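(* Let $S$ be an $\mathbb H^{r\times s}$-valued left hyperholomorphic function on $\mathcal E$. Then $S$ is a Schur multiplier if and only if $S(x)=\sum_{n\ge0}P_n(x)S_n$ on $\mathcal E$ for some $S_n\in\mathbb H^{r\times s}$ such that the lower triangular block Toeplitz operator $\mathscr T=(\mathscr T_{jk})_{j,k\ge0}$, with $\mathscr T_{jk}=S_{j-k}$ for $j\ge k$ and $\mathscr T_{jk}=0$ for $j<k$, is a contraction from $\ell_2(\mathbb N_0,\mathbb H^s)$ into $\ell_2(\mathbb N_0,\mathbb H^r)$.
   Context: For $m\ge0$, $T^m_j=\frac{2(m-j+1)}{(m+1)(m+2)}$, $c_m=\sum_{j=0}^m(-1)^jT^m_j$, $P_m(x)=\frac1{c_m}\sum_{j=0}^mT^m_jx^{m-j}\overline{x}^{\,j}$. $\mathcal E=\{x\in\mathbb H:9x_0^2+x_1^2+x_2^2+x_3^2<1\}$. Left hyperholomorphic (entrywise) means annihilated by $D=\partial_{x_0}+\sum_{i=1}^3\mathbf e_i\partial_{x_i}$. $\odot$ is the Cauchy–Kovalevskaya product $f\odot g=CK(f|_{x_0=0}g|_{x_0=0})$ (entrywise matrix product of restrictions, then unique hyperholomorphic extension); for $S=\sum_mP_mS_m$ one has $P_n\odot S=\sum_mP_{n+m}S_m$. An $\mathbb H^{r\times r}$-valued kernel $K(x,y)$ is positive definite on a set $\Omega$ if for all $N$, $y_1,\dots,y_N\in\Omega$, $u_1,\dots,u_N\in\mathbb H^r$, $\sum_{i,j}u_i^*K(y_i,y_j)u_j\ge0$.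 An $\mathbb H^{r\times s}$-valued hyperholomorphic $S$ is a Schur multiplier if the kernel $K_S(x,y)=\sum_{n\ge0}\big(P_n(x)\overline{P_n(y)}I_r-(P_n\odot S)(x)((P_n\odot S)(y))^*\big)$ converges and is positive definite on $\mathcal E$. *)

(* Defs.v *)
From HB Require Import structures.
From mathcomp Require Import all_boot all_order all_algebra.
From mathcomp Require Import all_classical all_reals all_analysis.
Set Implicit Arguments. Unset Strict Implicit. Unset Printing Implicit Defensive.
Import Order.TTheory GRing.Theory Num.Theory.
Import numFieldNormedType.Exports.
Local Open Scope classical_set_scope.
Local Open Scope ring_scope.

Section Quaternions.
Variable R : realType.

(* Real quaternions x = x0 + x1 e1 + x2 e2 + x3 e3, identified with R^4
   (row vectors of length 4, carrying MathComp-Analysis' normed topology). *)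
Definition quat := 'rV[R]_4.

Definition qc (x : quat) (n : nat) : R := x ord0 (inord n).

Definition qmk (a0 a1 a2 a3 : R) : quat :=
  \row_(k < 4) nth 0 [:: a0; a1; a2; a3] k.

(* Hamilton product (e1 e2 = e3, e2 e3 = e1, e3 e1 = e2, ei^2 = -1). *)
Definition qmul (a b : quat) : quat :=
  qmk (qc a 0 * qc b 0 - qc a 1 * qc b 1 - qc a 2 * qc b 2 - qc a 3 * qc b 3)
      (qc a 0 * qc b 1 + qc a 1 * qc b 0 + qc a 2 * qc b 3 - qc a 3 * qc b 2)
      (qc a 0 * qc b 2 - qc a 1 * qc b 3 + qc a 2 * qc b 0 + qc a 3 * qc b 1)
      (qc a 0 * qc b 3 + qc a 1 * qc b 2 - qc a 2 * qc b 1 + qc a 3 * qc b 0).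

Definition qconj (a : quat) : quat := qmk (qc a 0) (- qc a 1) (- qc a 2) (- qc a 3).

Definition qone : quat := qmk 1 0 0 0.

Definition qe (i : nat) : quat := \row_(k < 4) (if val k == i then 1 else 0).

Fixpoint qpow (x : quat) (n : nat) : quat :=
  if n is n'.+1 then qmul x (qpow x n') else qone.

Definition qnonneg (q : quat) : Prop :=
  [/\ qc q 1 = 0, qc q 2 = 0, qc q 3 = 0 & 0 <= qc q 0].

Definition qnorm2 (q : quat) : R := \sum_(c < 4) (q ord0 c) ^+ 2.
Definition vnorm2 (n : nat) (v : 'I_n -> quat) : R := \sum_(k < n) qnorm2 (v k).

Definition Ell : set quat :=
  [set x | 9 * qc x 0 ^+ 2 + qc x 1 ^+ 2 + qc x 2 ^+ 2 + qc x 3 ^+ 2 < 1].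

Definition Tco (m j : nat) : R :=
  (2 * ((m - j).+1)%:R) / ((m.+1)%:R * (m.+2)%:R).

Definition cco (m : nat) : R := \sum_(j < m.+1) (-1) ^+ j * Tco m j.

Definition Pm (m : nat) (x : quat) : quat :=
  (cco m)^-1 *: \sum_(j < m.+1) (Tco m j *: qmul (qpow x (m - j)) (qpow (qconj x) j)).

Definition Dop (f : quat -> quat) (x : quat) : quat :=
  'D_(qe 0) f x + \sum_(i < 3) qmul (qe i.+1) ('D_(qe i.+1) f x).

Definition hyperholo (U : set quat) (f : quat -> quat) : Prop :=
  (forall x, U x -> differentiable f x) /\
  (forall (i : 'I_4) x, U x -> {for x, continuous ('D_(qe i) f)}) /\
  (forall x, U x -> Dop f x = 0).

Definition hyperholo_mx (r s : nat) (U : set quat) (F : quat -> 'M[quat]_(r, s)) : Prop :=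
  forall (a : 'I_r) (b : 'I_s), hyperholo U (fun x => F x a b).

(* G is the Cauchy–Kovalevskaya product P_n ⊙ S on E: the hyperholomorphic
   function on E whose restriction to {x0 = 0} is the entrywise product
   P_n|_{x0=0} S|_{x0=0} (such an extension is unique). *)
Definition is_CKprod_P (r s : nat) (n : nat) (S G : quat -> 'M[quat]_(r, s)) : Prop :=
  hyperholo_mx Ell G /\
  forall x, Ell x -> qc x 0 = 0 -> forall a b, G x a b = qmul (Pm n x) (S x a b).

(* n-th term of the kernel K_S, given G n = P_n ⊙ S *)
Definition Kterm (r s : nat) (G : nat -> quat -> 'M[quat]_(r, s)) (n : nat)
    (x y : quat) (a b : 'I_r) : quat :=
  (if a == b then qmul (Pm n x) (qconj (Pm n y)) else 0)
  - \sum_(k < s) qmul (G n x a k) (qconj (G n y b k)).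

Definition pos_def_kernel (r : nat) (K : quat -> quat -> 'I_r -> 'I_r -> quat) : Prop :=
  forall (N : nat) (ys : 'I_N -> quat) (us : 'I_N -> 'I_r -> quat),
    (forall i, Ell (ys i)) ->
    qnonneg (\sum_(i < N) \sum_(j < N) \sum_(a < r) \sum_(b < r)
               qmul (qmul (qconj (us i a)) (K (ys i) (ys j) a b)) (us j b)).

Definition schur_multiplier (r s : nat) (S : quat -> 'M[quat]_(r, s)) : Prop :=
  exists G : nat -> quat -> 'M[quat]_(r, s),
    (forall n, is_CKprod_P n S (G n)) /\
    exists K : quat -> quat -> 'I_r -> 'I_r -> quat,
      (forall x y, Ell x -> Ell y -> forall a b,
         (fun N => \sum_(n < N) Kterm G n x y a b) @ \oo --> K x y a b) /\
      pos_def_kernel K.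

Definition has_P_expansion (r s : nat) (S : quat -> 'M[quat]_(r, s))
    (Sn : nat -> 'M[quat]_(r, s)) : Prop :=
  forall x, Ell x -> forall a b,
    (fun N => \sum_(n < N) qmul (Pm n x) (Sn n a b)) @ \oo --> S x a b.

Definition l2norm2 (n : nat) (h : nat -> 'I_n -> quat) : \bar R :=
  (\sum_(0 <= j <oo) (vnorm2 (h j))%:E)%E.

Definition in_l2 (n : nat) (h : nat -> 'I_n -> quat) : Prop :=
  (l2norm2 h < +oo)%E.

Definition toeplitz_apply (r s : nat) (Sn : nat -> 'M[quat]_(r, s))
    (h : nat -> 'I_s -> quat) : nat -> 'I_r -> quat :=
  fun j a => \sum_(k < j.+1) \sum_(l < s) qmul (Sn (j - k)%N a l) (h k l).

Definition toeplitz_contraction (r s : nat) (Sn : nat -> 'M[quat]_(r, s)) : Prop :=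
  forall h : nat -> 'I_s -> quat, in_l2 h ->
    in_l2 (toeplitz_apply Sn h) /\ (l2norm2 (toeplitz_apply Sn h) <= l2norm2 h)%E.

End Quaternions.

(* Main.v *)
Require Import Defs.
From HB Require Import structures.
From mathcomp Require Import all_boot all_order all_algebra.
From mathcomp Require Import all_classical all_reals all_analysis.
From mathcomp Require Import ring lra.
Set Implicit Arguments. Unset Strict Implicit. Unset Printing Implicit Defensive.
Import Order.TTheory GRing.Theory Num.Theory.
Import numFieldNormedType.Exports.
Local Open Scope classical_set_scope.
Local Open Scope ring_scope.

(* A hyperholomorphic function on the ellipsoid is determined by its values on
   [{x0 = 0}], where [P_n(x) = x^n]; thus both implications reduce to statements
   about imaginary points.

   Uniqueness: if [f] vanishes on [{x0 = 0}], so do its first derivatives, and [f]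
   extended by zero to one side is still a C^1 solution of [D f = 0]. Steklov
   averages of its components have pure second derivatives with vanishing sum, and
   the maximum principle applied to [U(x) - U(x reflected)] minus a quadratic barrier
   gives [|U(q + h e0) - U(q - h e0)| <= C M h / rho] with [C] independent of the
   smoothing. Iterating on symmetric differences, the [k]-th difference in the
   direction [e0] is at most [(C k h / rho)^k M], and Newton's formula then
   propagates the zero set by a fixed step.

   If [S] is a Schur multiplier, positivity of [K_S] at imaginary points says that
   [(conj(y^n) u)_n |-> (conj(S y) conj(y^n) u)_n] is contractive on linear
   combinations. The closure of this graph is invariant under the backward shift and
   contains all finitely supported sequences in its domain, so it is the adjoint of a
   block Toeplitz contraction, whose coefficients are the [S_n].

   Conversely, [P_n (.) S = sum_m P_(n+m) S_m], and the quadratic form of [K_S] is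
   [|h|^2 - |T^* h|^2] for [h_n = sum_j conj(P_n(y_j)) u_j]. *)

(** * Quaternions *)

(** [hyperholo] grants only continuous first derivatives: neither a Taylor expansion nor a second
    derivative of [S] is at hand, and this shapes the uniqueness part. Since conj(D) D is the
    Laplacian, the components of a solution are harmonic in a weak sense; averaging along all four
    axes makes this literal, because derivatives of averages are difference quotients, which
    commute. The factor [h / rho] gained by each symmetric difference replaces analyticity.
    Splitting the radius into [k] layers costs [k ^ k], which [h] of order [rho / k] absorbs, so the
    propagation step does not shrink with [k].

    Imaginary points matter because [P_(n+1)(y) = y P_n(y)] there, which ties positivity of the
    kernel to the shift. The [S_n] are read off the adjoint at unit sequences and are never
    derivatives of [S]. Contractivity bounds their entries by 1, and the ellipsoid lies in the unit
    ball, where [|P_m(x)|] grows at most like [(m + 2) |x|^m]; so the series converges to a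
    hyperholomorphic function, which uniqueness identifies with [S]. *)

Section QuatCoordinates.
Variable R : realType.
Implicit Types a b c x y : quat R.

Lemma qcE a (k : 'I_4) : a ord0 k = qc a k.
Proof. by rewrite /qc inord_val. Qed.

Lemma quatP a b : qc a 0 = qc b 0 -> qc a 1 = qc b 1 -> qc a 2 = qc b 2 ->
  qc a 3 = qc b 3 -> a = b.
Proof.
move=> h0 h1 h2 h3; apply/rowP => k; rewrite !qcE.
by case: k => [[|[|[|[|]]]]].
Qed.

Lemma qcD n a b : qc (a + b) n = qc a n + qc b n. Proof. by rewrite /qc mxE. Qed.
Lemma qcN n a : qc (- a) n = - qc a n. Proof. by rewrite /qc mxE. Qed.
Lemma qcB n a b : qc (a - b) n = qc a n - qc b n. Proof. by rewrite qcD qcN. Qed.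
Lemma qcZ n t a : qc (t *: a) n = t * qc a n. Proof. by rewrite /qc mxE. Qed.
Lemma qc_0 n : qc (0 : quat R) n = 0. Proof. by rewrite /qc mxE. Qed.
Lemma qc_sum n (I : Type) (r : seq I) (P : pred I) (F : I -> quat R) :
  qc (\sum_(i <- r | P i) F i) n = \sum_(i <- r | P i) qc (F i) n.
Proof. by rewrite /qc summxE. Qed.

Lemma qc_mk (t0 t1 t2 t3 : R) : ((qc (qmk t0 t1 t2 t3 : quat R) 0 = t0) *
  (qc (qmk t0 t1 t2 t3 : quat R) 1 = t1) *
  (qc (qmk t0 t1 t2 t3 : quat R) 2 = t2) * (qc (qmk t0 t1 t2 t3 : quat R) 3 = t3))%type.
Proof. by rewrite /qc /qmk !mxE !inordK. Qed.

Lemma qc_e i n : (n < 4)%N -> qc (qe R i) n = if n == i then 1 else 0.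
Proof. by move=> n4; rewrite /qc /qe mxE /= inordK. Qed.

Definition qcsimp := (qcD, qcN, qcZ, qc_0, qc_mk).

Lemma qc_qe : (((qc (qe R 0) 0 = 1) * (qc (qe R 0) 1 = 0) * (qc (qe R 0) 2 = 0) * (qc (qe R 0) 3 = 0))
 * ((qc (qe R 1) 0 = 0) * (qc (qe R 1) 1 = 1) * (qc (qe R 1) 2 = 0) * (qc (qe R 1) 3 = 0))
 * ((qc (qe R 2) 0 = 0) * (qc (qe R 2) 1 = 0) * (qc (qe R 2) 2 = 1) * (qc (qe R 2) 3 = 0))
 * ((qc (qe R 3) 0 = 0) * (qc (qe R 3) 1 = 0) * (qc (qe R 3) 2 = 0) * (qc (qe R 3) 3 = 1)))%type.
Proof. by rewrite !qc_e. Qed.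

End QuatCoordinates.

Ltac qring := apply: quatP; rewrite /qmul /qconj /qone ?(qcsimp, qc_qe); ring.

Section QuatAlgebra.
Variable R : realType.
Implicit Types a b c x y : quat R.

Lemma qmulA a b c : qmul a (qmul b c) = qmul (qmul a b) c. Proof. qring. Qed.
Lemma qmulDl a b c : qmul (a + b) c = qmul a c + qmul b c. Proof. qring. Qed.
Lemma qmulDr a b c : qmul a (b + c) = qmul a b + qmul a c. Proof. qring. Qed.
Lemma qmulNr a b : qmul a (- b) = - qmul a b. Proof. qring. Qed.
Lemma qmulBl a b c : qmul (a - b) c = qmul a c - qmul b c. Proof. qring. Qed.
Lemma qmulBr a b c : qmul a (b - c) = qmul a b - qmul a c. Proof. qring. Qed.
Lemma qmulZl t a b : qmul (t *: a) b = t *: qmul a b. Proof. qring. Qed.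
Lemma qmulZr t a b : qmul a (t *: b) = t *: qmul a b. Proof. qring. Qed.
Lemma qmul0l a : qmul 0 a = 0. Proof. qring. Qed.
Lemma qmul0r a : qmul a 0 = 0. Proof. qring. Qed.
Lemma qmul1l a : qmul (qone R) a = a. Proof. qring. Qed.
Lemma qmul1r a : qmul a (qone R) = a. Proof. qring. Qed.
Lemma qconjM a b : qconj (qmul a b) = qmul (qconj b) (qconj a). Proof. qring. Qed.
Lemma qconjD a b : qconj (a + b) = qconj a + qconj b. Proof. qring. Qed.
Lemma qconjZ t a : qconj (t *: a) = t *: qconj a. Proof. qring. Qed.
Lemma qconjN a : qconj (- a) = - qconj a. Proof. qring. Qed.
Lemma qconj0 : qconj (0 : quat R) = 0. Proof. qring. Qed.
Lemma qconjK a : qconj (qconj a) = a. Proof. qring. Qed.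
Lemma qconj1 : qconj (qone R) = qone R. Proof. qring. Qed.
Lemma qmul_conjC x : qmul x (qconj x) = qmul (qconj x) x. Proof. qring. Qed.

Lemma qmul_suml (I : Type) (r : seq I) (P : pred I) (F : I -> quat R) a :
  qmul (\sum_(i <- r | P i) F i) a = \sum_(i <- r | P i) qmul (F i) a.
Proof.
by elim/big_rec2 : _ => [|i y1 y2 _ <-]; rewrite ?qmul0l ?qmulDl.
Qed.
Lemma qmul_sumr (I : Type) (r : seq I) (P : pred I) (F : I -> quat R) a :
  qmul a (\sum_(i <- r | P i) F i) = \sum_(i <- r | P i) qmul a (F i).
Proof.
by elim/big_rec2 : _ => [|i y1 y2 _ <-]; rewrite ?qmul0r ?qmulDr.
Qed.
Lemma qconj_sum (I : Type) (r : seq I) (P : pred I) (F : I -> quat R) :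
  qconj (\sum_(i <- r | P i) F i) = \sum_(i <- r | P i) qconj (F i).
Proof.
by elim/big_rec2 : _ => [|i y1 y2 _ <-]; rewrite ?qconj0 ?qconjD.
Qed.

Definition qdot a b := \sum_(k < 4) qc a k * qc b k.
Lemma qdotE a b : qdot a b = qc a 0 * qc b 0 + qc a 1 * qc b 1 + qc a 2 * qc b 2 + qc a 3 * qc b 3.
Proof. by rewrite /qdot !big_ord_recr big_ord0 /= add0r. Qed.

Lemma qnorm2E a : qnorm2 a = qc a 0 ^+ 2 + qc a 1 ^+ 2 + qc a 2 ^+ 2 + qc a 3 ^+ 2.
Proof.
by rewrite /qnorm2; under eq_bigr do rewrite qcE; rewrite !big_ord_recr big_ord0 /= add0r.
Qed.

Lemma qdotxx a : qdot a a = qnorm2 a. Proof. by rewrite qdotE qnorm2E; ring. Qed.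
Lemma qdotC a b : qdot a b = qdot b a. Proof. by rewrite !qdotE; ring. Qed.
Lemma qdotDl a b c : qdot (a + b) c = qdot a c + qdot b c.
Proof. by rewrite !qdotE !qcsimp; ring. Qed.
Lemma qdotDr a b c : qdot a (b + c) = qdot a b + qdot a c.
Proof. by rewrite !qdotE !qcsimp; ring. Qed.
Lemma qdotZl t a b : qdot (t *: a) b = t * qdot a b.
Proof. by rewrite !qdotE !qcsimp; ring. Qed.
Lemma qdotZr t a b : qdot a (t *: b) = t * qdot a b.
Proof. by rewrite !qdotE !qcsimp; ring. Qed.
Lemma qdot0l a : qdot 0 a = 0. Proof. by rewrite !qdotE !qcsimp; ring. Qed.
Lemma qdot0r a : qdot a 0 = 0. Proof. by rewrite !qdotE !qcsimp; ring. Qed.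
Lemma qdot_suml (I : Type) (r : seq I) (P : pred I) (F : I -> quat R) a :
  qdot (\sum_(i <- r | P i) F i) a = \sum_(i <- r | P i) qdot (F i) a.
Proof.
by elim/big_rec2 : _ => [|i y1 y2 _ <-]; rewrite ?qdot0l ?qdotDl.
Qed.
Lemma qdot_sumr (I : Type) (r : seq I) (P : pred I) (F : I -> quat R) a :
  qdot a (\sum_(i <- r | P i) F i) = \sum_(i <- r | P i) qdot a (F i).
Proof.
by elim/big_rec2 : _ => [|i y1 y2 _ <-]; rewrite ?qdot0r ?qdotDr.
Qed.

Lemma qdot_mull p a b : qdot (qmul p a) b = qdot a (qmul (qconj p) b).
Proof. by rewrite !qdotE /qmul /qconj !qcsimp; ring. Qed.

Lemma qnorm2_ge0 a : 0 <= qnorm2 a.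
Proof. by rewrite sumr_ge0 // => i _; rewrite sqr_ge0. Qed.
Lemma qnorm2_eq0 a : qnorm2 a = 0 -> a = 0.
Proof.
move=> /eqP; rewrite psumr_eq0; last by move=> i _; rewrite sqr_ge0.
move=> /allP h; apply/rowP => k; rewrite mxE.
by have := h k (mem_index_enum _); rewrite implyTb sqrf_eq0 => /eqP.
Qed.
Lemma qnorm2M a b : qnorm2 (qmul a b) = qnorm2 a * qnorm2 b.
Proof. by rewrite !qnorm2E /qmul !qcsimp; ring. Qed.
Lemma qnorm2_conj a : qnorm2 (qconj a) = qnorm2 a.
Proof. by rewrite !qnorm2E /qconj !qcsimp; ring. Qed.
Lemma qnorm2Z t a : qnorm2 (t *: a) = t ^+ 2 * qnorm2 a.
Proof. by rewrite !qnorm2E !qcsimp; ring. Qed.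
Lemma qnorm2N a : qnorm2 (- a) = qnorm2 a.
Proof. by rewrite !qnorm2E !qcsimp; ring. Qed.
Lemma qnorm2_0 : qnorm2 (0 : quat R) = 0.
Proof. by rewrite !qnorm2E !qcsimp; ring. Qed.
Lemma qmul_conjx a : qmul (qconj a) a = qnorm2 a *: qone R.
Proof. apply: quatP; rewrite qnorm2E /qmul /qconj /qone !qcsimp; ring. Qed.

Lemma qdot_sqr_le a b : qdot a b ^+ 2 <= qnorm2 a * qnorm2 b.
Proof.
rewrite -subr_ge0.
(* Lagrange identity *)
have -> : qnorm2 a * qnorm2 b - qdot a b ^+ 2 =
  (qc a 0 * qc b 1 - qc a 1 * qc b 0) ^+ 2 + (qc a 0 * qc b 2 - qc a 2 * qc b 0) ^+ 2 +
  (qc a 0 * qc b 3 - qc a 3 * qc b 0) ^+ 2 + (qc a 1 * qc b 2 - qc a 2 * qc b 1) ^+ 2 +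
  (qc a 1 * qc b 3 - qc a 3 * qc b 1) ^+ 2 + (qc a 2 * qc b 3 - qc a 3 * qc b 2) ^+ 2.
  by rewrite !qnorm2E qdotE; ring.
by rewrite !addr_ge0 // sqr_ge0.
Qed.

(** The Euclidean norm, multiplicative for [qmul]. The norm carried by row vectors is the maximum
    norm; the two agree up to a factor 2. *)
Definition qn a := Num.sqrt (qnorm2 a).
Lemma qn_ge0 a : 0 <= qn a. Proof. exact: sqrtr_ge0. Qed.
Lemma qn_sqr a : qn a ^+ 2 = qnorm2 a. Proof. by rewrite sqr_sqrtr // qnorm2_ge0. Qed.
Lemma qnM a b : qn (qmul a b) = qn a * qn b.
Proof. by rewrite /qn qnorm2M sqrtrM // qnorm2_ge0. Qed.
Lemma qn_conj a : qn (qconj a) = qn a. Proof. by rewrite /qn qnorm2_conj. Qed.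
Lemma qnN a : qn (- a) = qn a. Proof. by rewrite /qn qnorm2N. Qed.
Lemma qnZ t a : qn (t *: a) = `|t| * qn a.
Proof. by rewrite /qn qnorm2Z sqrtrM ?sqr_ge0 // sqrtr_sqr. Qed.
Lemma qn0 : qn 0 = 0. Proof. by rewrite /qn qnorm2_0 sqrtr0. Qed.
Lemma qn1 : qn (qone R) = 1.
Proof. by rewrite /qn qnorm2E /qone !qcsimp expr1n !expr0n /= !addr0 sqrtr1. Qed.
Lemma qn_eq0 a : qn a = 0 -> a = 0.
Proof. by move=> h; apply: qnorm2_eq0; rewrite -qn_sqr h expr0n. Qed.
Lemma qdot_le a b : qdot a b <= qn a * qn b.
Proof.
have [h|/ltW h] := leP (qdot a b) 0; first by rewrite (le_trans h) // mulr_ge0 ?qn_ge0.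
rewrite -(@ler_pXn2r _ 2) ?nnegrE ?mulr_ge0 ?qn_ge0 //.
by rewrite exprMn !qn_sqr qdot_sqr_le.
Qed.
Lemma qnD a b : qn (a + b) <= qn a + qn b.
Proof.
rewrite -(@ler_pXn2r _ 2) ?nnegrE ?addr_ge0 ?qn_ge0 //.
rewrite qn_sqr -qdotxx qdotDl !qdotDr !qdotxx (qdotC b a) sqrrD !qn_sqr.
have := qdot_le a b; lra.
Qed.
Lemma qnB a b : qn (a - b) <= qn a + qn b.
Proof. by rewrite (le_trans (qnD _ _)) // qnN. Qed.
Lemma qnBC a b : qn (a - b) = qn (b - a). Proof. by rewrite -qnN opprB. Qed.
Lemma qn_sum (I : Type) (r : seq I) (P : pred I) (F : I -> quat R) :
  qn (\sum_(i <- r | P i) F i) <= \sum_(i <- r | P i) qn (F i).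
Proof.
elim/big_rec2 : _ => [|i y1 y2 _ h]; first by rewrite qn0.
by rewrite (le_trans (qnD _ _)) // lerD2l.
Qed.

Lemma qc_le_qn a (k : 'I_4) : `|qc a k| <= qn a.
Proof.
rewrite -sqrtr_sqr ler_wsqrtr // /qnorm2 (bigD1 k) //= qcE lerDl.
by rewrite sumr_ge0 // => i _; rewrite sqr_ge0.
Qed.

Lemma normq_le a M : 0 <= M -> (forall k : 'I_4, `|qc a k| <= M) -> `|a| <= M.
Proof.
move=> M0 h; rewrite [X in X <= _]/Num.norm /= mx_normrE; apply/bigmax_leP; split => // -[i k] _ /=.
by rewrite (ord1 i) qcE h.
Qed.
Lemma qc_le_norm a (k : 'I_4) : `|qc a k| <= `|a|.
Proof.
rewrite [X in _ <= X]/Num.norm /= mx_normrE -qcE.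
by apply: (le_trans _ (le_bigmax _ _ (ord0, k))).
Qed.
Lemma norm_le_qn a : `|a| <= qn a.
Proof. by apply: normq_le => [|k]; rewrite ?qn_ge0 ?qc_le_qn. Qed.
Lemma qn_le_norm a : qn a <= 2 * `|a|.
Proof.
have -> : 2 * `|a| = Num.sqrt (4 * `|a| ^+ 2).
  by rewrite (_ : 4 * _ = (2 * `|a|) ^+ 2) ?sqrtr_sqr ?ger0_norm ?mulr_ge0 //; ring.
rewrite ler_wsqrtr // qnorm2E.
have h (k : 'I_4) : qc a k ^+ 2 <= `|a| ^+ 2.
  by rewrite -[qc a k ^+ 2]real_normK ?num_real // lerXn2r ?nnegrE // qc_le_norm.
have /= := (h (@Ordinal 4 0 isT), h (@Ordinal 4 1 isT), h (@Ordinal 4 2 isT), h (@Ordinal 4 3 isT)).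
move=> [[[h0 h1] h2] h3]; lra.
Qed.

End QuatAlgebra.

(** * Derivatives and averages on the real line *)

Section RealLine.
Variable R : realType.
Implicit Types (f g : R -> R) (x d : R).

(** Derivative in epsilon-delta form with weak inequalities. Both sides vanish at [t = 0], so no
    punctured neighbourhood is involved, and bounds under an integral sign can be stated
    directly. *)
Definition hasd f x d := forall eta : R, 0 < eta -> exists2 del : R, 0 < del &
  forall t : R, `|t| <= del -> `|f (x + t) - f x - t * d| <= eta * `|t|.

Lemma hasd_is_derive f x d : hasd f x d -> is_derive x (1 : R) f d.
Proof.
move=> h.
have c : (fun t : R => t^-1 *: (f (t *: (1 : R) + x) - f x)) @ 0^' --> d.
  apply/cvgrPdist_le => e e0; have [del d0 H] := h _ e0.
  near=> t.
  have t0 : t != 0 by near: t; exact: nbhs_dnbhs_neq.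
  have td : `|t| <= del.
    near: t; apply: dnbhs0_le => //.
  have := H t td; rewrite [x + t]addrC.
  rewrite -ler_pdivrMr ?normr_gt0 // -normfV mulrC -normrM; congr (_ <= _).
  rewrite -normrN; congr (`| _ |).
  by rewrite /GRing.scale /= mulr1 opprB; field.
apply: DeriveDef; first by apply/cvg_ex; exists d.
by apply: cvg_lim.
Unshelve. all: by end_near. Qed.

Lemma is_derive_hasd f x d : is_derive x (1 : R) f d -> hasd f x d.
Proof.
move=> [dv <-] e e0.
have /cvgrPdist_le/(_ _ e0) : (fun t : R => t^-1 *: (f (t *: (1 : R) + x) - f x)) @ 0^' --> 'D_1 f x.
  exact: dv.
move=> /nbhs_ballP[del /= d0 H].
exists (del / 2); first by rewrite divr_gt0.
move=> t td; have [->|t0] := eqVneq t 0.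
  by rewrite addr0 mul0r subr0 subrr normr0 mulr0.
have : ball (0 : R) del t.
  by rewrite /ball /= sub0r normrN (le_lt_trans td) // ltr_pdivrMr // ltr_pMr // ltr1n.
move=> /H /(_ t0); rewrite -ler_pdivrMr ?normr_gt0 // -normfV [X in _ -> X <= _]mulrC -normrM.
rewrite -normrN opprB; congr (_ <= _); congr (`| _ |).
by rewrite /GRing.scale /= mulr1 [x + t]addrC; field.
Qed.

Lemma hasd_uniq f x d d' : hasd f x d -> hasd f x d' -> d = d'.
Proof.
by move=> /hasd_is_derive h /hasd_is_derive h'; rewrite -(derive_val (is_derive := h)) -(derive_val (is_derive := h')).
Qed.

Lemma hasd_cts f x d : hasd f x d -> forall eta : R, 0 < eta -> exists2 del : R, 0 < del &
  forall t : R, `|t| <= del -> `|f (x + t) - f x| <= eta.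
Proof.
move=> h e e0; have [del d0 H] := h _ ltr01.
exists (Num.min del (e / (1 + `|d|))).
  by rewrite lt_min d0 divr_gt0 // ltr_pwDl.
move=> t; rewrite le_min => /andP[t1 t2].
have h1 := H t t1.
rewrite (_ : f (x + t) - f x = (f (x + t) - f x - t * d) + t * d); last by ring.
rewrite (le_trans (ler_normD _ _)) // normrM.
rewrite (le_trans (lerD h1 (lexx _))) //.
by rewrite mul1r -{1}[`|t|]mulr1 -mulrDr -ler_pdivlMr // ltr_pwDl.
Qed.

Lemma within_cts f (A : set R) : (forall x, A x -> forall eta : R, 0 < eta ->
   exists2 del : R, 0 < del & forall y : R, A y -> `|x - y| <= del -> `|f x - f y| <= eta) ->
  {within A, continuous f}.
Proof.
move=> h; apply/subspace_continuousP => x Ax.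
apply/cvgrPdist_le => e e0; have [del d0 H] := h x Ax _ e0.
apply/nbhs_ballP; exists del => //= y /ltW xy Ay; exact: H.
Qed.

Lemma hasd_within f (A : set R) df : (forall x, A x -> hasd f x (df x)) ->
  {within A, continuous f}.
Proof.
move=> h; apply: within_cts => x Ax e e0.
have [del d0 H] := hasd_cts (h x Ax) e0; exists del => // y _ xy.
by have := H (y - x); rewrite [x + _]addrC subrK distrC [`|f _ - _|]distrC; apply.
Qed.

Lemma hasd_MVT f df (a b : R) : a < b -> (forall x, a <= x <= b -> hasd f x (df x)) ->
  exists2 c, a < c < b & f b - f a = df c * (b - a).
Proof.
move=> ab h; have [||c] := @MVT R f df a b ab.
- by move=> x; rewrite in_itv /= => /andP[/ltW ax /ltW xb]; apply: hasd_is_derive; apply: h; rewrite ax.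
- by apply: (@hasd_within _ _ df) => x /=; rewrite in_itv /=; apply: h.
by rewrite in_itv /= => cab ->; exists c.
Qed.

Lemma hasd_MVT0 f df (t : R) : (forall u, `|u| <= `|t| -> hasd f u (df u)) ->
  exists2 c, `|c| <= `|t| & f t - f 0 = df c * t.
Proof.
move=> h; have [t0|t0|->] := ltgtP t 0; last by exists 0; rewrite ?subrr ?mulr0.
- have [|c /andP[c1 c2]] := @hasd_MVT f df t 0 t0.
    by move=> u /andP[u1 u2]; apply: h; rewrite !ler0_norm ?lerN2 // ltW.
  rewrite sub0r => e; exists c; last by rewrite -opprB e mulrN opprK.
  by rewrite !ltr0_norm // lerN2 ltW.
- have [|c /andP[c1 c2]] := @hasd_MVT f df 0 t t0.
    by move=> u /andP[u1 u2]; apply: h; rewrite !ger0_norm // ltW.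
  by rewrite subr0 => e; exists c; rewrite // !gtr0_norm // ltW.
Qed.

(** A nonzero [df x] would let [f] increase in the direction of its sign. If [df x = 0], then [df]
    is positive just to the right of [x], and the mean value theorem gives a larger value there. *)
Lemma second_derivative_test f df x (s rho : R) : 0 < rho -> 0 < s ->
  (forall t, `|t| <= rho -> hasd f (x + t) (df (x + t))) -> hasd df x s ->
  ~ (forall t, `|t| <= rho -> f (x + t) <= f x).
Proof.
move=> r0 s0 h h2 mx.
have d0 : df x = 0.
  apply/eqP/negPn/negP => dn.
  have z0 : `|0 : R| <= rho by rewrite normr0 ltW.
  have z1 : 0 < `|df x| / 2 by rewrite divr_gt0 ?normr_gt0.
  have [del d0 H] := h 0 z0 _ z1.
  pose t := Num.sg (df x) * Num.min del rho.
  have mp : 0 < Num.min del rho by rewrite lt_min d0 r0.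
  have at_ : `|t| = Num.min del rho.
    by rewrite /t normrM normr_sg dn mul1r gtr0_norm.
  have := H t; rewrite at_ ge_min lexx => /(_ isT); rewrite !addr0.
  have := mx t; rewrite at_ ge_min lexx orbT => /(_ isT) m1.
  have -> : t * df x = Num.min del rho * `|df x|.
    by rewrite /t mulrAC -normrEsg mulrC.
  rewrite ler_norml => /andP[+ _].
  have : 0 < Num.min del rho * `|df x| by rewrite mulr_gt0 ?normr_gt0.
  by set u := Num.min _ _ in mp *; nra.
have [|del de0 H] := h2 (s / 2); first by rewrite divr_gt0.
pose t := Num.min del rho.
have t0 : 0 < t by rewrite lt_min de0.
have [||c /andP[c1 c2]] := @hasd_MVT f df x (x + t).
- by rewrite ltrDl.
- move=> y /andP[y1 y2]; rewrite -[y](subrK x) [_ + x]addrC; apply: h.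
  rewrite ger0_norm ?subr_ge0 // lerBlDl (le_trans y2) // lerD2l /t ge_min lexx orbT //.
have := mx t; rewrite gtr0_norm // {1}/t ge_min lexx orbT => /(_ isT) m2.
have := H (c - x); rewrite gtr0_norm ?subr_gt0 // {1}/t => /(_ _) H1.
have {}H1 : `|df (x + (c - x)) - df x - (c - x) * s| <= s / 2 * (c - x).
  apply: H1; rewrite lerBlDl (le_trans (ltW c2)) // lerD2l /t ge_min lexx //.
move: H1; rewrite d0 addrCA subrr addr0 subr0 ler_norml => /andP[H1 _].
have dc : 0 < df c by have : 0 < (c - x) * s; [rewrite mulr_gt0 ?subr_gt0|nra].
rewrite addrAC subrr add0r => e.
have : 0 < df c * t by rewrite mulr_gt0.
lra.
Qed.

Lemma hasdD f g x d d' : hasd f x d -> hasd g x d' -> hasd (fun t => f t + g t) x (d + d').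
Proof.
move=> h h' e e0; have e2 : 0 < e / 2 by rewrite divr_gt0.
have [u u0 H] := h _ e2; have [v v0 H'] := h' _ e2.
exists (Num.min u v) => [|t]; first by rewrite lt_min u0.
rewrite le_min => /andP[/H k /H' k'].
rewrite (_ : _ - _ = (f (x + t) - f x - t * d) + (g (x + t) - g x - t * d')); last by ring.
rewrite (le_trans (ler_normD _ _)) // (le_trans (lerD k k')) // -mulrDl.
by rewrite -splitr.
Qed.

Lemma hasdZ f x d (c : R) : hasd f x d -> hasd (fun t => c * f t) x (c * d).
Proof.
move=> h e e0; have e2 : 0 < e / (1 + `|c|) by rewrite divr_gt0 // ltr_pwDl.
have [u u0 H] := h _ e2; exists u => // t /H k.
rewrite (_ : _ - _ = c * (f (x + t) - f x - t * d)); last by ring.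
rewrite normrM (le_trans (ler_wpM2l _ k)) //.
rewrite mulrA ler_wpM2r // mulrCA ler_piMr ?(ltW e0) //.
by rewrite ler_pdivrMr ?ltr_pwDl // mul1r lerDr.
Qed.

Lemma hasd_ext f g x d (rho : R) : 0 < rho -> (forall t, `|t| <= rho -> f (x + t) = g (x + t)) ->
  hasd f x d -> hasd g x d.
Proof.
move=> r0 h H e e0; have [u u0 k] := H e e0.
exists (Num.min u rho) => [|t]; first by rewrite lt_min u0.
rewrite le_min => /andP[/k k1 /h <-].
by have := h 0; rewrite normr0 ltW // addr0 => /(_ isT) <-.
Qed.

Lemma hasd_affine f x d (a b : R) : hasd f (a * x + b) d ->
  hasd (fun t => f (a * t + b)) x (a * d).
Proof.
move=> h e e0; have e2 : 0 < e / (1 + `|a|) by rewrite divr_gt0 // ltr_pwDl.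
have [u u0 H] := h _ e2; exists (u / (1 + `|a|)); first by rewrite divr_gt0 // ltr_pwDl.
move=> t; rewrite ler_pdivlMr ?ltr_pwDl // => tu.
have := H (a * t); rewrite normrM.
have k : `|a| * `|t| <= u.
  by apply: le_trans tu; rewrite mulrC ler_wpM2l // lerDr.
move=> /(_ k).
rewrite (_ : a * x + b + a * t = a * (x + t) + b); last by ring.
rewrite (_ : a * t * d = t * (a * d)); last by ring.
move=> /le_trans; apply; rewrite mulrA ler_wpM2r // mulrAC -mulrA ler_piMr ?(ltW e0) //.
by rewrite ler_pdivrMr ?ltr_pwDl // mul1r lerDr.
Qed.

Definition av f := \int[lebesgue_measure]_(s in `[0%R, 1%R]) f s.
Definition ct01 f := {within `[0%R, 1%R], continuous f}.

Lemma ct01_int f : ct01 f -> lebesgue_measure.-integrable `[0%R, 1%R] (EFin \o f).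
Proof. by move=> h; apply: continuous_compact_integrable => //; apply: segment_compact. Qed.

Lemma avD f g : ct01 f -> ct01 g -> av (fun s => f s + g s) = av f + av g.
Proof. by move=> hf hg; rewrite /av RintegralD //; apply: ct01_int. Qed.
Lemma avZ f (c : R) : ct01 f -> av (fun s => c * f s) = c * av f.
Proof. by move=> hf; rewrite /av RintegralZl //; apply: ct01_int. Qed.
Lemma av_ext f g : (forall s : R, 0 <= s <= 1 -> f s = g s) -> av f = av g.
Proof. by move=> h; apply: eq_Rintegral => s; rewrite inE /= in_itv /=; exact: h. Qed.
Lemma av_cst (c : R) : av (fun _ => c) = c.
Proof.
by rewrite /av Rintegral_cst //= lebesgue_measure_itv /= lte_fin ltr01 EFinN oppe0 adde0 /= mulr1.
Qed.
Lemma ct01_cst (c : R) : ct01 (fun _ => c).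
Proof. by apply: within_cts => x _ e e0; exists 1 => // y _ _; rewrite subrr normr0 ltW. Qed.
Lemma av_le f (c : R) : ct01 f -> (forall s : R, 0 <= s <= 1 -> `|f s| <= c) -> `|av f| <= c.
Proof.
move=> hf h; rewrite ler_norml -[X in X <= _]av_cst -[X in _ && (_ <= X)]av_cst.
apply/andP; split; apply: le_Rintegral => //; do ?[by apply: ct01_int => //; apply: ct01_cst];
  by move=> s /=; rewrite in_itv /= => /h; rewrite ler_norml => /andP[].
Qed.

(** Substitution turns the average into [(G (t + e) - G t) / e] for a primitive [G] of [f]; it is
    differentiable although [f] is merely continuous. The margin [a] keeps [0] and [e] interior to
    the interval of integration. *)
Lemma av_deriv f (e a : R) : 0 < e ->
  (forall t : R, - a <= t <= e + a -> forall eta : R, 0 < eta -> exists2 del : R, 0 < del &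
    forall u : R, - a <= u <= e + a -> `|t - u| <= del -> `|f t - f u| <= eta) -> 0 < a ->
  hasd (fun t => av (fun s => f (t + e * s))) 0 ((f e - f 0) / e).
Proof.
move=> e0 cf a0.
have a0' : - a < e + a by lra.
have wc : {within `[- a, e + a], continuous f}.
  by apply: within_cts => x; rewrite /= in_itv /= => /cf h eta /h[del d0 k]; exists del => // y; rewrite in_itv; apply: k.
have fi : lebesgue_measure.-integrable `[- a, e + a] (EFin \o f).
  by apply: continuous_compact_integrable => //; apply: segment_compact.
pose G t := \int[lebesgue_measure]_(s in `[- a, t]) f s.
have dG (t : R) : - a < t < e + a -> hasd G t (f t).
  move=> /andP[t1 t2].
  have cft : {for t, continuous f}.
    apply/cvgrPdist_le => eta eta0.
    have [|del d0 k] := cf t _ eta eta0; first by rewrite !ltW.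
    have m0 : 0 < Num.min del (Num.min (t + a) (e + a - t)).
      by rewrite !lt_min d0 /= subr_gt0 t2 andbT; lra.
    near=> u.
    have : `|t - u| <= Num.min del (Num.min (t + a) (e + a - t)).
      by near: u; apply: cvgr_dist_le => //; apply: cvg_id.
    rewrite !le_min => /and3P[h1 h2 h3]; apply: k => //.
    move: h2 h3; rewrite !ler_norml => /andP[? ?] /andP[? ?].
    by apply/andP; split; lra.
  have [dd <-] := @continuous_FTC1_closed R f (- a) t (e + a) t2 fi t1 cft.
  by apply: is_derive_hasd; rewrite derive1E; apply: DeriveDef.
have key (t : R) : `|t| <= a / 2 -> av (fun s => f (t + e * s)) = (G (t + e) - G t) / e.
  move=> ta.
  pose F s := e^-1 * G (e * s + t).
  have ta' : - (a/2) <= t /\ t <= a/2 by apply/andP; rewrite -ler_norml.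
  have inr (s : R) : 0 <= s <= 1 -> - a < e * s + t < e + a.
    move=> /andP[s0 s1]; have s2 : 0 <= e * s by rewrite mulr_ge0 // ltW.
    have s3 : e * s <= e by rewrite ger_pMr.
    by case: ta' => *; apply/andP; split; lra.
  have dF (s : R) : 0 <= s <= 1 -> hasd F s (f (t + e * s)).
    move=> /inr /dG h; have := hasdZ e^-1 (hasd_affine h).
    by rewrite mulrA mulVf ?gt_eqF // mul1r [t + _]addrC.
  have := @continuous_FTC2 R (fun s => f (t + e * s)) F 0 1 ltr01.
  rewrite /av /Rintegral => -> /=.
  - by rewrite /F mulr1 mulr0 add0r [t + e]addrC; field; rewrite gt_eqF.
  - apply: within_cts => s; rewrite /= in_itv /= => /inr s01 eta eta0.
    have [|del d0 k] := cf (t + e * s) _ _ eta0.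
      by rewrite [t + _]addrC; case/andP: s01 => *; rewrite !ltW.
    exists (del / e); first by rewrite divr_gt0.
    move=> u; rewrite in_itv /= => /inr u01; rewrite ler_pdivlMr // => su; apply: k.
      by rewrite [t + _]addrC; case/andP: u01 => *; rewrite !ltW.
    rewrite (_ : _ - _ = (s - u) * e); last by ring.
    by rewrite normrM (gtr0_norm e0).
  - have dr (s : R) : 0 <= s <= 1 -> derivable F s 1.
      by move=> /dF /hasd_is_derive[].
    have cF (s : R) : 0 <= s <= 1 -> {for s, continuous F}.
      by move=> /dr /derivable1_diffP; apply: differentiable_continuous.
    split.
    + by move=> s; rewrite in_itv /= => /andP[s0 s1]; apply: dr; rewrite !ltW.
    + by apply: cvg_at_right_filter; apply: cF; rewrite lexx ler01.
    + by apply: cvg_at_left_filter; apply: cF; rewrite lexx ler01.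
  - move=> s; rewrite in_itv /= => /andP[s0 s1]; rewrite derive1E.
    by have [] : is_derive s (1 : R) F (f (t + e * s)) by apply: hasd_is_derive; apply: dF; rewrite !ltW.
have h1 : hasd (fun t => (G (t + e) - G t) / e) 0 ((f e - f 0) / e).
  have dge : hasd G (1 * 0 + e) (f e) by rewrite mul1r add0r; apply: dG; apply/andP; split; lra.
  have dg0 : hasd G 0 (f 0) by apply: dG; apply/andP; split; lra.
  have := hasdZ e^-1 (hasdD (hasd_affine dge) (hasdZ (-1) dg0)).
  rewrite (_ : e^-1 * _ = (f e - f 0) / e); last by ring.
  apply: (@hasd_ext _ _ _ _ 1) => // t _; rewrite add0r mul1r; ring.
apply: hasd_ext h1; last first.
  by move=> t; rewrite add0r => /key ->.
by rewrite divr_gt0.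
Unshelve. all: by end_near. Qed.
End RealLine.

(** * Steklov averages *)

Section Steklov.
Variable R : realType.
Implicit Types (x y q : quat R) (g f : quat R -> R) (D : quat R -> Prop) (e rho t c eta M : R).

Lemma norm_qe i : `|qe R i| <= 1.
Proof.
apply: normq_le => // k; rewrite qc_e //; case: ifP => _; rewrite ?normr1 ?normr0 //.
Qed.
Lemma norm_tqe t i : `|t *: qe R i| <= `|t|.
Proof. by rewrite normrZ ler_piMr // norm_qe. Qed.

(* The norm of row vectors is the maximum norm, so these balls are cubes. *)
Definition inb q rho x := `|x - q| <= rho.

Lemma inbD q rho x e v : inb q (rho - e) x -> `|v| <= e -> inb q rho (x + v).
Proof.
rewrite /inb => h1 h2; rewrite addrAC (le_trans (ler_normD _ _)) //; lra.
Qed.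
Lemma inb_le q rho rho' x : rho <= rho' -> inb q rho x -> inb q rho' x.
Proof. by move=> h1 h2; apply: le_trans h1. Qed.

Opaque inb.

Definition UC D g := forall eta : R, 0 < eta -> exists2 del : R, 0 < del &
  forall x y, D x -> D y -> `|x - y| <= del -> `|g x - g y| <= eta.

Definition PD D i g g' := forall x, D x -> hasd (fun t => g (x + t *: qe R i)) 0 (g' x).

Lemma UC_sub D D' g : (forall x, D' x -> D x) -> UC D g -> UC D' g.
Proof. by move=> s h e e0; have [d d0 k] := h e e0; exists d => // x y /s ? /s ?; apply: k. Qed.
Lemma PD_sub D D' i g g' : (forall x, D' x -> D x) -> PD D i g g' -> PD D' i g g'.
Proof. by move=> s h x /s; apply: h. Qed.
Lemma PD_eq D i g g' g'' : (forall x, D x -> g' x = g'' x) -> PD D i g g' -> PD D i g g''.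
Proof. by move=> s h x Dx; rewrite -s //; apply: h. Qed.
Lemma UCD D g f : UC D g -> UC D f -> UC D (fun x => g x + f x).
Proof.
move=> h h' e e0; have e2 : 0 < e / 2 by rewrite divr_gt0.
have [u u0 k] := h _ e2; have [v v0 k'] := h' _ e2.
exists (Num.min u v) => [|x y Dx Dy]; first by rewrite lt_min u0.
rewrite le_min => /andP[/(k _ _ Dx Dy) a /(k' _ _ Dx Dy) b].
rewrite opprD addrACA (le_trans (ler_normD _ _)) // (le_trans (lerD a b)) // -splitr //.
Qed.
Lemma UCZ D g (c : R) : UC D g -> UC D (fun x => c * g x).
Proof.
move=> h e e0; have e2 : 0 < e / (1 + `|c|) by rewrite divr_gt0 // ltr_pwDl.
have [u u0 k] := h _ e2; exists u => // x y Dx Dy /(k _ _ Dx Dy) a.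
rewrite -mulrBr normrM (le_trans (ler_wpM2l _ a)) //.
rewrite mulrCA ler_piMr ?(ltW e0) //.
by rewrite ler_pdivrMr ?ltr_pwDl // mul1r lerDr.
Qed.
Lemma PDZ D i g g' (c : R) : PD D i g g' -> PD D i (fun x => c * g x) (fun x => c * g' x).
Proof. by move=> h x Dx; apply: hasdZ; apply: h. Qed.

Lemma PD_line D i g g' x t : PD D i g g' -> D (x + t *: qe R i) ->
  hasd (fun s => g (x + s *: qe R i)) t (g' (x + t *: qe R i)).
Proof.
move=> h /h H.
have := @hasd_affine R (fun s => g (x + t *: qe R i + s *: qe R i)) t (g' (x + t *: qe R i)) 1 (- t).
rewrite !mul1r subrr => /(_ H); apply: (@hasd_ext _ _ _ _ _ 1) => // u _.
by rewrite -addrA -scalerDl mul1r addrCA subrr addr0.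
Qed.

(** The Steklov average in direction [i]; its derivative in that direction is the difference
    quotient [dq] ([St_FTC]). *)
Definition St i e g x := av (fun s => g (x + (e * s) *: qe R i)).
Definition dq i e g x := (g (x + e *: qe R i) - g x) / e.

Section Box.
Variables (q : quat R) (e : R).
Hypothesis e0 : 0 < e.
Local Notation B rho := (inb q rho).

(** One [e] of the margin is spent on the averaging segment; the other is kept so that the point can
    still be moved when the average is differentiated. *)
Lemma inb_seg i rho x s : B (rho - 2 * e) x -> 0 <= s <= 1 -> B (rho - e) (x + (e * s) *: qe R i).
Proof.
move=> h /andP[s0 s1]; apply: (@inbD _ _ _ e); first by move: h; congr inb; ring.
by rewrite (le_trans (norm_tqe _ _)) // ger0_norm ?mulr_ge0 ?(ltW e0) // ger_pMr.
Qed.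
Lemma inb_w rho x : B (rho - e) x -> B rho x.
Proof. by apply: (@inb_le q (rho - e)); rewrite gerBl ltW. Qed.
Lemma inb_w2 rho x : B (rho - 2 * e) x -> B rho x.
Proof. by apply: (@inb_le q (rho - 2 * e)); rewrite gerBl mulr_ge0 // ltW. Qed.
Lemma inb_e i rho x : B (rho - 2 * e) x -> B rho (x + e *: qe R i).
Proof.
by move=> /(@inb_seg i) h; apply: inb_w; rewrite -[e in e *: _]mulr1; apply: h; rewrite ler01 lexx.
Qed.

Lemma ct_line i rho g x : UC (B rho) g -> B (rho - 2 * e) x ->
  ct01 (fun s => g (x + (e * s) *: qe R i)).
Proof.
move=> h Bx; apply: within_cts => s; rewrite /= in_itv /= => s01 eta eta0.
have [d d0 k] := h _ eta0; exists (d / e); first by rewrite divr_gt0.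
move=> y; rewrite in_itv /= => y01; rewrite ler_pdivlMr // => sy.
apply: k; do ?[by apply: inb_w; apply: inb_seg].
rewrite opprD addrACA subrr add0r -scalerBl (le_trans (norm_tqe _ _)) //.
by rewrite -mulrBr normrM (gtr0_norm e0) mulrC.
Qed.

Lemma ct_comb (f g : R -> R) (a b : R) : ct01 f -> ct01 g -> ct01 (fun s => a * f s + b * g s).
Proof.
move=> hf hg x; apply: cvgD; apply: cvgM; do ?[exact: cvg_cst]; [exact: hf|exact: hg].
Qed.
Lemma av_comb (f g : R -> R) (a b : R) : ct01 f -> ct01 g ->
  av (fun s => a * f s + b * g s) = a * av f + b * av g.
Proof.
move=> hf hg.
have k (c : R) h : ct01 h -> ct01 (fun s => c * h s).
  by move=> hh x; apply: cvgM; [exact: cvg_cst|exact: hh].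
by rewrite avD ?avZ //; apply: k.
Qed.

Lemma St_UC i rho g : UC (B rho) g -> UC (B (rho - 2 * e)) (St i e g).
Proof.
move=> h eta eta0; have [d d0 k] := h _ eta0; exists d => // x y Bx By xy.
have -> : St i e g x - St i e g y = av (fun s => 1 * g (x + (e * s) *: qe R i) + (-1) * g (y + (e * s) *: qe R i)).
  by rewrite av_comb ?mul1r ?mulN1r //; apply: (ct_line (rho := rho)).
apply: av_le => [|s s01].
  by apply: ct_comb; apply: (ct_line (rho := rho)).
rewrite mul1r mulN1r; apply: k; do ?[by apply: inb_w; apply: inb_seg].
by rewrite opprD addrACA subrr addr0.
Qed.

Lemma St_le i rho g M : UC (B rho) g -> (forall x, B rho x -> `|g x| <= M) ->
  forall x, B (rho - 2 * e) x -> `|St i e g x| <= M.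
Proof.
move=> h hM x Bx; apply: av_le; first exact: (ct_line (rho := rho)).
by move=> s s01; apply: hM; apply: inb_w; apply: inb_seg.
Qed.

Lemma St_eq i rho g f : (forall x, B rho x -> g x = f x) ->
  forall x, B (rho - 2 * e) x -> St i e g x = St i e f x.
Proof.
by move=> h x Bx; apply: av_ext => s s01; apply: h; apply: inb_w; apply: inb_seg.
Qed.

Lemma St_close i rho g f c eta : UC (B rho) g ->
  (forall x y, B rho x -> B rho y -> `|x - y| <= e -> `|f x - f y| <= eta) ->
  (forall x, B rho x -> `|g x - f x| <= c) ->
  forall x, B (rho - 2 * e) x -> `|St i e g x - f x| <= c + eta.
Proof.
move=> h hf hc x Bx.
have cl := @ct_line i _ _ _ h Bx.
have -> : St i e g x - f x = av (fun s => 1 * g (x + (e * s) *: qe R i) + (-1) * f x).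
  by rewrite av_comb ?av_cst ?mul1r ?mulN1r //; apply: ct01_cst.
apply: av_le => [|s s01]; first by apply: ct_comb => //; apply: ct01_cst.
have Bs : B rho (x + (e * s) *: qe R i) by apply: inb_w; apply: inb_seg.
rewrite mul1r mulN1r -(subrKA (f (x + (e * s) *: qe R i))) (le_trans (ler_normD _ _)) // lerD ?hc //.
apply: hf => //; first exact: inb_w2.
rewrite addrAC subrr add0r (le_trans (norm_tqe _ _)) // normrM (gtr0_norm e0).
by case/andP: s01 => s0 s1; rewrite ger0_norm // ger_pMr.
Qed.

(** Differentiation under the integral: the mean value theorem writes the remainder at each [s] as
    [t] times an increment of [g'], which uniform continuity bounds uniformly in [s]. *)
Lemma St_PD i k rho g g' : UC (B rho) g -> UC (B rho) g' -> PD (B rho) k g g' ->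
  PD (B (rho - 2 * e)) k (St i e g) (St i e g').
Proof.
move=> hg hg' h x Bx eta eta0.
have [d d0 H] := hg' _ eta0.
exists (Num.min d e) => [|t]; first by rewrite lt_min d0.
rewrite le_min => /andP[td te]; rewrite add0r scale0r addr0.
have Bxt s t' : 0 <= s <= 1 -> `|t'| <= e -> B rho (x + (e * s) *: qe R i + t' *: qe R k).
  move=> s01 te'; apply: (@inbD _ _ _ e); first exact: inb_seg.
  by rewrite (le_trans (norm_tqe _ _)).
have ct : ct01 (fun s => g (x + t *: qe R k + (e * s) *: qe R i)).
  apply: within_cts => s; rewrite /= in_itv /= => s01 et et0.
  have [d' d'0 kk] := hg _ et0; exists (d' / e); first by rewrite divr_gt0.
  move=> y; rewrite in_itv /= => y01; rewrite ler_pdivlMr // => sy.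
  rewrite -!addrA ![t *: _ + _]addrC !addrA.
  apply: kk; do ?[by apply: Bxt].
  rewrite [X in `|X|](_ : _ = (e * s - e * y) *: qe R i); last first.
    rewrite scalerBl; apply/rowP => z; rewrite !mxE; ring.
  by rewrite (le_trans (norm_tqe _ _)) // -mulrBr normrM (gtr0_norm e0) mulrC.
have cl := @ct_line i _ _ _ hg Bx.
have cl' := @ct_line i _ _ _ hg' Bx.
have -> : St i e g (x + t *: qe R k) - St i e g x - t * St i e g' x =
  av (fun s => 1 * (1 * g (x + t *: qe R k + (e * s) *: qe R i) + (-1) * g (x + (e * s) *: qe R i)) + (- t) * g' (x + (e * s) *: qe R i)).
  rewrite av_comb // ?av_comb //; last by apply: ct_comb.
  by rewrite !mul1r mulN1r mulNr.
apply: av_le => [|s s01]; first by apply: ct_comb => //; apply: ct_comb.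
rewrite !mul1r mulN1r mulNr [x + t *: _ + _]addrAC.
set z := x + (e * s) *: qe R i.
have line u : `|u| <= `|t| -> hasd (fun u => g (z + u *: qe R k)) u (g' (z + u *: qe R k)).
  by move=> ut; apply: PD_line h _; apply: Bxt => //; apply: le_trans te.
have [c ct' hc] := hasd_MVT0 line.
rewrite scale0r addr0 in hc.
have -> : g (z + t *: qe R k) - g z - t * g' z = t * (g' (z + c *: qe R k) - g' z) by lra.
rewrite normrM mulrC ler_wpM2r //.
apply: H; first by apply: Bxt => //; apply: le_trans te.
  by have := Bxt s 0 s01; rewrite scale0r addr0 normr0; apply; apply: ltW.
by rewrite addrAC subrr add0r (le_trans (norm_tqe _ _)) // (le_trans ct').
Qed.

Lemma St_FTC i rho g : UC (B rho) g -> PD (B (rho - 2 * e)) i (St i e g) (dq i e g).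
Proof.
move=> h x Bx.
have := @av_deriv R (fun s => g (x + s *: qe R i)) e e e0.
rewrite scale0r addr0 => H.
have : hasd (fun t => av (fun s => g (x + (t + e * s) *: qe R i))) 0 ((g (x + e *: qe R i) - g x) / e).
  apply: H => // t te eta eta0; have [d d0 k] := h _ eta0.
  have Bt u : - e <= u <= e + e -> B rho (x + u *: qe R i).
    move=> ue; apply: (@inbD _ _ _ (2 * e)) => //.
    rewrite (le_trans (norm_tqe _ _)) // ler_norml; case/andP: ue => *; apply/andP; split; lra.
  exists d => // u ue tu; apply: k; do ?[exact: Bt].
  by rewrite opprD addrACA subrr add0r -scalerBl (le_trans (norm_tqe _ _)).
apply: (@hasd_ext _ _ _ _ _ 1) => // t _; apply: av_ext => s _.
by rewrite add0r scalerDl addrA.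
Qed.

Lemma dq_UC i rho g : UC (B rho) g -> UC (B (rho - 2 * e)) (dq i e g).
Proof.
move=> h.
have s : UC (B (rho - 2 * e)) (fun x => g (x + e *: qe R i)).
  move=> eta eta0; have [d d0 k] := h _ eta0; exists d => // x y Bx By xy.
  apply: k; [exact: inb_e|exact: inb_e|].
  by rewrite opprD addrACA subrr addr0.
have h' : UC (B (rho - 2 * e)) g by apply: UC_sub h => x; apply: inb_w2.
have := UCZ e^-1 (UCD s (UCZ (-1) h')).
move=> H eta /H[d d0 k]; exists d => // x y Bx By xy; have := k x y Bx By xy.
by rewrite !mulN1r ![e^-1 * _]mulrC.
Qed.

Lemma dq_PD i k rho g g' : PD (B rho) k g g' -> PD (B (rho - 2 * e)) k (dq i e g) (dq i e g').
Proof.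
move=> h x Bx; have a := h _ (inb_w2 Bx); have b := h _ (inb_e i Bx).
have := hasdZ e^-1 (hasdD b (hasdZ (-1) a)).
rewrite mulrC mulN1r; apply: (@hasd_ext _ _ _ _ _ 1) => // t _.
by rewrite mulrC mulN1r add0r /dq ![x + e *: _ + _]addrAC.
Qed.

Lemma dq_eq i rho g f : (forall x, B rho x -> g x = f x) ->
  forall x, B (rho - 2 * e) x -> dq i e g x = dq i e f x.
Proof. by move=> h x Bx; rewrite /dq !h //; [apply: inb_w2|apply: inb_e]. Qed.

Lemma dqC i j g x : dq i e (dq j e g) x = dq j e (dq i e g) x.
Proof. by rewrite /dq [x + e *: qe R i + _]addrAC; congr (_ / _); rewrite -!mulrBl; congr (_ / _); ring. Qed.

Lemma St_dq i j rho g : UC (B rho) g -> forall x, B (rho - 2 * e - 2 * e) x ->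
  St i e (dq j e g) x = dq j e (St i e g) x.
Proof.
move=> h x Bx; rewrite /dq /St.
have c1 := @ct_line i _ _ _ h (inb_w2 Bx).
have c2 := @ct_line i _ _ _ h (inb_e j Bx).
have -> : (av (fun s => g (x + e *: qe R j + (e * s) *: qe R i)) - av (fun s => g (x + (e * s) *: qe R i))) / e
  = av (fun s => e^-1 * g (x + e *: qe R j + (e * s) *: qe R i) + (- e^-1) * g (x + (e * s) *: qe R i)).
  by rewrite av_comb //; ring.
by apply: av_ext => s _; rewrite [x + e *: _ + _]addrAC; ring.
Qed.

Definition Sts l g := foldr (fun i => St i e) g l.

(* Each average costs a margin of [2 * e]. *)
Definition lossB rho (n : nat) := rho - 2 * e * n%:R.
Lemma lossS rho n : lossB rho n.+1 = lossB rho n - 2 * e.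
Proof. by rewrite /lossB -[n.+1%:R]natr1; ring. Qed.
Lemma loss0 rho : lossB rho 0 = rho. Proof. by rewrite /lossB mulr0 subr0. Qed.

Lemma Sts_UC l rho g : UC (B rho) g -> UC (B (lossB rho (size l))) (Sts l g).
Proof.
by move=> h; elim: l => [|i l IH] /=; rewrite ?loss0 // lossS; apply: St_UC.
Qed.
Lemma Sts_le l rho g M : UC (B rho) g -> (forall x, B rho x -> `|g x| <= M) ->
  forall x, B (lossB rho (size l)) x -> `|Sts l g x| <= M.
Proof.
move=> h hM; elim: l => [|i l IH] /=; rewrite ?loss0 // lossS => x Bx.
exact: (St_le i (Sts_UC l h) IH Bx).
Qed.
Lemma Sts_eq l rho g f : (forall x, B rho x -> g x = f x) ->
  forall x, B (lossB rho (size l)) x -> Sts l g x = Sts l f x.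
Proof.
move=> h; elim: l => [|i l IH] /=; rewrite ?loss0 // lossS => x Bx.
by apply: (@St_eq i _ _ _ IH).
Qed.
Lemma Sts_close l rho g eta : UC (B rho) g ->
  (forall x y, B rho x -> B rho y -> `|x - y| <= e -> `|g x - g y| <= eta) ->
  forall x, B (lossB rho (size l)) x -> `|Sts l g x - g x| <= eta * (size l)%:R.
Proof.
move=> h he; elim: l => [|i l IH] x; first by rewrite /= subrr normr0 mulr0.
rewrite /= lossS -[X in eta * X]natr1 mulrDr mulr1 => Bx.
apply: (St_close i (Sts_UC l h) _ IH) => // y z By Bz; apply: he.
  by move: By; apply: inb_le; rewrite /lossB gerBl !mulr_ge0 ?(ltW e0).
by move: Bz; apply: inb_le; rewrite /lossB gerBl !mulr_ge0 ?(ltW e0).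
Qed.
Lemma Sts_PD l k rho g g' : UC (B rho) g -> UC (B rho) g' -> PD (B rho) k g g' ->
  PD (B (lossB rho (size l))) k (Sts l g) (Sts l g').
Proof.
move=> h h' hd; elim: l => [|i l IH] /=; rewrite ?loss0 // lossS.
by apply: St_PD => //; apply: Sts_UC.
Qed.
(** The average in direction [i] may sit deep inside [l]; the outer averages are differentiated
    under the integral and commute with [dq]. *)
Lemma Sts_FTC l i rho g : UC (B rho) g -> i \in l ->
  PD (B (lossB rho (size l))) i (Sts l g) (dq i e (Sts (rem i l) g)).
Proof.
move=> h; elim: l => [//|j l IH]; rewrite inE /= lossS eq_sym.
case: eqP => [-> _|_ /= il]; first by apply: St_FTC; apply: Sts_UC.
have s1 : size l = (size (rem i l)).+1.
  by rewrite size_rem // prednK //; case: (l) il.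
have u := Sts_UC (rem i l) h.
apply: (PD_eq (g' := St j e (dq i e (Sts (rem i l) g)))).
  by move=> x; rewrite s1 lossS; apply: St_dq.
apply: St_PD; [exact: Sts_UC| |exact: IH].
by rewrite s1 lossS; apply: dq_UC.
Qed.
(** Both sides are the derivative of [Sts l g] in direction [j]. This trades a smoothed derivative
    for a difference quotient, at the price of one average. *)
Lemma Sts_swap l j rho g g' : UC (B rho) g -> UC (B rho) g' -> PD (B rho) j g g' -> j \in l ->
  forall x, B (lossB rho (size l)) x -> Sts l g' x = dq j e (Sts (rem j l) g) x.
Proof.
move=> h h' hd jl x Bx.
have a := @Sts_PD l j _ _ _ h h' hd x Bx.
exact: hasd_uniq a (@Sts_FTC l j _ _ h jl x Bx).
Qed.

End Box.
End Steklov.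

(** * Maximum principle for smoothed solutions *)

Section Harmonic.
Variable R : realType.
Implicit Types (x y q : quat R) (g f : quat R -> R) (D : quat R -> Prop) (e rho t eta M : R).

(* [D f = 0] in coordinates; [p i c] stands for the [i]-th partial derivative of the component [f c]. *)
Definition mfeq (p : nat -> nat -> quat R -> R) x :=
  [/\ p 0%N 0%N x - p 1%N 1%N x - p 2%N 2%N x - p 3%N 3%N x = 0,
      p 0%N 1%N x + p 1%N 0%N x + p 2%N 3%N x - p 3%N 2%N x = 0,
      p 0%N 2%N x - p 1%N 3%N x + p 2%N 0%N x + p 3%N 1%N x = 0 &
      p 0%N 3%N x + p 1%N 2%N x - p 2%N 1%N x + p 3%N 0%N x = 0].

Definition msys D (f : nat -> quat R -> R) (p : nat -> nat -> quat R -> R) :=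
  [/\ forall c, UC D (f c), forall i c, (i < 4)%N -> UC D (p i c),
      forall i c, (i < 4)%N -> PD D i (f c) (p i c) & forall x, D x -> mfeq p x].

Section Loc.
Variables (q : quat R) (e rho : R).
Hypothesis e0 : 0 < e.
Local Notation B rho := (inb q rho).

Lemma St_comb i r g f (a b : R) : UC (B r) g -> UC (B r) f -> forall x, B (r - 2 * e) x ->
  St i e (fun y => a * g y + b * f y) x = a * St i e g x + b * St i e f x.
Proof.
by move=> hg hf x Bx; rewrite /St av_comb //; apply: (ct_line e0 (rho := r)); eauto.
Qed.

Lemma UC_comb D g f (a b : R) : UC D g -> UC D f -> UC D (fun y => a * g y + b * f y).
Proof. by move=> h h'; apply: UCD; apply: UCZ. Qed.

Lemma Sts_comb l g f (a b : R) : UC (B rho) g -> UC (B rho) f -> forall x, B (lossB e rho (size l)) x ->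
  Sts e l (fun y => a * g y + b * f y) x = a * Sts e l g x + b * Sts e l f x.
Proof.
move=> hg hf; elim: l => [//|i l IH] x; rewrite /= lossS => Bx.
rewrite (St_eq e0 i IH Bx); apply: St_comb Bx; apply: Sts_UC => //.
Qed.

Definition l4 : seq nat := [:: 0; 1; 2; 3]%N.
Variables (f : nat -> quat R -> R) (p : nat -> nat -> quat R -> R).
Hypothesis mf : msys (B rho) f p.

(** A second difference quotient of component [c], averaged in the two remaining directions. *)
Let T i j c x := dq i e (dq j e (Sts e (rem j (rem i l4)) (f c))) x.

(** One equation of the system expresses [p i 0] by three other partial derivatives. After smoothing
    these are difference quotients, so a pure second derivative becomes a combination of mixed
    quotients [T]. *)
Let dec i (j1 j2 j3 c1 c2 c3 : nat) (s1 s2 s3 : R) x : (i < 4)%N ->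
  (j1 < 4)%N -> (j2 < 4)%N -> (j3 < 4)%N -> j1 \in rem i l4 -> j2 \in rem i l4 -> j3 \in rem i l4 ->
  (forall y, B rho y -> p i 0%N y = s1 * p j1 c1 y + 1 * (s2 * p j2 c2 y + s3 * p j3 c3 y)) ->
  B (lossB e rho 4) x ->
  dq i e (Sts e (rem i l4) (p i 0%N)) x = s1 * T i j1 c1 x + s2 * T i j2 c2 x + s3 * T i j3 c3 x.
Proof.
move=> i4 k1 k2 k3 h1 h2 h3 hp.
have [u1 u2 u3 u4] := mf.
have sz : size (rem i l4) = 3%N by case: i i4 {h1 h2 h3 hp} => [|[|[|[|]]]].
have key y : B (lossB e rho 3) y -> Sts e (rem i l4) (p i 0%N) y =
  s1 * dq j1 e (Sts e (rem j1 (rem i l4)) (f c1)) y + s2 * dq j2 e (Sts e (rem j2 (rem i l4)) (f c2)) y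
   + s3 * dq j3 e (Sts e (rem j3 (rem i l4)) (f c3)) y.
  rewrite -sz => By; rewrite (Sts_eq e0 hp By).
  have v1 := u2 _ c1 k1; have v2 := u2 _ c2 k2; have v3 := u2 _ c3 k3.
  rewrite (Sts_comb s1 1 v1 (UC_comb s2 s3 v2 v3) By) (Sts_comb s2 s3 v2 v3 By).
  rewrite (Sts_swap e0 (u1 c1) v1 (u3 _ _ k1) h1 By) (Sts_swap e0 (u1 c2) v2 (u3 _ _ k2) h2 By).
  by rewrite (Sts_swap e0 (u1 c3) v3 (u3 _ _ k3) h3 By) mul1r addrA.
rewrite lossS => Bx.
rewrite (dq_eq e0 i key Bx) /T /dq; ring.
Qed.

Let TC i j c x : (i < 4)%N -> (j < 4)%N -> T i j c x = T j i c x.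
Proof.
move=> i4 j4; rewrite /T dqC.
by case: i i4 => [|[|[|[|]]]] // _; case: j j4 => [|[|[|[|]]]].
Qed.

Definition smooth := Sts e l4 (f 0%N).
Definition smooth1 i := dq i e (Sts e (rem i l4) (f 0%N)).
Definition smooth2 i := dq i e (Sts e (rem i l4) (p i 0%N)).

Lemma smooth_PD i : (i < 4)%N -> PD (B (lossB e rho 4)) i smooth (smooth1 i).
Proof.
have [u1 u2 u3 u4] := mf.
move=> i4; have il : i \in l4 by case: i i4 => [|[|[|[|]]]].
exact: (Sts_FTC e0 (u1 0%N) il).
Qed.

Lemma smooth_PD1 i : (i < 4)%N -> PD (B (lossB e rho 4)) i (smooth1 i) (smooth2 i).
Proof.
move=> i4; have [u1 u2 u3 u4] := mf.
rewrite lossS /smooth1 /smooth2; apply: (dq_PD e0).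
have -> : 3%N = size (rem i l4) by case: i i4 => [|[|[|[|]]]].
by apply: (Sts_PD e0); eauto.
Qed.

(* The cross terms cancel because second difference quotients commute. *)
Lemma smooth_harmonic x : B (lossB e rho 4) x ->
  smooth2 0 x + smooth2 1 x + smooth2 2 x + smooth2 3 x = 0.
Proof.
move=> Bx; have [u1 u2 u3 u4] := mf.
rewrite /smooth2.
rewrite (@dec 0 1 2 3 1 2 3 1 1 1) //; last by move=> y /u4[]; lra.
rewrite (@dec 1 0 2 3 1 3 2 (-1) (-1) 1) //; last by move=> y /u4[]; lra.
rewrite (@dec 2 0 1 3 2 3 1 (-1) 1 (-1)) //; last by move=> y /u4[]; lra.
rewrite (@dec 3 0 1 2 3 2 1 (-1) (-1) 1) //; last by move=> y /u4[]; lra.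
rewrite (@TC 1 0 1 x) // (@TC 2 0 2 x) // (@TC 3 0 3 x) //.
rewrite (@TC 2 1 3 x) // (@TC 3 1 2 x) // (@TC 3 2 1 x) //.
move: (T 0 1 1 x) (T 0 2 2 x) (T 0 3 3 x) (T 1 2 3 x) (T 1 3 2 x) (T 2 3 1 x) => *; ring.
Qed.

End Loc.

Lemma hasd_quad (a b c t : R) : hasd (fun s => a + b * s + c * s ^+ 2) t (b + 2 * c * t).
Proof.
move=> eta eta0; exists (eta / (1 + `|c|)); first by rewrite divr_gt0 // ltr_pwDl.
move=> s; rewrite ler_pdivlMr ?ltr_pwDl // => hs.
rewrite (_ : _ - _ - _ = c * s * s); last by ring.
rewrite !normrM ler_wpM2r // mulrC; apply: le_trans hs; rewrite ler_wpM2l // lerDr //.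
Qed.

(** Reflection in the hyperplane orthogonal to [qe R 0] through [q]. *)
Definition rf q x := x - (2 * (qc x 0 - qc q 0)) *: qe R 0.

Lemma qc_addqe x t i j : (j < 4)%N -> qc (x + t *: qe R i) j = qc x j + (if j == i then t else 0).
Proof. by move=> j4; rewrite qcD qcZ qc_e //; case: ifP; rewrite ?mulr1 ?mulr0. Qed.

Lemma rf_line q x t i : rf q (x + t *: qe R i) =
  rf q x + (if i == 0%N then - t else t) *: qe R i.
Proof.
rewrite /rf qc_addqe // eq_sym; case: (i == 0%N) / eqP => [->|_].
  by apply/rowP => k; rewrite !mxE; ring.
by apply/rowP => k; rewrite !mxE; ring.
Qed.

Lemma inb_qcP q rho x : 0 <= rho -> inb q rho x <-> forall k, (k < 4)%N -> `|qc x k - qc q k| <= rho.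
Proof.
Transparent inb.
move=> r0; split=> [h k k4|h]; last by apply: normq_le => // k; rewrite qcB h.
by rewrite -qcB (le_trans (@qc_le_norm _ _ (Ordinal k4))).
Opaque inb.
Qed.

Lemma inb_rf q rho x : 0 <= rho -> inb q rho x -> inb q rho (rf q x).
Proof.
move=> r0; rewrite !inb_qcP // => h k k4; rewrite /rf qcB qcZ qc_e //.
have := h k k4; case: eqP => [->|_]; last by rewrite mulr0 subr0.
by rewrite mulr1 -normrN; congr (`|_| <= _); ring.
Qed.

Lemma quat_ctsP (V : normedModType R) (g : quat R -> V) x : {for x, continuous g} <->
  forall eta : R, 0 < eta -> exists2 d : R, 0 < d & forall y, `|x - y| <= d -> `|g x - g y| <= eta.
Proof.
have F := @nbhs_filter [the topologicalType of 'rV[R]_4] x.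
split=> [h eta eta0|h].
  have /(@cvgrPdist_le R V _ _ F) h' : g @ nbhs (x : [the topologicalType of 'rV[R]_4]) --> g x by exact: h.
  have /nbhs_ballP[d /= d0 H] := h' _ eta0.
  exists (d / 2) => [|y xy]; first by rewrite divr_gt0.
  by apply: H; rewrite -ball_normE /= (le_lt_trans xy) // ltr_pdivrMr // ltr_pMr // ltr1n.
suff : g @ nbhs (x : [the topologicalType of 'rV[R]_4]) --> g x by [].
apply/(@cvgrPdist_le R V _ _ F) => e e0; have [d d0 H] := h e e0.
apply/nbhs_ballP; exists d => //= y; rewrite -ball_normE /= => /ltW; exact: H.
Qed.

Lemma inb_closed q rho : closed [set x | inb q rho x].
Proof.
Transparent inb.
have c : continuous (fun x : quat R => `|x - q| : R); last first.
  by apply: (preimage_closed (f := fun x : quat R => `|x - q|) _ (@closed_le _ rho)) => y _; exact: c.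
move=> y; apply/quat_ctsP => e e0; exists e => // z yz.
by rewrite (le_trans (ler_dist_dist _ _)) // opprB addrA subrK.
Opaque inb.
Qed.

Lemma inb_compact q rho (A : set (quat R)) : closed A -> (forall x, A x -> inb q rho x) -> compact A.
Proof.
Transparent inb.
move=> cA h; apply: bounded_closed_compact => //.
exists (`|q| + rho); split; first exact: num_real.
move=> M /ltW hM y /h; rewrite /inb => hy; apply: le_trans hM.
by rewrite -[y](subrK q) (le_trans (ler_normD _ _)) // addrC lerD2l.
Opaque inb.
Qed.

Lemma qc_continuous k : continuous (fun x => qc x k).
Proof. exact: coord_continuous. Qed.

Lemma UC_within D g : UC D g -> {within [set x | D x], continuous g}.
Proof.
move=> h; apply/subspace_continuousP => x Dx.
apply/cvgrPdist_le => eta eta0; have [d d0 k] := h _ eta0.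
apply/nbhs_ballP; exists d => //= y; rewrite -ball_normE /= => /ltW xy Dy; exact: k.
Qed.

(** Heine-Cantor on a compact cube. *)
Lemma continuous_UC q rho g : (forall x, inb q rho x -> {for x, continuous g}) -> UC (inb q rho) g.
Proof.
move=> h eta eta0; have e2 : 0 < eta / 2 by rewrite divr_gt0.
have cpt : compact [set x | inb q rho x].
  by apply: (inb_compact (q := q) (rho := rho)) => //; exact: inb_closed.
have NC := (compact_near_coveringP [set x | inb q rho x]).1 cpt.
pose P d y := forall z, inb q rho z -> `|y - z| <= d -> `|g y - g z| <= eta.
have HH : \forall d \near (0 : R)^'+, [set x | inb q rho x] `<=` (fun y => P d y).
  apply: (NC _ _ P) => x /h /quat_ctsP /(_ _ e2) [d /= d0 H].
  exists ([set y | ball x (d / 2) y], [set t | 0 < t < d / 2]) => /=.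
    split; first by apply: nbhsx_ballx; rewrite divr_gt0.
    near=> t => /=; apply/andP; split; near: t; [exact: nbhs_right_gt|].
    by apply: nbhs_right_lt; rewrite divr_gt0.
  move=> [y t] /= [] hy /andP[t0 td] z _ yz.
  have h1 : `|g x - g y| <= eta / 2.
    by apply: H; move: hy; rewrite -ball_normE /= => /ltW /le_trans; apply; rewrite ler_pdivrMr // ler_pMr // ler1n.
  have h2 : `|g x - g z| <= eta / 2.
    apply: H; move: hy; rewrite -ball_normE /= => hy.
    rewrite -(subrKA y) (le_trans (ler_normD _ _)) //.
    by rewrite [d]splitr lerD // ltW // (le_lt_trans yz).
  rewrite -(subrKA (g x)) (le_trans (ler_normD _ _)) // [eta]splitr lerD // distrC //.
near (0 : R)^'+ => d; exists d; first by near: d; exact: nbhs_right_gt.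
near: d; apply: filterS HH => d hd x y Bx; exact: hd.
Unshelve. all: by end_near. Qed.

(** * Comparison with a barrier on the half cube *)

Section MaxPrinciple.
Variables (q : quat R) (rho M : R).
Hypotheses (r0 : 0 < rho) (M0 : 0 < M).
Variables (U : quat R -> R) (U1 U2 : nat -> quat R -> R).
Local Notation B := (inb q rho).
Hypothesis cU : UC B U.
Hypothesis d1 : forall i, (i < 4)%N -> PD B i U (U1 i).
Hypothesis d2 : forall i, (i < 4)%N -> PD B i (U1 i) (U2 i).
Hypothesis harm : forall x, B x -> U2 0 x + U2 1 x + U2 2 x + U2 3 x = 0.
Hypothesis bU : forall x, B x -> `|U x| <= M.

(* With [x] centered at [q], the barrier [2M |(x1,x2,x3)|^2 / rho^2 + 10M x0 / rho - 8M x0^2 / rho^2]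
   is nonnegative on the half cube, at least [2M] on its outer faces, and strictly superharmonic. *)
Let cf (i : nat) : R := if i == 0%N then - (8 * M / rho ^+ 2) else 2 * M / rho ^+ 2.
Let cl (i : nat) : R := if i == 0%N then 10 * M / rho else 0.
Let bar x : R := \sum_(i < 4) (cl i * (qc x i - qc q i) + cf i * (qc x i - qc q i) ^+ 2).
Let Psi x := U x - U (rf q x) - bar x.
(** The reflection reverses direction 0 only: the chain rule puts this sign on first derivatives,
    and its square, 1, on second derivatives. *)
Let sg (i : nat) : R := if i == 0%N then - 1 else 1.
Let Psi1 i x := U1 i x - sg i * U1 i (rf q x) - (cl i + 2 * cf i * (qc x i - qc q i)).
Let Psi2 i x := U2 i x - U2 i (rf q x) - 2 * cf i.

Let barE x : bar x = 2 * M * ((qc x 1 - qc q 1) / rho) ^+ 2 + 2 * M * ((qc x 2 - qc q 2) / rho) ^+ 2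
  + 2 * M * ((qc x 3 - qc q 3) / rho) ^+ 2 +
  2 * M * ((qc x 0 - qc q 0) / rho) * (5 - 4 * ((qc x 0 - qc q 0) / rho)).
Proof. rewrite /bar !big_ord_recl big_ord0 /cl /cf /=; field; by rewrite gt_eqF. Qed.

Let bar_line i x : (i < 4)%N -> exists a b : R, forall t : R,
   bar (x + t *: qe R i) = a + b * t + cf i * t ^+ 2 /\ b = cl i + 2 * cf i * (qc x i - qc q i).
Proof.
move=> i4; exists (bar x), (cl i + 2 * cf i * (qc x i - qc q i)) => t; split => //.
rewrite /bar (bigD1 (Ordinal i4)) //= [in RHS](bigD1 (Ordinal i4)) //= qc_addqe // eqxx.
under eq_bigr => k ki.
  rewrite qc_addqe // (_ : (k == i :> nat) = false) ?addr0; last by apply/negbTE.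
  over.
set s := \sum_(k < 4 | _) _; ring.
Qed.

Let Psi_d1 i x : (i < 4)%N -> B x -> hasd (fun t => Psi (x + t *: qe R i)) 0 (Psi1 i x).
Proof.
move=> i4 Bx.
have [a [b hb]] := bar_line x i4.
have h1 := d1 i4 Bx.
have h2 := d1 i4 (inb_rf (ltW r0) Bx).
have h2' : hasd (fun t => U (rf q (x + t *: qe R i))) 0 (sg i * U1 i (rf q x)).
  have := @hasd_affine _ (fun t => U (rf q x + t *: qe R i)) 0 (U1 i (rf q x)) (sg i) 0.
  rewrite mulr0 addr0 => /(_ h2); apply: (@hasd_ext _ _ _ _ _ 1) => // t _.
  by rewrite rf_line add0r addr0 /sg; case: ifP; rewrite ?mulN1r ?mul1r.
have h3 := hasd_quad a b (cf i) 0.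
have := hasdD h1 (hasdD (hasdZ (-1) h2') (hasdZ (-1) h3)).
rewrite [X in hasd _ _ X -> _](_ : _ = Psi1 i x); last by rewrite /Psi1 -(hb 0).2; ring.
apply: (@hasd_ext _ _ _ _ _ 1) => // t _; rewrite add0r /Psi (hb t).1; ring.
Qed.

Let Psi_d2 i x : (i < 4)%N -> B x -> hasd (fun t => Psi1 i (x + t *: qe R i)) 0 (Psi2 i x).
Proof.
move=> i4 Bx.
have h1 := d2 i4 Bx.
have h2 := d2 i4 (inb_rf (ltW r0) Bx).
have h2' : hasd (fun t => sg i * U1 i (rf q (x + t *: qe R i))) 0 (U2 i (rf q x)).
  have := @hasd_affine _ (fun t => U1 i (rf q x + t *: qe R i)) 0 (U2 i (rf q x)) (sg i) 0.
  rewrite mulr0 addr0 => /(_ h2) /(hasdZ (sg i)).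
  rewrite mulrA (_ : sg i * sg i = 1) ?mul1r; last by rewrite /sg; case: ifP; rewrite ?mulrNN mul1r.
  apply: (@hasd_ext _ _ _ _ _ 1) => // t _.
  by rewrite rf_line add0r addr0 /sg; case: ifP; rewrite ?mulN1r ?mul1r.
have h3 := hasd_quad (cl i + 2 * cf i * (qc x i - qc q i)) (2 * cf i) 0 0.
have := hasdD h1 (hasdD (hasdZ (-1) h2') (hasdZ (-1) h3)).
rewrite [X in hasd _ _ X -> _](_ : _ = Psi2 i x); last by rewrite /Psi2; ring.
apply: (@hasd_ext _ _ _ _ _ 1) => // t _; rewrite add0r /Psi1 qc_addqe // eqxx; ring.
Qed.

Let cbar x : {for x, continuous bar}.
Proof.
have c i : (i < 4)%N -> {for x, continuous (fun x => qc x i - qc q i)}.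
  move=> i4; apply/quat_ctsP => eta e0; exists eta => // z xz.
  by rewrite opprB addrA subrK -qcB (le_trans (@qc_le_norm _ _ (Ordinal i4))).
have cc i : (i < 4)%N -> {for x, continuous (fun x => cl i * (qc x i - qc q i) + cf i * (qc x i - qc q i) ^+ 2)}.
  move=> i4; apply: (@continuousD _ _ _ (fun x => cl i * (qc x i - qc q i)) (fun x => cf i * (qc x i - qc q i) ^+ 2)).
    by apply: (@continuousM _ _ (fun _ => cl i) (fun x => qc x i - qc q i)); [exact: cst_continuous|exact: c].
  apply: (@continuousM _ _ (fun _ => cf i) (fun x => (qc x i - qc q i) ^+ 2)); first exact: cst_continuous.
  by apply: (@continuousM _ _ (fun x => qc x i - qc q i) (fun x => qc x i - qc q i)); exact: c.
rewrite (_ : bar = (fun x => cl 0 * (qc x 0 - qc q 0) + cf 0 * (qc x 0 - qc q 0) ^+ 2) +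
  ((fun x => cl 1 * (qc x 1 - qc q 1) + cf 1 * (qc x 1 - qc q 1) ^+ 2) +
  ((fun x => cl 2 * (qc x 2 - qc q 2) + cf 2 * (qc x 2 - qc q 2) ^+ 2) +
  (fun x => cl 3 * (qc x 3 - qc q 3) + cf 3 * (qc x 3 - qc q 3) ^+ 2)))).
  by apply: continuousD; [exact: cc|apply: continuousD; [exact: cc|apply: continuousD; exact: cc]].
by apply/funext => y; rewrite /bar !big_ord_recl big_ord0 addr0.
Qed.

Let UC_rf : UC B (fun x => U (rf q x)).
Proof.
move=> eta eta0; have [d d0 k] := cU eta0; exists d => // x y Bx By xy.
apply: k; do ?[exact: inb_rf (ltW r0) _]; apply: le_trans xy.
apply: normq_le => // k; apply: le_trans (qc_le_norm _ k).
rewrite /rf !(qcB, qcZ) qc_e //; case: eqP => [->|_]; last by rewrite !mulr0 !subr0.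
by rewrite [X in `|X| <= _](_ : _ = - (qc x 0 - qc y 0)) ?normrN //; ring.
Qed.

(** A positive maximum of [Psi] on the half cube can lie neither on the hyperplane of symmetry nor
    on an outer face; in the interior it contradicts the positive sum of the second derivatives of
    [Psi]. *)
Lemma half_box_barrier x : B x -> qc q 0 <= qc x 0 -> U x - U (rf q x) <= bar x.
Proof.
move=> Bx x0; rewrite -subr_le0 -/(Psi x).
pose A := [set y | B y /\ qc q 0 <= qc y 0].
have Acl : closed A.
  apply: closedI; first exact: inb_closed.
  apply: (preimage_closed (f := fun y : quat R => qc y 0) _ (@closed_ge _ (qc q 0))) => y _.
  exact: qc_continuous.
have Acpt : compact A by apply: (inb_compact (q := q) (rho := rho)) => // y [].
have cPsi : {within A, continuous Psi}.
  have s y : A y -> B y by case.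
  have w1 : {within A, continuous U} by exact: (UC_within (UC_sub s cU)).
  have w2 : {within A, continuous (fun x => U (rf q x))} by exact: (UC_within (UC_sub s UC_rf)).
  have w3 : {within A, continuous bar} by apply: continuous_subspaceT => y; exact: cbar.
  by move=> y; apply: cvgB; [apply: cvgB; [exact: w1|exact: w2]|exact: w3].
have [|z zA zmax] := @EVT_max_rV R 4 Psi A _ Acpt cPsi; first by exists x.
rewrite inE in zA; case: zA => Bz z0.
have xz : Psi x <= Psi z by apply: zmax; rewrite inE.
apply: (le_trans xz) => {x Bx x0 xz}; rewrite leNgt; apply/negP => Pz.
have zq := (inb_qcP q z (ltW r0)).1 Bz.
have vz : U z - U (rf q z) <= 2 * M.
  have := bU Bz; have := bU (inb_rf (ltW r0) Bz).
  by rewrite !ler_norml => /andP[? ?] /andP[? ?]; lra.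
have [u hu] : exists u : nat -> R, forall k, u k = (qc z k - qc q k) / rho by exists (fun k => (qc z k - qc q k) / rho).
have u1 k : (k < 4)%N -> `|u k| <= 1.
  by move=> k4; rewrite hu normrM normfV (gtr0_norm r0) ler_pdivrMr // mul1r zq.
have u0 : 0 <= u 0%N by rewrite hu divr_ge0 ?subr_ge0 // ltW.
have bz : bar z < 2 * M by move: Pz; rewrite /Psi; lra.
rewrite barE -!hu in bz.
(* On the hyperplane of symmetry [rf] fixes [z], so that [Psi z = - bar z <= 0]. *)
have zgt : qc q 0 < qc z 0.
  rewrite lt_neqAle z0 andbT; apply/eqP => e; move: Pz.
  have -> : Psi z = - bar z by rewrite /Psi /rf -e subrr mulr0 scale0r subr0; ring.
  rewrite barE -!hu (_ : u 0%N = 0) ?mulr0; last by rewrite hu -e subrr mul0r.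
  rewrite mul0r addr0 oppr_gt0 ltNge !addr_ge0 // mulr_ge0 ?sqr_ge0 // mulr_ge0 // ltW //.
have u01 : u 0%N <= 1 by have := u1 0%N isT; rewrite ger0_norm.
have q0 : 0 <= 2 * M * u 0%N * (5 - 4 * u 0%N) by rewrite !mulr_ge0 // ?(ltW M0) //; lra.
have sq k : 0 <= 2 * M * u k ^+ 2 by rewrite mulr_ge0 ?sqr_ge0 // mulr_ge0 // ltW.
(* On an outer face a single summand of the barrier already reaches [2 * M], against [bz]. *)
have lt1 k : (k < 4)%N -> `|u k| < 1.
  move=> k4; rewrite lt_neqAle u1 // andbT; apply/eqP => e.
  have ek : u k ^+ 2 = 1 by rewrite -real_normK ?num_real // e expr1n.
  have [k0|k0] := eqVneq k 0%N.
    have e0 : u 0%N = 1 by rewrite -e k0 ger0_norm.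
    move: bz (sq 1%N) (sq 2%N) (sq 3%N); rewrite e0; lra.
  have : 2 * M <= 2 * M * u 1%N ^+ 2 + 2 * M * u 2%N ^+ 2 + 2 * M * u 3%N ^+ 2.
    move: (sq 1%N) (sq 2%N) (sq 3%N); case: k k4 k0 ek {e} => [|[|[|[|k]]]] // _ _ ->; rewrite mulr1; lra.
  lra.
(* Room to move from [z] along axis [i], both ways, inside the half cube. *)
pose del i := Num.min (rho - `|qc z i - qc q i|) (qc z 0 - qc q 0).
have del0 i : (i < 4)%N -> 0 < del i.
  move=> i4; rewrite lt_min !subr_gt0 zgt andbT.
  by have := lt1 i i4; rewrite hu normrM normfV (gtr0_norm r0) ltr_pdivrMr // mul1r.
have inA i t : (i < 4)%N -> `|t| <= del i -> A (z + t *: qe R i).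
  move=> i4; rewrite le_min => /andP[t1 t2]; split.
    rewrite inb_qcP ?ltW // => k k4; rewrite qc_addqe //; case: eqP => [->|_]; last by rewrite addr0 zq.
    rewrite addrAC (le_trans (ler_normD _ _)) //; lra.
  rewrite qc_addqe //; case: eqP => _; last by rewrite addr0.
  by move: t2; rewrite ler_norml => /andP[]; lra.
have no i : (i < 4)%N -> Psi2 i z <= 0.
  move=> i4; rewrite leNgt; apply/negP => P2.
  apply: (@second_derivative_test _ (fun t => Psi (z + t *: qe R i)) (fun t => Psi1 i (z + t *: qe R i)) 0 _ _ (del0 i i4) P2).
  - move=> t ht; rewrite add0r; have [Bt _] := inA i t i4 ht.
    have := @hasd_affine _ (fun s => Psi (z + t *: qe R i + s *: qe R i)) t (Psi1 i (z + t *: qe R i)) 1 (- t).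
    rewrite !mul1r subrr => /(_ (Psi_d1 i4 Bt)); apply: (@hasd_ext _ _ _ _ _ 1) => // s _.
    by rewrite -addrA -scalerDl mul1r addrCA subrr addr0.
  - exact: Psi_d2.
  - by move=> t ht; rewrite add0r scale0r addr0; apply: zmax; rewrite inE; apply: inA.
(* The [U] parts cancel by harmonicity, and the barrier leaves the sum [-2 * (-8 + 3 * 2) = 4] times
   [M / rho ^+ 2]. *)
have := harm Bz; have := harm (inb_rf (ltW r0) Bz).
have := no 0%N isT; have := no 1%N isT; have := no 2%N isT; have := no 3%N isT.
rewrite /Psi2 /cf /=.
have : 0 < M / rho ^+ 2 by rewrite divr_gt0 // exprn_gt0.
rewrite -!mulrA; lra.
Qed.

(** On the axis through [q] the tangential part of the barrier vanishes, and 10 is its slope at [q]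
    in units of [M / rho]. *)
Lemma axis_gradient_le h : 0 <= h <= rho ->
  U (q + h *: qe R 0) - U (q - h *: qe R 0) <= 10 * M * h / rho.
Proof.
move=> /andP[h0 hr].
have hx i : (i < 4)%N -> qc (q + h *: qe R 0) i - qc q i = if i == 0%N then h else 0.
  by move=> i4; rewrite qc_addqe // addrAC subrr add0r.
have Bx : B (q + h *: qe R 0).
  apply/(inb_qcP _ _ (ltW r0)) => k k4; rewrite hx //.
  by case: eqP => _; rewrite ?normr0 ?(ltW r0) // ger0_norm.
have rfx : rf q (q + h *: qe R 0) = q - h *: qe R 0.
  by rewrite /rf hx //=; apply/rowP => k; rewrite !mxE; ring.
have q0 : qc q 0 <= qc (q + h *: qe R 0) 0 by rewrite -subr_ge0 hx.
have := half_box_barrier Bx q0; rewrite rfx barE !hx //= !mul0r expr0n /= !mulr0 !add0r => H.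
apply: (le_trans H).
rewrite -subr_ge0 [X in 0 <= X](_ : _ = 8 * M * (h / rho) ^+ 2); last by ring.
by rewrite mulr_ge0 ?sqr_ge0 // mulr_ge0 // ltW.
Qed.

End MaxPrinciple.
End Harmonic.

(** * Gradient estimate and propagation of zeros *)

Section GradientEstimate.
Variable R : realType.
Implicit Types (x y q : quat R) (g : quat R -> R) (D : quat R -> Prop) (e rho t eta M h sigma : R).
Implicit Types (f : nat -> quat R -> R) (p : nat -> nat -> quat R -> R).

Lemma axis_gradient q rho M (U : quat R -> R) (U1 U2 : nat -> quat R -> R) h :
  0 < rho -> 0 < M -> UC (inb q rho) U ->
  (forall i, (i < 4)%N -> PD (inb q rho) i U (U1 i)) ->
  (forall i, (i < 4)%N -> PD (inb q rho) i (U1 i) (U2 i)) ->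
  (forall x, inb q rho x -> U2 0 x + U2 1 x + U2 2 x + U2 3 x = 0) ->
  (forall x, inb q rho x -> `|U x| <= M) -> 0 <= h <= rho ->
  `|U (q + h *: qe R 0) - U (q - h *: qe R 0)| <= 10 * M * h / rho.
Proof.
move=> r0 M0 cU d1 d2 hm bU hh; rewrite ler_norml (axis_gradient_le r0 M0 cU d1 d2) // andbT.
have := @axis_gradient_le R q rho M r0 M0 (fun x => -1 * U x) (fun i x => -1 * U1 i x)
  (fun i x => -1 * U2 i x) (UCZ (-1) cU) (fun i i4 => PDZ (-1) (d1 i i4)) (fun i i4 => PDZ (-1) (d2 i i4)) _ _ h hh.
have s1 x : inb q rho x -> -1 * U2 0%N x + -1 * U2 1%N x + -1 * U2 2%N x + -1 * U2 3%N x = 0.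
  by move=> /hm hx; lra.
have s2 x : inb q rho x -> `|-1 * U x| <= M by move=> /bU; rewrite mulN1r normrN.
by move=> /(_ s1 s2); lra.
Qed.

Lemma msys_sub D D' f p : (forall x, D' x -> D x) -> msys D f p -> msys D' f p.
Proof.
move=> s [a b c d]; split => [k|i k i4|i k i4|x /s]; last exact: d.
- exact: UC_sub (a k).
- exact: UC_sub (b _ _ i4).
- exact: PD_sub (c _ _ i4).
Qed.

Lemma inb_axis q rho h : `|h| <= rho -> inb q rho (q + h *: qe R 0).
Proof.
move=> hr; have r0 : 0 <= rho by apply: le_trans hr.
apply: (@inbD _ _ _ _ rho); last by rewrite (le_trans (norm_tqe _ _)).
by rewrite subrr; apply/(inb_qcP _ _ (lexx 0)) => k _; rewrite subrr normr0.
Qed.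

(** The bound for the smoothed component does not depend on the smoothing scale, which may therefore
    tend to 0. Half of the radius is left to the averages, hence 20 in place of 10. *)
Lemma msys_gradient q rho M f p h : 0 < rho -> 0 < M -> msys (inb q rho) f p ->
  (forall x, inb q rho x -> `|f 0%N x| <= M) -> 0 <= h <= rho / 2 ->
  `|f 0%N (q + h *: qe R 0) - f 0%N (q - h *: qe R 0)| <= 20 * M * h / rho.
Proof.
move=> r0 M0 mf bf /andP[h0 hr]; apply/ler_addgt0Pr => eta eta0.
have [u1 u2 u3 u4] := mf.
have eta8 : 0 < eta / 8 by rewrite divr_gt0.
have [del d0 hd] := u1 0%N _ eta8.
(* Four averages consume [8 * e <= rho / 2] of the radius, and each moves [f 0] by at most
   [eta / 8]: in total [eta] over the two points. *)
pose e := Num.min del (rho / 16).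
have e0 : 0 < e by rewrite lt_min d0 divr_gt0.
have er : e <= rho / 16 by rewrite ge_min lexx orbT.
have ed : e <= del by rewrite ge_min lexx.
have sub x : inb q (rho / 2) x -> inb q (lossB e rho 4) x.
  by apply: inb_le; rewrite /lossB; lra.
have G := @axis_gradient q (rho / 2) M (smooth e f) (smooth1 e f) (smooth2 e p) h.
have cl x : inb q (rho / 2) x -> `|smooth e f x - f 0%N x| <= eta / 8 * 4%:R.
  move=> /sub Bx; apply: (Sts_close e0 (u1 0%N) (l := l4)) Bx => y z By Bz yz.
  by apply: hd => //; apply: le_trans ed.
have {}G : `|smooth e f (q + h *: qe R 0) - smooth e f (q - h *: qe R 0)| <= 10 * M * h / (rho / 2).
  apply: G => //; rewrite ?divr_gt0 //.
  - apply: UC_sub sub _; exact: (Sts_UC e0 l4 (u1 0%N)).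
  - by move=> i i4; apply: PD_sub sub _; apply: smooth_PD => //; exact: mf.
  - by move=> i i4; apply: PD_sub sub _; apply: smooth_PD1 => //; exact: mf.
  - by move=> x /sub Bx; apply: (smooth_harmonic e0 mf Bx).
  - by move=> x /sub Bx; apply: (Sts_le e0 (u1 0%N) bf (l := l4)) Bx.
  - by rewrite h0.
have c1 := cl _ (@inb_axis q (rho / 2) h _).
have c2 := cl _ (@inb_axis q (rho / 2) (- h) _).
rewrite scaleNr normrN ger0_norm // in c2; rewrite ger0_norm // in c1.
move: (c1 hr) (c2 hr) G; set a := smooth e f _; set b := smooth e f _.
have -> : 10 * M * h / (rho / 2) = 20 * M * h / rho by field; rewrite gt_eqF.
rewrite !ler_norml => /andP[? ?] /andP[? ?] /andP[? ?]; apply/andP; split; lra.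
Qed.

Definition sdiff h f := fun c x => f c (x + h *: qe R 0) - f c (x - h *: qe R 0).

Lemma UC_shift q rho g (v : quat R) h : `|v| <= h -> UC (inb q (rho + h)) g ->
  UC (inb q rho) (fun x => g (x + v)).
Proof.
move=> vh H eta eta0; have [d d0 k] := H _ eta0; exists d => // x y Bx By xy.
have s z : inb q rho z -> inb q (rho + h) (z + v).
  by move=> Bz; apply: (@inbD _ _ _ _ h) => //; rewrite addrK.
by apply: k; [exact: s|exact: s|]; rewrite opprD addrACA subrr addr0.
Qed.

Lemma msys_sdiff q rho h f p : 0 <= h -> msys (inb q (rho + h)) f p ->
  msys (inb q rho) (sdiff h f) (fun i => sdiff h (p i)).
Proof.
move=> h0 [u1 u2 u3 u4].
have n1 : `|h *: qe R 0| <= h by rewrite (le_trans (norm_tqe _ _)) // ger0_norm.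
have n2 : `|- (h *: qe R 0)| <= h by rewrite normrN.
have s1 z : inb q rho z -> inb q (rho + h) (z + h *: qe R 0).
  by move=> Bz; apply: (@inbD _ _ _ _ h) => //; rewrite addrK.
have s2 z : inb q rho z -> inb q (rho + h) (z - h *: qe R 0).
  by move=> Bz; apply: (@inbD _ _ _ _ h) => //; rewrite addrK.
have S g : UC (inb q (rho + h)) g -> UC (inb q rho) (fun x => g (x + h *: qe R 0) - g (x - h *: qe R 0)).
  move=> H; have := UCD (UC_shift n1 H) (UCZ (-1) (UC_shift n2 H)).
  by move=> K eta eta0; have [d d0 k] := K _ eta0; exists d => // x y Bx By xy; have := k x y Bx By xy; rewrite !mulN1r.
split=> [c|i c i4|i c i4|x Bx].
- exact: S.
- by apply: S; apply: u2.
- move=> x Bx; have a := u3 i c i4 _ (s1 _ Bx); have b := u3 i c i4 _ (s2 _ Bx).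
  have := hasdD a (hasdZ (-1) b); rewrite mulN1r.
  apply: (@hasd_ext _ _ _ _ _ 1) => // t _.
  by rewrite mulN1r add0r /sdiff ![x + _ *: qe R i + _]addrAC.
- have [a1 a2 a3 a4] := u4 _ (s1 _ Bx); have [b1 b2 b3 b4] := u4 _ (s2 _ Bx).
  rewrite /mfeq /sdiff; split; lra.
Qed.

(** A symmetric difference of a solution is again a solution, so the gradient estimate can be
    repeated. Each round gives up [sigma] of the radius and gains the factor [20 * h / sigma]. *)
Lemma iter_sdiff k q rho sigma M f p h : 0 <= rho -> 0 < M -> 0 < h -> h <= sigma / 2 ->
  msys (inb q (rho + k%:R * sigma)) f p ->
  (forall x, inb q (rho + k%:R * sigma) x -> `|f 0%N x| <= M) ->
  forall x, inb q rho x -> `|iter k (sdiff h) f 0%N x| <= (20 * h / sigma) ^+ k * M.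
Proof.
move=> r0 + h0 hs; have s0 : 0 < sigma by lra.
elim: k M f p => [|k IH] M f p M0 mf bf x Bx.
  by rewrite expr0 mul1r; apply: bf; rewrite mul0r addr0.
have ks : rho + k.+1%:R * sigma = rho + k%:R * sigma + sigma by rewrite -[k.+1%:R]natr1; ring.
rewrite iterSr exprSr -mulrA.
have c0 : 0 < 20 * h / sigma by rewrite divr_gt0 // mulr_gt0.
apply: (IH _ (sdiff h f) (fun i => sdiff h (p i))) => //.
- by rewrite mulr_gt0.
- apply: msys_sdiff; first exact: ltW.
  apply: msys_sub mf => y; apply: inb_le; rewrite ks; lra.
- move=> y By.
  have sub z : inb y sigma z -> inb q (rho + k.+1%:R * sigma) z.
    Transparent inb.
    by rewrite ks /inb => yz; rewrite -(subrKA y) (le_trans (ler_normD _ _)) // addrC lerD.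
    Opaque inb.
  rewrite (_ : 20 * h / sigma * M = 20 * M * h / sigma); last by ring.
  apply: (msys_gradient s0 M0 (msys_sub sub mf)).
    by move=> z /sub; apply: bf.
  by rewrite ltW //.
Qed.

End GradientEstimate.

(** * Propagation of zeros along a line *)

Section LineVanishing.
Variable R : realType.
Implicit Types (phi : R -> R) (a : nat -> R) (h t M rho : R).

Definition fdiff a := fun j => a j.+1 - a j.
Definition cdiff h phi := fun t => phi (t + h) - phi (t - h).

(** The remainder of Newton's forward formula; the nested inductions follow Pascal's rule. *)
Lemma newton_bound k n a (B : R) : 0 <= B -> (forall j, (j < k)%N -> a j = 0) ->
  (forall j, (j + k <= n)%N -> `|iter k fdiff a j| <= B) -> `|a n| <= B * 'C(n, k)%:R.
Proof.
move=> B0; elim: k n a => [|k IH] n a az hB.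
  by rewrite bin0 mulr1; apply: (hB n); rewrite addn0.
elim: n hB => [|n IHn] hB; first by rewrite az // normr0 mulr_ge0.
rewrite binS natrD mulrDr -(subrK (a n) (a n.+1)) addrC (le_trans (ler_normD _ _)) //.
rewrite lerD //; first by apply: IHn => j hj; apply: hB; apply: leqW.
apply: (IH n (fdiff a)) => [j hj|j hj]; first by rewrite /fdiff !az ?subrr // ltnW.
by have := hB j; rewrite iterSr; apply; rewrite addnS.
Qed.

(** A forward difference of step [2 * h] is a centred one about the midpoint, which accounts for the
    shift by [k%:R * h]. *)
Lemma iter_fdiff k phi t0 h j :
  iter k fdiff (fun j => phi (t0 + j%:R * (2 * h))) j = iter k (cdiff h) phi (t0 + j%:R * (2 * h) + k%:R * h).
Proof.
elim: k j => [|k IH] j; first by rewrite mul0r addr0.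
rewrite !iterS /fdiff IH IH /cdiff; congr (_ - _); congr (iter _ _ _ _);
  rewrite -?[k.+1%:R]natr1 -?[j.+1%:R]natr1; ring.
Qed.

Lemma small_pow_eq0 (y M : R) : (forall k, `|y| <= (2^-1) ^+ k.+1 * M) -> y = 0.
Proof.
move=> h; apply/eqP; rewrite -normr_le0; apply/ler_addgt0Pr => e e0; rewrite add0r.
pose k := Num.bound (`|M| / e).
have hk : `|M| / e < k.+1%:R.
  by rewrite (lt_le_trans (archi_boundP _)) ?divr_ge0 ?(ltW e0) // ler_nat.
apply: (le_trans (h k)); rewrite exprVn mulrC ler_pdivrMr ?exprn_gt0 //.
rewrite (le_trans (ler_norm _)) // mulrC -ler_pdivrMr //.
by rewrite (le_trans (ltW hk)) // -natrX ler_nat ltnW // ltn_expl.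
Qed.

(** On a grid whose first [k] nodes lie in the known zero set, Newton's formula bounds [phi] at node
    [2 * k] by [(80 * h * k / rho) ^+ k * M]. This tends to 0 in [k] on a stretch of length [tau]
    independent of [k]. *)
Lemma line_vanish phi rho M hi : 0 < rho -> 0 < M -> (forall t, t <= 0 -> phi t = 0) ->
  (forall k h t, (0 < k)%N -> 0 < h -> h <= rho / k%:R / 2 -> - rho <= t <= hi ->
     `|iter k (cdiff h) phi t| <= (20 * h / (rho / k%:R)) ^+ k * M) ->
  forall t, t <= hi -> phi t = 0.
Proof.
(* 80 is the 20 of the difference bound times the 4 of ['C(2 * k, k) <= 4 ^+ k]; as
   [h * k <= tau / 2], the ratio is at most 1/2. *)
move=> r0 M0 z0 H; pose tau := rho / 80.
have tau0 : 0 < tau by rewrite divr_gt0.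
have step (a : R) : 0 <= a -> (forall t, t <= a -> t <= hi -> phi t = 0) -> forall t, t <= a + tau -> t <= hi -> phi t = 0.
  move=> a0 za b ba bhi; have [ab|ab] := leP b a; first exact: za.
  apply: (@small_pow_eq0 _ M) => k'; set k := k'.+1.
  have k0 : (0 : R) < k%:R by rewrite ltr0n.
  (* The grid goes from [t0] to [b] in [2 * k] steps of [2 * h]. Its first half has length
     [L / 2 <= tau], so the nodes below index [k] do not pass [a]. *)
  pose t0 := a - tau; pose L := b - t0.
  have L0 : 0 < L by rewrite /L /t0; lra.
  have L2 : L <= 2 * tau by rewrite /L /t0; lra.
  pose h := L / (4 * k%:R).
  have h0 : 0 < h by rewrite divr_gt0 // mulr_gt0.
  have hE : h * (4 * k%:R) = L by rewrite divfK // gt_eqF // mulr_gt0.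
  have hk : h * k%:R <= tau / 2 by lra.
  pose s j := phi (t0 + j%:R * (2 * h)).
  have -> : b = t0 + (2 * k)%:R * (2 * h) by rewrite natrM; rewrite /L in hE; lra.
  have hp : 0 <= (20 * h / (rho / k%:R)) ^+ k * M.
    by rewrite mulr_ge0 ?(ltW M0) // exprn_ge0 // !mulr_ge0 ?invr_ge0 ?divr_ge0 // ltW.
  have NB : `|s (2 * k)%N| <= (20 * h / (rho / k%:R)) ^+ k * M * 'C(2 * k, k)%:R.
    apply: newton_bound => //.
    - move=> j jk; apply: za.
        have : j%:R * h <= k%:R * h by rewrite ler_wpM2r ?ltW // ltr_nat.
        rewrite /t0; lra.
      have : j%:R * h <= k%:R * h by rewrite ler_wpM2r ?ltW // ltr_nat.
      rewrite /t0; lra.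
    - move=> j jk; rewrite iter_fdiff; apply: H => //.
        rewrite ler_pdivlMr // ler_pdivlMr //; rewrite /tau in hk; lra.
      have j0 : 0 <= j%:R * h by rewrite mulr_ge0 ?ler0n // ltW.
      have kh0 : 0 <= k%:R * h by rewrite mulr_ge0 ?ler0n // ltW.
      have : (j + k)%:R * h <= (2 * k)%:R * h by rewrite ler_wpM2r ?(ltW h0) // ler_nat.
      rewrite natrD natrM /t0; rewrite /tau in tau0 *; rewrite /L /t0 in hE.
      by move=> ?; apply/andP; split; rewrite /tau in hE *; lra.
  apply: (le_trans NB).
  rewrite mulrAC ler_wpM2r ?(ltW M0) //.
  have C4 : 'C(2 * k, k)%:R <= (4 : R) ^+ k.
    rewrite -natrX ler_nat (_ : 4 = 2 ^ 2)%N // -expnM.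
    have := expnDn 1 1 (2 * k); rewrite addn1 => ->.
    have hk' : (k < (2 * k).+1)%N by rewrite ltnS leq_pmull.
    by rewrite (bigD1 (Ordinal hk')) //= !exp1n !muln1 leq_addr.
  apply: (le_trans (ler_wpM2l _ C4)); first by rewrite exprn_ge0 // !mulr_ge0 ?invr_ge0 ?divr_ge0 // ltW.
  rewrite -exprMn lerXn2r ?nnegrE //.
    by rewrite !mulr_ge0 ?invr_ge0 ?divr_ge0 // ltW.
  rewrite invf_div.
  rewrite (_ : 20 * h * (k%:R / rho) * 4 = 80 * (h * k%:R) / rho); last by ring.
  rewrite ler_pdivrMr //; rewrite /tau in hk; lra.
move=> t thi.
have {}step m : forall t, t <= m%:R * tau -> t <= hi -> phi t = 0.
  elim: m => [|m IH] u; first by rewrite mul0r => /z0.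
  rewrite -[m.+1%:R]natr1 mulrDl mul1r; apply: step => //.
  by rewrite mulr_ge0 ?ler0n // ltW.
apply: (step (Num.bound (`|t| / tau))) => //.
by rewrite (le_trans (ler_norm _)) // -ler_pdivrMr // ltW // archi_boundP // divr_ge0 // ltW.
Qed.

End LineVanishing.

(** * Cauchy-Kovalevskaya uniqueness *)

Section CKUniqueness.
Variable R : realType.
Implicit Types (x y q : quat R) (g : quat R -> R) (e rho t eta M h : R).

Definition Nq x : R := 9 * qc x 0 ^+ 2 + qc x 1 ^+ 2 + qc x 2 ^+ 2 + qc x 3 ^+ 2.

Lemma EllE x : Ell x = (Nq x < 1) :> Prop. Proof. by []. Qed.

Lemma qc_sqr_le_Nq x k : (k < 4)%N -> qc x k ^+ 2 <= Nq x.
Proof.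
have := (sqr_ge0 (qc x 0), sqr_ge0 (qc x 1), sqr_ge0 (qc x 2), sqr_ge0 (qc x 3)).
by rewrite /Nq => -[[[? ?] ?] ?]; case: k => [|[|[|[|]]]] // _; lra.
Qed.

Lemma Nq_continuous x : {for x, continuous Nq}.
Proof.
have c i : (i < 4)%N -> {for x, continuous (fun x => qc x i ^+ 2)}.
  move=> i4; apply: (@continuousM _ _ (fun x => qc x i) (fun x => qc x i));
  by apply/quat_ctsP => eta e0; exists eta => // z xz; rewrite -qcB (le_trans (@qc_le_norm _ _ (Ordinal i4))).
rewrite (_ : Nq = (fun x => 9 * qc x 0 ^+ 2) + ((fun x => qc x 1 ^+ 2) + ((fun x => qc x 2 ^+ 2) + (fun x => qc x 3 ^+ 2)))).
  apply: continuousD; last by apply: continuousD; [exact: c|apply: continuousD; exact: c].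
  by apply: (@continuousM _ _ (fun _ => 9) (fun x => qc x 0 ^+ 2)); [exact: cst_continuous|exact: c].
by apply/funext => y; rewrite /Nq /=; rewrite !addrA.
Qed.

Lemma Ell_nbhs x : Ell x -> exists2 d : R, 0 < d & forall y, `|x - y| <= d -> Ell y.
Proof.
rewrite EllE => Ex; have e0 : 0 < (1 - Nq x) / 2 by rewrite divr_gt0 // subr_gt0.
have [d d0 hd] := (quat_ctsP Nq x).1 (@Nq_continuous x) _ e0.
exists d => // y /hd; rewrite EllE ler_norml => /andP[? ?]; lra.
Qed.

Lemma sum_ord3 (g : nat -> quat R) : \sum_(i < 3) g i.+1 = g 1%N + g 2%N + g 3%N.
Proof. by rewrite !big_ord_recr big_ord0 /= add0r. Qed.

Section Facts.
Variable F : quat R -> quat R.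
Hypothesis hF : hyperholo (@Ell R) F.
Let P i := 'D_(qe R i) F.

Lemma hyperholo_cts x : Ell x -> forall eta, 0 < eta -> exists2 d : R, 0 < d &
  forall y, `|x - y| <= d -> `|F x - F y| <= eta.
Proof.
move=> Ex; apply: (quat_ctsP F x).1; apply: differentiable_continuous.
by case: hF => h _; apply: h.
Qed.

Lemma hyperholo_Dcts i x : (i < 4)%N -> Ell x -> forall eta, 0 < eta -> exists2 d : R, 0 < d &
  forall y, `|x - y| <= d -> `|P i x - P i y| <= eta.
Proof.
move=> i4 Ex; apply: (quat_ctsP (P i) x).1.
by case: hF => _ [h _]; apply: (h (Ordinal i4)).
Qed.

Lemma hyperholo_line i x : Ell x -> forall eta, 0 < eta -> exists2 d : R, 0 < d &
  forall t, `|t| <= d -> `|F (x + t *: qe R i) - F x - t *: P i x| <= eta * `|t|.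
Proof.
move=> Ex e e0; case: hF => /(_ x Ex) dF _.
have dv : derivable F x (qe R i) by apply: diff_derivable.
have /cvgrPdist_le/(_ _ e0) : (fun t : R => t^-1 *: (F (t *: qe R i + x) - F x)) @ 0^' --> P i x.
  exact: dv.
move=> /nbhs_ballP[del /= d0 H].
exists (del / 2); first by rewrite divr_gt0.
move=> t td; have [->|t0] := eqVneq t 0.
  by rewrite !scale0r addr0 subr0 subrr !normr0 mulr0.
have : ball (0 : R) del t.
  by rewrite /ball /= sub0r normrN (le_lt_trans td) // ltr_pdivrMr // ltr_pMr // ltr1n.
move=> /H /(_ t0); rewrite -ler_pdivrMr ?normr_gt0 // => /(le_trans _); apply.
rewrite mulrC -normfV -normrZ [x + _]addrC [X in `|X| <= _]scalerBr scalerA mulVf // scale1r.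
by rewrite distrC.
Qed.

Lemma hyperholo_D x : Ell x -> P 0 x + (qmul (qe R 1) (P 1 x) + qmul (qe R 2) (P 2 x) + qmul (qe R 3) (P 3 x)) = 0.
Proof.
move=> Ex; have [_ [_ /(_ x Ex) h]] := hF.
rewrite -[RHS]h; symmetry.
exact: (congr1 (fun z => P 0 x + z) (sum_ord3 (fun k => qmul (qe R k) (P k x)))).
Qed.

End Facts.

Lemma half_cts (G : quat R -> R) x :
  (forall eta, 0 < eta -> exists2 d : R, 0 < d & forall y, `|x - y| <= d -> `|G x - G y| <= eta) ->
  (qc x 0 = 0 -> G x = 0) ->
  {for x, continuous (fun y => if 0 < qc y 0 then G y else 0)}.
Proof.
move=> cG z0; apply/quat_ctsP => eta eta0; have [d d0 H] := cG _ eta0.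
have near y : `|x - y| <= `|qc x 0| / 2 -> `|qc x 0 - qc y 0| <= `|qc x 0| / 2.
  by apply: le_trans; rewrite -qcB (@qc_le_norm _ _ (@Ordinal 4 0 isT)).
have [x0|x0|x0] := ltgtP 0 (qc x 0).
- exists (Num.min d (`|qc x 0| / 2)); first by rewrite lt_min d0 divr_gt0 // normr_gt0 gt_eqF.
  move=> y; rewrite le_min => /andP[/H h1 /near]; rewrite (gtr0_norm x0) ler_norml => /andP[h2 h3].
  by rewrite ifT //; lra.
- exists (`|qc x 0| / 2); first by rewrite divr_gt0 // normr_gt0 lt_eqF.
  move=> y /near; rewrite (ltr0_norm x0) ler_norml => /andP[h2 h3].
  by rewrite ifF ?subrr ?normr0 ?ltW //; apply/negbTE; rewrite -leNgt; lra.
- exists d => // y /H; rewrite (z0 (esym x0)); case: ifP => // _ _.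
  by rewrite subrr normr0 ltW.
Qed.

(** At [x0 = 0] an increment of the cut function is zero or an increment of [G], and [G] vanishes
    there together with its derivative; so extension by zero stays differentiable. *)
Lemma half_line (G G' : quat R -> R) i x :
  hasd (fun t => G (x + t *: qe R i)) 0 (G' x) ->
  (qc x 0 = 0 -> G x = 0) -> (qc x 0 = 0 -> G' x = 0) ->
  hasd (fun t => (fun y => if 0 < qc y 0 then G y else 0) (x + t *: qe R i)) 0
    (if 0 < qc x 0 then G' x else 0).
Proof.
move=> hG z0 z1.
have near t : `|t| <= `|qc x 0| / 2 -> `|qc x 0 - qc (x + t *: qe R i) 0| <= `|qc x 0| / 2.
  apply: le_trans; rewrite -qcB (le_trans (@qc_le_norm _ _ (@Ordinal 4 0 isT))) //.
  by rewrite opprD addrA subrr sub0r normrN norm_tqe.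
have [x0|x0|x0] := ltgtP 0 (qc x 0).
- apply: hasd_ext hG; last first.
    move=> t; rewrite add0r => /near; rewrite (gtr0_norm x0) ler_norml => /andP[h2 h3].
    by rewrite ifT //; lra.
  by rewrite divr_gt0 // normr_gt0 gt_eqF.
- move=> eta eta0; exists (`|qc x 0| / 2); first by rewrite divr_gt0 // normr_gt0 lt_eqF.
  move=> t /near; rewrite add0r (ltr0_norm x0) ler_norml => /andP[h2 h3].
  rewrite ifF; last by apply/negbTE; rewrite -leNgt; lra.
  rewrite scale0r addr0 ifF; last by apply/negbTE; rewrite -leNgt ltW.
  by rewrite mulr0 !subr0 normr0 mulr_ge0 // ltW.
- move=> eta eta0; have [d d0 H] := hG _ eta0; exists d => // t /H.
  rewrite add0r scale0r addr0 -x0 ltxx (z0 (esym x0)) (z1 (esym x0)) mulr0 !subr0.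
  by case: ifP => // _ _; rewrite normr0 mulr_ge0 // ltW.
Qed.

(** [D] multiplies from the left, hence commutes with right multiplication by [w]: the coordinates
    of [(D f) w] are combinations of the four equations. *)
Lemma mfeq_const (a : nat -> quat R) :
  a 0%N + (qmul (qe R 1) (a 1%N) + qmul (qe R 2) (a 2%N) + qmul (qe R 3) (a 3%N)) = 0 ->
  forall (w : quat R) (s : R) x, mfeq (fun i c _ => s * qc (qmul (a i) w) c) x.
Proof.
move=> D w s x; rewrite /mfeq.
move: (a 0%N) (a 1%N) (a 2%N) (a 3%N) D => a0 a1 a2 a3 D.
rewrite /qmul !qc_mk.
have := congr1 (fun a => qc a 0) D; have := congr1 (fun a => qc a 1) D.
have := congr1 (fun a => qc a 2) D; have := congr1 (fun a => qc a 3) D.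
rewrite /qmul !(qcsimp, qc_qe).
move: (qc a0 0) (qc a0 1) (qc a0 2) (qc a0 3) (qc a1 0) (qc a1 1) (qc a1 2) (qc a1 3) => {a0 a1 D} a00 a01 a02 a03 a10 a11 a12 a13.
move: (qc a2 0) (qc a2 1) (qc a2 2) (qc a2 3) (qc a3 0) (qc a3 1) (qc a3 2) (qc a3 3) => {a2 a3} a20 a21 a22 a23 a30 a31 a32 a33.
move: (qc w 0) (qc w 1) (qc w 2) (qc w 3) => {w} w0 w1 w2 w3 E3 E2 E1 E0.
have H0 : a00 - a11 - a22 - a33 = 0 by lra.
have H1 : a01 + a10 + a23 - a32 = 0 by lra.
have H2 : a02 - a13 + a20 + a31 = 0 by lra.
have H3 : a03 + a12 - a21 + a30 = 0 by lra.
split.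
- rewrite [LHS](_ : _ = s * ((a00 - a11 - a22 - a33) * w0 - (a01 + a10 + a23 - a32) * w1 - (a02 - a13 + a20 + a31) * w2 - (a03 + a12 - a21 + a30) * w3)); last by ring.
  by rewrite H0 H1 H2 H3; ring.
- rewrite [LHS](_ : _ = s * ((a00 - a11 - a22 - a33) * w1 + (a01 + a10 + a23 - a32) * w0 + (a02 - a13 + a20 + a31) * w3 - (a03 + a12 - a21 + a30) * w2)); last by ring.
  by rewrite H0 H1 H2 H3; ring.
- rewrite [LHS](_ : _ = s * ((a00 - a11 - a22 - a33) * w2 - (a01 + a10 + a23 - a32) * w3 + (a02 - a13 + a20 + a31) * w0 + (a03 + a12 - a21 + a30) * w1)); last by ring.
  by rewrite H0 H1 H2 H3; ring.
- rewrite [LHS](_ : _ = s * ((a00 - a11 - a22 - a33) * w3 + (a01 + a10 + a23 - a32) * w2 - (a02 - a13 + a20 + a31) * w1 + (a03 + a12 - a21 + a30) * w0)); last by ring.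
  by rewrite H0 H1 H2 H3; ring.
Qed.

Section Uniqueness.
Variable F : quat R -> quat R.
Hypothesis hF : hyperholo (@Ell R) F.
Hypothesis F0 : forall x, Ell x -> qc x 0 = 0 -> F x = 0.
Let P i := 'D_(qe R i) F.

(** Tangential derivatives vanish because [F] does so along the hyperplane; then [D F = 0] leaves
    only the normal derivative, whose coefficient is 1. *)
Lemma hyperholo_D0 i x : (i < 4)%N -> Ell x -> qc x 0 = 0 -> P i x = 0.
Proof.
move=> i4 Ex x0.
have tang j : (j < 4)%N -> (j != 0)%N -> P j x = 0.
  move=> j4 j0; apply/eqP; rewrite -normr_le0; apply/ler_addgt0Pr => eta eta0; rewrite add0r.
  have [d d0 hd] := Ell_nbhs Ex; have [u u0 hu] := hyperholo_line hF j Ex eta0.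
  pose t := Num.min d u; have t0 : 0 < t by rewrite lt_min d0.
  have at_ : `|t| = t by rewrite gtr0_norm.
  have := hu t; rewrite at_ ge_min lexx orbT => /(_ isT).
  have Et : Ell (x + t *: qe R j).
    by apply: hd; rewrite opprD addrA subrr sub0r normrN (le_trans (norm_tqe _ _)) // at_ ge_min lexx.
  rewrite (F0 Et); last by rewrite qc_addqe // eq_sym (negbTE j0) addr0.
  by rewrite (F0 Ex x0) subrr sub0r normrN normrZ at_ mulrC ler_pM2r.
have [->|i0] := eqVneq i 0%N; last exact: tang.
have D : P 0 x + (qmul (qe R 1) (P 1 x) + qmul (qe R 2) (P 2 x) + qmul (qe R 3) (P 3 x)) = 0 := hyperholo_D hF Ex.
by rewrite (tang 1%N) // (tang 2%N) // (tang 3%N) // !qmul0r !addr0 in D.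
Qed.

Lemma sqr_shift_le (a b r : R) : `|b| <= 1 -> `|a - b| <= r -> 0 <= r <= 1 -> a ^+ 2 <= b ^+ 2 + 3 * r.
Proof.
move=> b1 ab /andP[r0 r1].
have h1 : b * (a - b) <= r.
  by rewrite (le_trans (ler_norm _)) // normrM -[r]mul1r ler_pM.
have h2 : (a - b) ^+ 2 <= r ^+ 2 by rewrite -real_normK ?num_real // lerXn2r ?nnegrE.
have h3 : r ^+ 2 <= r by rewrite expr2 ler_piMr.
have -> : a ^+ 2 = (a - b) ^+ 2 + 2 * (b * (a - b)) + b ^+ 2 by ring.
lra.
Qed.

Section Half.
Variables (s : R) (w : quat R).
Hypothesis s1 : s ^+ 2 = 1.

(* The sign [s = +-1] selects the half space, and the factor [w] brings any
   component of [F] to position 0 while preserving [D F = 0]. *)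
Let G c y := qc (qmul (F (s *: y)) w) c.
Let G' i c y := s * qc (qmul (P i (s *: y)) w) c.
Let f (c : nat) y := if 0 < qc y 0 then G c y else 0.
Let p (i c : nat) y := if 0 < qc y 0 then G' i c y else 0.

Let abs_s : `|s| = 1.
Proof. by apply/eqP; rewrite -(@eqrXn2 _ 2) // ?real_normK ?num_real // s1 expr1n. Qed.

Let Nqs y : Nq (s *: y) = Nq y.
Proof. by rewrite /Nq !qcZ !exprMn s1 !mul1r. Qed.
Let Ells y : Ell y -> Ell (s *: y). Proof. by rewrite !EllE Nqs. Qed.

Let qcw (a : quat R) c : `|qc (qmul a w) c| <= 2 * qn w * `|a|.
Proof.
have -> : qc (qmul a w) c = qc (qmul a w) (inord c : 'I_4) by rewrite /qc inord_val.
by rewrite (le_trans (qc_le_qn _ _)) // qnM mulrC -mulrA mulrCA ler_wpM2l ?qn_ge0 // qn_le_norm.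
Qed.
Let w1 : 0 < 1 + 2 * qn w. Proof. by rewrite ltr_pwDl // mulr_ge0 // qn_ge0. Qed.

Let bound (a : quat R) c eta : 0 < eta -> `|a| <= eta / (1 + 2 * qn w) -> `|qc (qmul a w) c| <= eta.
Proof.
move=> e0 h; rewrite (le_trans (qcw _ _)) // (le_trans (ler_wpM2l _ h)) ?mulr_ge0 ?qn_ge0 //.
by rewrite mulrCA ler_piMr ?(ltW e0) // ler_pdivrMr // mul1r lerDr.
Qed.

Let G_cts c x : Ell x -> forall eta, 0 < eta -> exists2 d : R, 0 < d & forall y, `|x - y| <= d -> `|G c x - G c y| <= eta.
Proof.
move=> /Ells Ex eta eta0; have e2 : 0 < eta / (1 + 2 * qn w) by rewrite divr_gt0.
have [d d0 H] := hyperholo_cts hF Ex e2; exists d => // y xy.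
by rewrite /G -qcB -qmulBl bound // H // -scalerBr normrZ abs_s mul1r.
Qed.
Let G'_cts i c x : (i < 4)%N -> Ell x -> forall eta, 0 < eta -> exists2 d : R, 0 < d & forall y, `|x - y| <= d -> `|G' i c x - G' i c y| <= eta.
Proof.
move=> i4 /Ells Ex eta eta0; have e2 : 0 < eta / (1 + 2 * qn w) by rewrite divr_gt0.
have [d d0 H] := hyperholo_Dcts hF i4 Ex e2; exists d => // y xy.
by rewrite /G' -mulrBr normrM abs_s mul1r -qcB -qmulBl bound // H // -scalerBr normrZ abs_s mul1r.
Qed.
Let G_line i c x : Ell x -> hasd (fun t => G c (x + t *: qe R i)) 0 (G' i c x).
Proof.
move=> /Ells Ex eta eta0; have e2 : 0 < eta / (1 + 2 * qn w) by rewrite divr_gt0.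
have [d d0 H] := hyperholo_line hF i Ex e2; exists d => // t td.
rewrite add0r scale0r addr0.
have -> : G c (x + t *: qe R i) - G c x - t * G' i c x =
  qc (qmul (F (s *: x + (t * s) *: qe R i) - F (s *: x) - (t * s) *: P i (s *: x)) w) c.
  by rewrite !qmulBl qmulZl !qcB qcZ mulrA /G scalerDr scalerA [s * t]mulrC.
have := H (t * s); rewrite normrM abs_s mulr1 => /(_ td) h.
have [->|t0] := eqVneq t 0.
  by rewrite !mul0r !scale0r addr0 subr0 subrr qmul0l qc_0 normr0 mulr0.
apply: bound; first by rewrite mulr_gt0 // normr_gt0.
by rewrite mulrAC.
Qed.
Let G_0 c x : Ell x -> qc x 0 = 0 -> G c x = 0.
Proof. by move=> /Ells Ex x0; rewrite /G F0 ?qmul0l ?qc_0 // qcZ x0 mulr0. Qed.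
Let G'_0 i c x : (i < 4)%N -> Ell x -> qc x 0 = 0 -> G' i c x = 0.
Proof. by move=> i4 /Ells Ex x0; rewrite /G' hyperholo_D0 ?qmul0l ?qc_0 ?mulr0 // qcZ x0 mulr0. Qed.

Let mfeq_p x : Ell x -> mfeq p x.
Proof.
move=> /Ells Ex.
have D1 : P 0 (s *: x) + (qmul (qe R 1) (P 1 (s *: x)) + qmul (qe R 2) (P 2 (s *: x)) + qmul (qe R 3) (P 3 (s *: x))) = 0 := hyperholo_D hF Ex.
have := @mfeq_const (fun i => P i (s *: x)) D1 w s x.
rewrite /mfeq /p; case: (0 < qc x 0) => // _; split; by rewrite ?subr0 ?addr0 ?subr0 ?addr0.
Qed.

Let msys_f q rho : (forall x, inb q rho x -> Ell x) -> msys (inb q rho) f p.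
Proof.
move=> sub; split.
- by move=> c; apply: continuous_UC => x /sub Ex; apply: half_cts; [exact: G_cts|exact: G_0].
- by move=> i c i4; apply: continuous_UC => x /sub Ex; apply: half_cts; [exact: G'_cts|exact: G'_0].
- by move=> i c i4 x /sub Ex; apply: half_line; [exact: G_line|exact: G_0|exact: G'_0].
- by move=> x /sub; exact: mfeq_p.
Qed.

Lemma upper_half_zero x : Ell x -> 0 < qc x 0 -> qc (qmul (F (s *: x)) w) 0 = 0.
Proof.
move=> Ex x0; pose T := qc x 0; pose base := Nq x.
have b1 : base < 1 by [].
have Tp : 0 < T by [].
have b0 : 0 <= base by apply: le_trans (qc_sqr_le_Nq x (isT : (0 < 4)%N)); rewrite sqr_ge0.
(* A compact sublevel set halfway between the level of [x] and the boundary: it provides the bound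
   [M] and contains all cubes used below. *)
pose A := [set y | Nq y <= (1 + base) / 2].
have AE y : A y -> Ell y by rewrite EllE /A /= => h; apply: (le_lt_trans h); lra.
have Acl : closed A.
  by apply: (preimage_closed (f := Nq) _ (@closed_le _ ((1 + base) / 2))) => y _; exact: Nq_continuous.
have Acp : compact A.
  apply: (inb_compact (q := 0) (rho := 1)) => // y Ay; apply/(inb_qcP _ _ ler01) => k k4.
  rewrite qc_0 subr0 -(@ler_pXn2r _ 2) ?nnegrE // expr1n real_normK ?num_real //.
  by rewrite (le_trans (qc_sqr_le_Nq _ k4)) // ltW //; exact: AE.
have [M M0 hM] : exists2 M, 0 < M & forall y, A y -> `|f 0 y| <= M.
  have cf : {within A, continuous (fun y => `|f 0 y|)}.
    apply: continuous_in_subspaceT => y; rewrite inE => /AE Ey.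
    apply/quat_ctsP => eta eta0.
    have [d d0 H] := (quat_ctsP _ _).1 (half_cts (G_cts 0 Ey) (G_0 0 Ey)) _ eta0.
    by exists d => // z /H; apply: le_trans; exact: ler_dist_dist.
  have [|z _ zmax] := @EVT_max_rV R 4 (fun y => `|f 0 y|) A _ Acp cf.
    by exists x; rewrite /A /= -/base; lra.
  exists (1 + `|f 0 z|); first by rewrite ltr_pwDl.
  by move=> y Ay; rewrite (le_trans (zmax y _)) ?inE // lerDr.
(* In the cubes around the segment [Nq] exceeds [base] by at most [81 * rho], half of the gap:
   [9 * 8] from coordinate 0 and 3 from each of the others. *)
pose rho := (1 - base) / 162.
have rho0 : 0 < rho by rewrite divr_gt0 // subr_gt0.
have xk k : (k < 4)%N -> `|qc x k| <= 1.
  move=> k4; rewrite -(@ler_pXn2r _ 2) ?nnegrE // expr1n real_normK ?num_real //.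
  by rewrite (le_trans (qc_sqr_le_Nq _ k4)) // ltW.
have box t y : - rho <= t <= T -> inb (x + (t - T) *: qe R 0) rho y -> A y.
  move=> /andP[t1 t2] /(inb_qcP _ _ (ltW rho0)) hy.
  have := (hy 0%N isT, hy 1%N isT, hy 2%N isT, hy 3%N isT).
  rewrite !qc_addqe //= !addr0 => -[[[y0 y1] y2] y3].
  have sqk k : (k < 4)%N -> `|qc y k - qc x k| <= rho -> qc y k ^+ 2 <= qc x k ^+ 2 + 3 * rho.
    move=> /xk h1 h2; apply: sqr_shift_le => //; rewrite ltW //=; rewrite /rho; lra.
  have sq0 : qc y 0 ^+ 2 <= T ^+ 2 + 8 * rho.
    have := xk 0%N isT; rewrite -/T gtr0_norm // => T1.
    have r1 : rho <= 1 by rewrite /rho; lra.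
    have ya : `|qc y 0| <= T + 2 * rho.
      move: y0; rewrite -/T (_ : T + (t - T) = t); last by ring.
      by rewrite !ler_norml => /andP[? ?]; apply/andP; split; lra.
    rewrite -real_normK ?num_real //.
    have : `|qc y 0| ^+ 2 <= (T + 2 * rho) ^+ 2 by rewrite lerXn2r ?nnegrE // (le_trans _ ya).
    have t3 : T * rho <= rho by rewrite ler_piMl // ltW.
    have t4 : rho ^+ 2 <= rho by rewrite expr2 ler_piMl // ltW.
    rewrite (_ : (T + 2 * rho) ^+ 2 = T ^+ 2 + 4 * (T * rho) + 4 * rho ^+ 2); last by ring.
    by move=> /le_trans; apply; lra.
  have := sqk 1%N isT y1; have := sqk 2%N isT y2; have := sqk 3%N isT y3.
  rewrite /A /= /Nq.
  have : base = 9 * T ^+ 2 + qc x 1 ^+ 2 + qc x 2 ^+ 2 + qc x 3 ^+ 2 by [].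
  have : rho * 162 = 1 - base by rewrite /rho divfK.
  lra.
(* The vertical line through [x], parametrized by the coordinate [x0]; [phi] vanishes for [t <= 0]
   because [f] is extended by zero. *)
pose phi t := f 0%N (x + (t - T) *: qe R 0).
have itE k h t : iter k (cdiff h) phi t = iter k (sdiff h) f 0%N (x + (t - T) *: qe R 0).
  elim: k t => [//|k IH] t; rewrite iterS.
  have cE (ps : R -> R) u : cdiff h ps u = ps (u + h) - ps (u - h) by [].
  rewrite cE !IH (_ : x + (t + h - T) *: qe R 0 = x + (t - T) *: qe R 0 + h *: qe R 0).
    rewrite (_ : x + (t - h - T) *: qe R 0 = x + (t - T) *: qe R 0 - h *: qe R 0) //.
    by apply/rowP => j; rewrite !mxE; ring.
  by apply/rowP => j; rewrite !mxE; ring.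
have -> : qc (qmul (F (s *: x)) w) 0 = phi T.
  by rewrite /phi subrr scale0r addr0 /f x0.
apply: (@line_vanish R phi rho M T) => //.
  by move=> t t0; rewrite /phi /f ifF // qc_addqe //=; apply/negbTE; rewrite -leNgt -/T; lra.
move=> k h t k0 h0 hk tt; rewrite itE.
have kk : 0 + k%:R * (rho / k%:R) = rho by rewrite add0r mulrC divfK // pnatr_eq0 -lt0n.
(* Only the centre is needed in the end, so the final radius is 0 and all of [rho] is divided into
   [k] layers. *)
apply: (@iter_sdiff _ k (x + (t - T) *: qe R 0) 0 (rho / k%:R) M f p h (lexx 0) M0 h0 hk).
- by rewrite kk; apply: msys_f => y By; apply: AE; apply: box By.
- by rewrite kk => y By; apply: hM; apply: box By.
- by apply/(inb_qcP _ _ (lexx 0)) => j _; rewrite subrr normr0.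
Qed.

End Half.

Theorem CK_unique x : Ell x -> F x = 0.
Proof.
move=> Ex; have main s : s ^+ 2 = 1 -> 0 < qc (s *: x) 0 -> F x = 0.
  move=> s1 x0; have Es : Ell (s *: x) by rewrite EllE /Nq !qcZ !exprMn s1 !mul1r.
  (* For this [w] coordinate 0 of [F x w] is [|F x|^2], so one scalar identity settles all
     components. *)
  have := upper_half_zero (qconj (F x)) s1 Es x0.
  rewrite scalerA -expr2 s1 scale1r => h; apply: qnorm2_eq0.
  by rewrite -h qnorm2E /qmul /qconj !qcsimp; ring.
have [x0|x0|x0] := ltgtP (qc x 0) 0; last exact: F0.
- by apply: (main (-1)); rewrite ?sqrrN ?expr1n // qcZ mulN1r oppr_gt0.
- by apply: (main 1); rewrite ?expr1n // scale1r.
Qed.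

End Uniqueness.
End CKUniqueness.

(** * The polynomials P_m *)

Section Polynomials.
Variable R : realType.
Implicit Types (x y a b h : quat R).

Lemma qpowSr x n : qpow x n.+1 = qmul (qpow x n) x.
Proof.
elim: n => [|n IH]; first by rewrite /= qmul1l qmul1r.
by rewrite -[LHS]/(qmul x (qpow x n.+1)) {1}IH qmulA.
Qed.

Definition qcomm a b := qmul a b = qmul b a.
Lemma qcommD a b c : qcomm a c -> qcomm b c -> qcomm (a + b) c.
Proof. by rewrite /qcomm qmulDl qmulDr => -> ->. Qed.
Lemma qcommZ t a c : qcomm a c -> qcomm (t *: a) c.
Proof. by rewrite /qcomm qmulZl qmulZr => ->. Qed.
Lemma qcommM a b c : qcomm a c -> qcomm b c -> qcomm (qmul a b) c.
Proof. by rewrite /qcomm => h1 h2; rewrite -qmulA h2 qmulA h1 -qmulA. Qed.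
Lemma qcomm1 c : qcomm (qone R) c. Proof. by rewrite /qcomm qmul1l qmul1r. Qed.
Lemma qcomm_pow a c n : qcomm a c -> qcomm (qpow a n) c.
Proof. by move=> h; elim: n => [|n IH]; [exact: qcomm1|exact: qcommM]. Qed.
Lemma qcomm_conj x : qcomm (qconj x) x. Proof. by rewrite /qcomm qmul_conjC. Qed.

(* [Qm m x = sum_j (m - j + 1) x^(m-j) conj(x)^j]: [P_m] without its normalization. *)
Fixpoint Qm (m : nat) x : quat R :=
  if m is m'.+1 then qmul (Qm m' x) (qconj x) + (m'.+2)%:R *: qpow x m'.+1 else qone R.

(* [Um m x = sum_j x^(m-j) conj(x)^j]. *)
Fixpoint Um (m : nat) x : quat R :=
  if m is m'.+1 then qmul (Um m' x) x + qpow (qconj x) m'.+1 else qone R.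

Lemma qcomm_Qm m x : qcomm (Qm m x) x.
Proof.
elim: m => [|m IH]; first exact: qcomm1.
apply: qcommD; first by apply: qcommM => //; exact: qcomm_conj.
by apply: qcommZ; apply: qcomm_pow.
Qed.

Lemma UmSr m x : Um m.+1 x = qmul (Um m x) (qconj x) + qpow x m.+1.
Proof.
elim: m => [|m IH]; first by rewrite /= !qmul1l !qmul1r addrC.
rewrite -[LHS]/(qmul (Um m.+1 x) x + qpow (qconj x) m.+2) {1}IH.
rewrite qmulDl -qmulA -qmul_conjC qmulA -qpowSr.
rewrite [qpow (qconj x) m.+2]qpowSr addrAC -qmulDl //.
Qed.

(** Multiplication by [x - conj(x)] telescopes the weighted sum. *)
Lemma Qm_diff m x : qmul (Qm m x) (x - qconj x) = (m.+2)%:R *: qpow x m.+1 - Um m.+1 x.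
Proof.
elim: m => [|m IH].
  rewrite /= !qmul1l !qmul1r scaler_nat mulr2n; apply/rowP => k; rewrite !mxE; ring.
rewrite -[Qm m.+1 x]/(qmul (Qm m x) (qconj x) + m.+2%:R *: qpow x m.+1).
have c : qcomm (qconj x) (x - qconj x).
  by rewrite /qcomm qmulBl qmulBr qmul_conjC.
rewrite qmulDl -qmulA c qmulA IH qmulBl qmulZl qmulZl qmulBr -qpowSr (UmSr m.+1).
rewrite -[m.+3%:R]natr1; move: (m.+2%:R : R) => N.
move: (qmul (qpow x m.+1) _) (qmul (Um m.+1 x) _) (qpow x m.+2) => a b d.
by apply/rowP => k; rewrite !mxE; ring.
Qed.

(** Conjugation reverses the order of the monomials, so the weights [m - j + 1] and [j + 1] meet and
    add up to [m + 2]. *)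
Lemma Qm_conj m x : Qm m x + qconj (Qm m x) = (m.+2)%:R *: Um m x.
Proof.
elim: m => [|m IH]; first by rewrite /= qconj1 scaler_nat mulr2n.
have e : qconj (Qm m x) = m.+2%:R *: Um m x - Qm m x by rewrite -IH addrC addKr.
have cp n : qconj (qpow x n) = qpow (qconj x) n.
  by elim: n => [|n IHn]; [rewrite /= qconj1|rewrite qpowSr qconjM IHn].
have cU : qcomm (Um m x) x.
  elim: (m) => [|k IHk]; first exact: qcomm1.
  apply: qcommD; first by apply: qcommM.
  by apply: qcomm_pow; exact: qcomm_conj.
rewrite -[Qm m.+1 x]/(qmul (Qm m x) (qconj x) + m.+2%:R *: qpow x m.+1).
rewrite qconjD qconjM qconjK qconjZ cp e qmulBr qmulZr -cU -(qcomm_Qm m x).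
have D := Qm_diff m x; rewrite qmulBr in D.
have UE : Um m.+1 x = qmul (Um m x) x + qpow (qconj x) m.+1 by [].
have -> : qmul (Qm m x) (qconj x) = qmul (Qm m x) x - (m.+2%:R *: qpow x m.+1 - Um m.+1 x).
  by rewrite -D opprB addrC subrK.
rewrite UE -[m.+3%:R]natr1; move: (m.+2%:R : R) => N.
move: (qmul (Qm m x) x) (qmul (Um m x) x) (qpow x m.+1) (qpow (qconj x) m.+1) => a b d e'.
by apply/rowP => k; rewrite !mxE; ring.
Qed.

Fixpoint dpow (n : nat) x h : quat R :=
  if n is n'.+1 then qmul (dpow n' x h) x + qmul (qpow x n') h else 0.

Fixpoint dQ (m : nat) x h : quat R :=
  if m is m'.+1 then qmul (dQ m' x h) (qconj x) + qmul (Qm m' x) (qconj h) + (m'.+2)%:R *: dpow m'.+1 x h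
  else 0.

(** The value of [D] on a map whose differential at the point is [L]. *)
Definition qD (L : quat R -> quat R) : quat R :=
  L (qe R 0) + (qmul (qe R 1) (L (qe R 1)) + qmul (qe R 2) (L (qe R 2)) + qmul (qe R 3) (L (qe R 3))).

Lemma qDD L L' : qD (fun h => L h + L' h) = qD L + qD L'.
Proof. by rewrite /qD !qmulDr; apply/rowP => k; rewrite !mxE; ring. Qed.
Lemma qDZ t L : qD (fun h => t *: L h) = t *: qD L.
Proof. by rewrite /qD !qmulZr !scalerDr. Qed.
Lemma qDM L w : qD (fun h => qmul (L h) w) = qmul (qD L) w.
Proof. by rewrite /qD !qmulDl !qmulA. Qed.
Lemma qD0 : qD (fun=> 0) = 0. Proof. by rewrite /qD !qmul0r !addr0. Qed.
Lemma qe_l a : ((qmul (qe R 1) a = qmk (- qc a 1) (qc a 0) (- qc a 3) (qc a 2)) *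
  (qmul (qe R 2) a = qmk (- qc a 2) (qc a 3) (qc a 0) (- qc a 1)) *
  (qmul (qe R 3) a = qmk (- qc a 3) (- qc a 2) (qc a 1) (qc a 0)))%type.
Proof. by split; [split|]; qring. Qed.
Lemma qe_r a : ((qmul a (qe R 0) = a) *
  (qmul a (qe R 1) = qmk (- qc a 1) (qc a 0) (qc a 3) (- qc a 2)) *
  (qmul a (qe R 2) = qmk (- qc a 2) (- qc a 3) (qc a 0) (qc a 1)) *
  (qmul a (qe R 3) = qmk (- qc a 3) (qc a 2) (- qc a 1) (qc a 0)))%type.
Proof. by split; [split; [split|]|]; qring. Qed.
Lemma qconj_qe : ((qconj (qe R 0) = qe R 0) * (qconj (qe R 1) = - qe R 1) *
  (qconj (qe R 2) = - qe R 2) * (qconj (qe R 3) = - qe R 3))%type.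
Proof. by split; [split; [split|]|]; qring. Qed.
Lemma qD_id a : qD (fun h => qmul a h) = (- 2) *: qconj a.
Proof. by rewrite /qD !qe_r !qe_l; apply: quatP; rewrite /qconj !qcsimp; ring. Qed.
Lemma qD_conj a : qD (fun h => qmul a (qconj h)) = 2 *: (a + qconj a).
Proof. by rewrite /qD !qconj_qe !qmulNr !qe_r !qe_l; apply: quatP; rewrite /qconj !qcsimp; ring. Qed.

Lemma qD_dpow n x : qD (dpow n.+1 x) = (- 2) *: Um n x.
Proof.
elim: n => [|n IH].
  have -> : dpow 1 x = (fun h => qmul (qone R) h) by apply/funext => h; rewrite /= qmul0l add0r.
  by rewrite qD_id /= qconj1.
have -> : dpow n.+2 x = (fun h => qmul (dpow n.+1 x h) x + qmul (qpow x n.+1) h) by [].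
rewrite qDD qDM IH qD_id qmulZl -scalerDr; congr (_ *: (_ + _)).
elim: n.+1 => [|k IHk]; first by rewrite /= qconj1.
by rewrite qpowSr qconjM IHk.
Qed.

(** In the recursion for [Qm] the factor [conj(x)] contributes [2 (Qm + conj(Qm))] and the new power
    [-2 (m + 2) Um]; by [Qm_conj] they cancel. *)
Lemma qD_dQ m x : qD (dQ m x) = 0.
Proof.
elim: m => [|m IH]; first exact: qD0.
have -> : dQ m.+1 x = (fun h => qmul (dQ m x h) (qconj x) + qmul (Qm m x) (qconj h) + m.+2%:R *: dpow m.+1 x h) by [].
rewrite (qDD (fun h => qmul (dQ m x h) (qconj x) + qmul (Qm m x) (qconj h))) qDD qDM IH qmul0l add0r.
rewrite qD_conj qDZ qD_dpow Qm_conj !scalerA -scalerDl mulrN mulrC subrr scale0r //.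
Qed.

(** The alternating sum of the weights [m - j + 1], that is the ratio of [Qm m x] to [x^m] at
    imaginary [x], where [conj(x) = - x]. *)
Fixpoint sm (m : nat) : R := if m is m'.+1 then (m'.+2)%:R - sm m' else 1.

Lemma sm_bounds m : (m.+1)%:R / 2 <= sm m <= (m.+2)%:R / 2.
Proof.
elim: m => [|m /andP[h1 h2]] /=; first by rewrite mulfV // lexx andbT ler_pdivrMr // mul1r ler1n.
rewrite -[m.+3%:R]natr1; apply/andP; split; move: h1 h2; rewrite -[m.+2%:R]natr1; lra.
Qed.
Lemma sm_gt0 m : 0 < sm m.
Proof. by have /andP[h _] := sm_bounds m; apply: lt_le_trans h; rewrite divr_gt0 // ltr0n. Qed.

Let nrm m : R := 2 / ((m.+1)%:R * (m.+2)%:R).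
Let nrm0 m : nrm m != 0.
Proof. by rewrite mulf_neq0 // invr_neq0 // mulf_neq0 // pnatr_eq0. Qed.
Let TcoE m j : @Tco R m j = nrm m * ((m - j).+1)%:R.
Proof. by rewrite /Tco /nrm mulrAC. Qed.

Lemma Qm_sum m x : Qm m x = \sum_(j < m.+1) ((m - j).+1)%:R *: qmul (qpow x (m - j)) (qpow (qconj x) j).
Proof.
elim: m => [|m IH]; first by rewrite big_ord_recl big_ord0 /= qmul1l scale1r addr0.
rewrite big_ord_recl subn0 qmul1r.
rewrite -[LHS]/(qmul (Qm m x) (qconj x) + m.+2%:R *: qpow x m.+1) addrC; congr (_ + _).
rewrite IH qmul_suml; apply: eq_bigr => j _.
by rewrite /= /bump add1n subSS qmulZl -qmulA -qpowSr.
Qed.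

Lemma sm_sum m : sm m = \sum_(j < m.+1) (-1) ^+ j * ((m - j).+1)%:R.
Proof.
elim: m => [|m IH]; first by rewrite big_ord_recl big_ord0 /= expr0 mul1r addr0.
rewrite big_ord_recl subn0 expr0 mul1r /= IH -sumrN; congr (_ + _).
by apply: eq_bigr => j _; rewrite /= /bump add1n subSS exprS mulN1r mulNr.
Qed.

Lemma PmE m x : Pm m x = (sm m)^-1 *: Qm m x.
Proof.
rewrite /Pm Qm_sum.
have -> : @cco R m = nrm m * sm m.
  by rewrite /cco sm_sum mulr_sumr; apply: eq_bigr => j _; rewrite TcoE mulrCA.
have -> : \sum_(j < m.+1) Tco R m j *: qmul (qpow x (m - j)) (qpow (qconj x) j) =
  nrm m *: \sum_(j < m.+1) ((m - j).+1)%:R *: qmul (qpow x (m - j)) (qpow (qconj x) j).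
  by rewrite scaler_sumr; apply: eq_bigr => j _; rewrite TcoE scalerA.
by rewrite scalerA invfM mulrAC mulVf // mul1r.
Qed.

Lemma Pm_imag m x : qc x 0 = 0 -> Pm m x = qpow x m.
Proof.
move=> x0; have cx : qconj x = - x by apply: quatP; rewrite /qconj !qcsimp ?x0; ring.
rewrite PmE; suff -> : Qm m x = sm m *: qpow x m.
  by rewrite scalerA mulVf ?scale1r // gt_eqF // sm_gt0.
elim: m => [|m IH] /=; first by rewrite scale1r.
rewrite IH cx qmulNr qmulZl -qpowSr scalerBl addrC //.
Qed.

End Polynomials.

(** * Value, derivative and remainder bounds for P_m on balls *)

Section Jets.
Variable R : realType.
Implicit Types (x h k : quat R) (f : quat R -> quat R) (L : quat R -> quat R -> quat R) (rho c : R).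

(* First-order jet bounds for a map homogeneous of degree [m] on the ball of radius [rho]. *)
Record jet rho (m : nat) c f L : Prop := Jet {
  jet_linD : forall x h k, L x (h + k) = L x h + L x k;
  jet_linZ : forall x (t : R) h, L x (t *: h) = t *: L x h;
  jet_val : forall x, qn x <= rho -> qn (f x) <= c * rho ^+ m;
  jet_der : forall x h, qn x <= rho -> qn (L x h) <= c * m%:R * rho ^+ m * (qn h / rho);
  jet_lip : forall x h, qn x <= rho -> qn (x + h) <= rho ->
    qn (f (x + h) - f x) <= c * m%:R * rho ^+ m * (qn h / rho);
  jet_rem : forall x h, qn x <= rho -> qn (x + h) <= rho ->
    qn (f (x + h) - f x - L x h) <= c * m%:R ^+ 2 * rho ^+ m * (qn h / rho) ^+ 2;
  jet_dlip : forall x h k, qn x <= rho -> qn (x + h) <= rho ->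
    qn (L (x + h) k - L x k) <= c * m%:R ^+ 2 * rho ^+ m * (qn h / rho) * (qn k / rho)
}.

Lemma jet_cst rho : jet rho 0 1 (fun=> qone R) (fun _ _ => 0).
Proof.
split=> *; rewrite ?addr0 ?scaler0 ?subrr ?subr0 ?qn1 ?qn0 ?mulr0 ?mul0r ?expr0 ?mulr1 ?expr0n //= ?mulr0 ?mul0r //.
Qed.

(** [l] stands for the identity or [qconj], the factors that build the powers and [Qm]. Both are
    linear isometries, so only the degree grows while [c] is kept. *)
Lemma jet_mul rho m c f L (l : quat R -> quat R) : 0 < rho -> 0 <= c ->
  (forall h k, l (h + k) = l h + l k) -> (forall (t : R) h, l (t *: h) = t *: l h) ->
  (forall h, qn (l h) = qn h) -> jet rho m c f L ->
  jet rho m.+1 c (fun x => qmul (f x) (l x)) (fun x h => qmul (L x h) (l x) + qmul (f x) (l h)).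
Proof.
move=> r0 c0 lD lZ ln [LD LZ V D Li Re Dl].
pose C := c * rho ^+ m.
have q0 h : 0 <= qn h / rho by rewrite divr_ge0 ?qn_ge0 // ltW.
have C0 : 0 <= C by rewrite mulr_ge0 // exprn_ge0 // ltW.
have m1 : (m.+1)%:R = m%:R + 1 :> R by rewrite natr1.
split.
- by move=> x h k; rewrite LD lD qmulDl qmulDr addrACA.
- by move=> x t h; rewrite LZ lZ qmulZl qmulZr scalerDr.
- by move=> x hx; rewrite qnM ln exprSr mulrA ler_pM ?qn_ge0 // V.
- move=> x h hx; rewrite (le_trans (qnD _ _)) // !qnM !ln.
  apply: (@le_trans _ _ (c * m%:R * rho ^+ m * (qn h / rho) * rho + c * rho ^+ m * qn h)).
    by rewrite lerD // ler_pM ?qn_ge0 // ?D ?V.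
  by rewrite m1 [rho ^+ m.+1]exprSr le_eqVlt; apply/orP; left; apply/eqP; field; rewrite gt_eqF.
- move=> x h hx hxh.
  have -> : qmul (f (x + h)) (l (x + h)) - qmul (f x) (l x) = qmul (f (x + h) - f x) (l (x + h)) + qmul (f x) (l h).
    by rewrite lD qmulBl !qmulDr; apply/rowP => j; rewrite !mxE; ring.
  rewrite (le_trans (qnD _ _)) // !qnM !ln.
  apply: (@le_trans _ _ (c * m%:R * rho ^+ m * (qn h / rho) * rho + c * rho ^+ m * qn h)).
    by rewrite lerD // ler_pM ?qn_ge0 // ?Li ?V.
  by rewrite m1 [rho ^+ m.+1]exprSr le_eqVlt; apply/orP; left; apply/eqP; field; rewrite gt_eqF.
- move=> x h hx hxh.
  have -> : qmul (f (x + h)) (l (x + h)) - qmul (f x) (l x) - (qmul (L x h) (l x) + qmul (f x) (l h)) =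
    qmul (f (x + h) - f x - L x h) (l x) + qmul (f (x + h) - f x) (l h).
    by rewrite lD !qmulBl !qmulDr; apply/rowP => j; rewrite !mxE; ring.
  rewrite (le_trans (qnD _ _)) // !qnM !ln.
  apply: (@le_trans _ _ (c * m%:R ^+ 2 * rho ^+ m * (qn h / rho) ^+ 2 * rho + c * m%:R * rho ^+ m * (qn h / rho) * qn h)).
    by rewrite lerD // ler_pM ?qn_ge0 // ?Re ?Li.
  rewrite -subr_ge0 m1 [rho ^+ m.+1]exprSr.
  rewrite [X in 0 <= X](_ : _ = C * (m%:R + 1) * (qn h / rho) ^+ 2 * rho); last by rewrite /C; field; rewrite gt_eqF.
  by rewrite mulr_ge0 ?(ltW r0) // mulr_ge0 ?sqr_ge0 // mulr_ge0 // addr_ge0.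
- move=> x h k hx hxh.
  have -> : qmul (L (x + h) k) (l (x + h)) + qmul (f (x + h)) (l k) - (qmul (L x k) (l x) + qmul (f x) (l k)) =
    qmul (L (x + h) k - L x k) (l (x + h)) + qmul (L x k) (l h) + qmul (f (x + h) - f x) (l k).
    by rewrite lD !qmulBl !qmulDr; apply/rowP => j; rewrite !mxE; ring.
  rewrite (le_trans (qnD _ _)) // (le_trans (lerD (qnD _ _) (lexx _))) // !qnM !ln.
  apply: (@le_trans _ _ (c * m%:R ^+ 2 * rho ^+ m * (qn h / rho) * (qn k / rho) * rho +
     c * m%:R * rho ^+ m * (qn k / rho) * qn h + c * m%:R * rho ^+ m * (qn h / rho) * qn k)).
    by rewrite !lerD // ler_pM ?qn_ge0 // ?Dl ?D ?Li.
  rewrite -subr_ge0 m1 [rho ^+ m.+1]exprSr.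
  rewrite [X in 0 <= X](_ : _ = C * (qn h / rho) * (qn k / rho) * rho); last by rewrite /C; field; rewrite gt_eqF.
  by rewrite mulr_ge0 ?(ltW r0) // mulr_ge0 // mulr_ge0.
Qed.

Lemma jetD rho m c c' f f' L L' : jet rho m c f L -> jet rho m c' f' L' ->
  jet rho m (c + c') (fun x => f x + f' x) (fun x h => L x h + L' x h).
Proof.
move=> [LD LZ V D Li Re Dl] [LD' LZ' V' D' Li' Re' Dl']; split.
- by move=> x h k; rewrite LD LD' addrACA.
- by move=> x t h; rewrite LZ LZ' scalerDr.
- by move=> x hx; rewrite (le_trans (qnD _ _)) // !mulrDl lerD // ?V ?V'.
- by move=> x h hx; rewrite (le_trans (qnD _ _)) // !mulrDl lerD // ?D ?D'.
- by move=> x h hx hxh; rewrite opprD addrACA (le_trans (qnD _ _)) // !mulrDl lerD // ?Li ?Li'.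
- move=> x h hx hxh; rewrite [X in qn X](_ : _ = (f (x + h) - f x - L x h) + (f' (x + h) - f' x - L' x h)).
    by rewrite (le_trans (qnD _ _)) // !mulrDl lerD // ?Re ?Re'.
  by apply/rowP => j; rewrite !mxE; ring.
- by move=> x h k hx hxh; rewrite opprD addrACA (le_trans (qnD _ _)) // !mulrDl lerD // ?Dl ?Dl'.
Qed.

Lemma jetZ rho m c f L (t : R) : 0 <= t -> jet rho m c f L ->
  jet rho m (t * c) (fun x => t *: f x) (fun x h => t *: L x h).
Proof.
move=> t0 [LD LZ V D Li Re Dl]; split.
- by move=> x h k; rewrite LD scalerDr.
- by move=> x u h; rewrite LZ !scalerA mulrC.
- by move=> x hx; rewrite qnZ ger0_norm // -!mulrA ler_wpM2l // V.
- by move=> x h hx; rewrite qnZ ger0_norm // -!mulrA ler_wpM2l // !mulrA -!mulrA mulrA (le_trans (D _ _ hx)) // !mulrA.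
- by move=> x h hx hxh; rewrite -scalerBr qnZ ger0_norm // -!mulrA ler_wpM2l // (le_trans (Li _ _ hx hxh)) // !mulrA.
- by move=> x h hx hxh; rewrite -!scalerBr qnZ ger0_norm // -!mulrA ler_wpM2l // (le_trans (Re _ _ hx hxh)) // !mulrA.
- by move=> x h k hx hxh; rewrite -!scalerBr qnZ ger0_norm // -!mulrA ler_wpM2l // (le_trans (Dl _ _ _ hx hxh)) // !mulrA.
Qed.

Lemma jet_le rho m c c' f L : 0 < rho -> c <= c' -> jet rho m c f L -> jet rho m c' f L.
Proof.
move=> r0 cc [LD LZ V D Li Re Dl].
have q0 h : 0 <= qn h / rho by rewrite divr_ge0 ?qn_ge0 // ltW.
have e0 : 0 <= rho ^+ m by rewrite exprn_ge0 // ltW.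
split=> //.
- by move=> x hx; rewrite (le_trans (V _ hx)) // ler_wpM2r.
- by move=> x h hx; rewrite (le_trans (D _ _ hx)) // !ler_wpM2r.
- by move=> x h hx hxh; rewrite (le_trans (Li _ _ hx hxh)) // !ler_wpM2r.
- by move=> x h hx hxh; rewrite (le_trans (Re _ _ hx hxh)) // !ler_wpM2r ?sqr_ge0.
- by move=> x h k hx hxh; rewrite (le_trans (Dl _ _ _ hx hxh)) // !ler_wpM2r ?sqr_ge0.
Qed.

Lemma jet_pow rho n : 0 < rho -> jet rho n 1 (fun x => qpow x n) (dpow n).
Proof.
move=> r0; elim: n => [|n IH]; first exact: jet_cst.
have := @jet_mul rho n 1 _ _ id r0 ler01 (fun _ _ => erefl) (fun _ _ => erefl) (fun _ => erefl) IH.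
have -> : (fun x => qmul (qpow x n) (id x)) = (fun x => qpow x n.+1).
  by apply/funext => x; rewrite qpowSr.
by [].
Qed.

Lemma jet_Qm rho m : 0 < rho -> jet rho m ((m.+1)%:R * (m.+2)%:R / 2) (Qm m) (dQ m).
Proof.
move=> r0; elim: m => [|m IH].
  by rewrite mul1r mulfV //; apply: jet_cst.
have c0 : 0 <= (m.+1)%:R * (m.+2)%:R / 2 :> R by rewrite !mulr_ge0.
have := jetD (@jet_mul rho m _ _ _ (@qconj R) r0 c0 (@qconjD R) (@qconjZ R) (@qn_conj R) IH)
  (jetZ (ler0n R m.+2) (jet_pow m.+1 r0)).
rewrite (_ : _ + _ * 1 = m.+2%:R * m.+3%:R / 2) //.
by rewrite -[m.+3%:R]natr1 -[m.+2%:R]natr1; field.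
Qed.

Definition dP m x h := (sm R m)^-1 *: dQ m x h.

(** The weights of [Qm] add up to [(m+1)(m+2)/2]; division by [sm], at least [(m+1)/2], leaves
    [m + 2]. *)
Lemma jet_Pm rho m : 0 < rho -> jet rho m (m.+2)%:R (@Pm R m) (dP m).
Proof.
move=> r0; have s0 := sm_gt0 R m.
have -> : @Pm R m = (fun x => (sm R m)^-1 *: Qm m x) by apply/funext => x; exact: PmE.
have i0 : 0 <= (sm R m)^-1 by rewrite invr_ge0 ltW.
apply: (jet_le r0 _ (jetZ i0 (jet_Qm m r0))).
rewrite mulrC ler_pdivrMr // mulrAC mulrC ler_wpM2l //.
by have /andP[] := sm_bounds R m.
Qed.

End Jets.

(** * Series in the polynomials P_m *)

Section QuatSeries.
Variable R : realType.
Implicit Types (u v : nat -> quat R) (l : quat R) (B : nat -> R).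

Definition qlim u l := forall e : R, 0 < e -> exists N0, forall N, (N0 <= N)%N -> qn (l - u N) <= e.

Lemma qlimP u l : qlim u l <-> u @ \oo --> l.
Proof.
split=> [h|h].
  apply/cvgrPdist_le => e e0; have [N0 H] := h e e0.
  by exists N0 => // N /= hN; rewrite (le_trans (norm_le_qn _)) // H.
move=> e e0; have e2 : 0 < e / 2 by rewrite divr_gt0.
have /cvgrPdist_le /(_ _ e2) [N0 _ H] := h.
exists N0 => N hN; rewrite (le_trans (qn_le_norm _)) // mulrC -ler_pdivlMr //.
exact: (H N hN).
Qed.

Lemma qlim_uniq u l l' : qlim u l -> qlim u l' -> l = l'.
Proof.
move=> h h'; apply/eqP; rewrite -subr_eq0; apply/eqP; apply: qn_eq0; apply/eqP.
rewrite eq_le qn_ge0 andbT; apply/ler_addgt0Pr => e e0; rewrite add0r.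
have e2 : 0 < e / 2 by rewrite divr_gt0.
have [N H] := h _ e2; have [N' H'] := h' _ e2.
rewrite -(subrKA (u (maxn N N'))) (le_trans (qnD _ _)) // [e]splitr lerD ?H ?leq_maxl //.
by rewrite qnBC H' ?leq_maxr.
Qed.

Lemma qlimD u v l l' : qlim u l -> qlim v l' -> qlim (fun N => u N + v N) (l + l').
Proof.
move=> h h' e e0; have e2 : 0 < e / 2 by rewrite divr_gt0.
have [N H] := h _ e2; have [N' H'] := h' _ e2.
exists (maxn N N') => k; rewrite geq_max => /andP[/H k1 /H' k2].
by rewrite opprD addrACA (le_trans (qnD _ _)) // [e]splitr lerD.
Qed.

Lemma qlimMl a u l : qlim u l -> qlim (fun N => qmul a (u N)) (qmul a l).
Proof.
move=> h e e0; have e2 : 0 < e / (1 + qn a) by rewrite divr_gt0 // ltr_pwDl // qn_ge0.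
have [N H] := h _ e2; exists N => k /H hk.
rewrite -qmulBr qnM (le_trans (ler_wpM2l (qn_ge0 _) hk)) //.
by rewrite mulrCA ler_piMr ?(ltW e0) // ler_pdivrMr ?mul1r ?lerDr // ltr_pwDl // qn_ge0.
Qed.
Lemma qlimMr a u l : qlim u l -> qlim (fun N => qmul (u N) a) (qmul l a).
Proof.
move=> h e e0; have e2 : 0 < e / (1 + qn a) by rewrite divr_gt0 // ltr_pwDl // qn_ge0.
have [N H] := h _ e2; exists N => k /H hk.
rewrite -qmulBl qnM mulrC (le_trans (ler_wpM2l (qn_ge0 _) hk)) //.
by rewrite mulrCA ler_piMr ?(ltW e0) // ler_pdivrMr ?mul1r ?lerDr // ltr_pwDl // qn_ge0.
Qed.
Lemma qlimZ (t : R) u l : qlim u l -> qlim (fun N => t *: u N) (t *: l).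
Proof.
have E x : t *: x = qmul (t *: qone R) x by rewrite qmulZl qmul1l.
by move=> h; rewrite E; under eq_fun do rewrite E; apply: qlimMl.
Qed.
Lemma qlim_conj u l : qlim u l -> qlim (fun N => qconj (u N)) (qconj l).
Proof. by move=> h e /h[N H]; exists N => k /H; rewrite -qconjN -qconjD qn_conj. Qed.
Lemma qlim_cst l : qlim (fun=> l) l.
Proof. by move=> e e0; exists 0%N => N _; rewrite subrr qn0 ltW. Qed.
Lemma qlim_eq u v l : (forall N, u N = v N) -> qlim u l -> qlim v l.
Proof. by move=> h; rewrite (_ : u = v) //; apply/funext. Qed.
Lemma qlim_sum (I : finType) (u : I -> nat -> quat R) (l : I -> quat R) :
  (forall i, qlim (u i) (l i)) -> qlim (fun N => \sum_i u i N) (\sum_i l i).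
Proof.
move=> h; elim: (index_enum I) => [|i s IH].
  by rewrite big_nil; apply: qlim_eq (qlim_cst 0) => N; rewrite big_nil.
rewrite big_cons; apply: qlim_eq (qlimD (h i) IH) => N; by rewrite big_cons.
Qed.
Lemma qlim_le u l (M : R) : qlim u l -> (forall N, qn (u N) <= M) -> qn l <= M.
Proof.
move=> h hM; apply/ler_addgt0Pl => e e0; have [N H] := h _ e0.
by rewrite -(subrK (u N) l) (le_trans (qnD _ _)) // lerD // H.
Qed.
Lemma qlim_le_near u l (M : R) N0 : qlim u l -> (forall N, (N0 <= N)%N -> qn (u N) <= M) -> qn l <= M.
Proof.
move=> h hM; apply/ler_addgt0Pl => e e0; have [N H] := h _ e0.
rewrite -(subrK (u (maxn N N0)) l) (le_trans (qnD _ _)) // lerD //; first by rewrite H // leq_maxl.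
by rewrite hM // leq_maxr.
Qed.

Lemma qlim_coord u l : (forall k : 'I_4, (fun N => qc (u N) k) @ \oo --> qc l k) -> qlim u l.
Proof.
move=> h e e0; have e2 : 0 < e / 2 by rewrite divr_gt0.
have H (k : 'I_4) : exists N0, forall N, (N0 <= N)%N -> `|qc l k - qc (u N) k| <= e / 2.
  have /cvgrPdist_le /(_ _ e2) [N0 _ H] := h k.
  by exists N0 => N hN; apply: (H N hN).
have /(_ _)/cid-/all_tag[f hf] := H.
exists (\max_k f k) => N hN; rewrite (le_trans (qn_le_norm _)) // mulrC -ler_pdivlMr //.
apply: normq_le; first exact: ltW.
by move=> k; rewrite qcB hf // (leq_trans _ hN) // leq_bigmax.
Qed.

Lemma coord_qlim u l : qlim u l -> forall k : 'I_4, (fun N => qc (u N) k) @ \oo --> qc l k.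
Proof.
move=> h k; apply/cvgrPdist_le => e e0; have [N0 H] := h e e0.
by exists N0 => // N /= hN; rewrite -qcB (le_trans (qc_le_qn _ _)) // H.
Qed.

Definition qpart u N := \sum_(m < N) u m.
(** Total by means of [limn]; it is the sum of the series once [qsum_lim] provides convergence. *)
Definition qsum u : quat R := \row_(k < 4) limn (series (fun m => qc (u m) k)).

Section Dominated.
Variables (B : nat -> R) (S : R).
Hypothesis B0 : forall m, 0 <= B m.
Hypothesis BS : forall N, \sum_(m < N) B m <= S.

Lemma qsum_lim u (C : R) : 0 <= C -> (forall m, qn (u m) <= C * B m) -> qlim (qpart u) (qsum u).
Proof.
move=> C0 hu.
have hs : cvgn (series (fun m => C * B m)).
  apply: nondecreasing_is_cvgn.
    by apply/nondecreasing_seqP => n; rewrite /series /= big_nat_recr //= lerDl mulr_ge0.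
  exists (C * S) => _ [N _ <-]; rewrite /series /= -mulr_sumr ler_wpM2l // big_mkord; exact: BS.
apply: qlim_coord => k; rewrite [qc (qsum u) k]mxE inord_val.
have hn : cvgn [normed series (fun m => qc (u m) k)].
  apply: (series_le_cvg _ _ _ hs) => n; first exact: normr_ge0.
    by rewrite mulr_ge0.
  by rewrite (le_trans (qc_le_qn _ _)).
have E : (fun N => qc (qpart u N) k) = series (fun m => qc (u m) k).
  by apply/funext => N; rewrite /qpart /series /= big_mkord qc_sum.
by rewrite E; exact: (normed_cvg hn).
Qed.

Lemma qpart_le u (C : R) N : 0 <= C -> (forall m, qn (u m) <= C * B m) -> qn (qpart u N) <= C * S.
Proof.
move=> C0 hu; rewrite (le_trans (qn_sum _ _ _)) //.
apply: (@le_trans _ _ (\sum_(m < N) C * B m)); first by apply: ler_sum => i _.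
by rewrite -mulr_sumr ler_wpM2l.
Qed.

Lemma qsum_le u (C : R) : 0 <= C -> (forall m, qn (u m) <= C * B m) -> qn (qsum u) <= C * S.
Proof.
by move=> C0 hu; apply: (qlim_le (qsum_lim C0 hu)) => N; apply: qpart_le.
Qed.
End Dominated.

Lemma qpartD u v N : qpart (fun m => u m + v m) N = qpart u N + qpart v N.
Proof. by rewrite /qpart big_split. Qed.

Lemma geometric_le (th : R) N : 0 <= th < 1 -> \sum_(m < N) th ^+ m <= (1 - th)^-1.
Proof.
move=> /andP[t0 t1]; rewrite -div1r ler_pdivlMr ?subr_gt0 //.
suff -> : (\sum_(m < N) th ^+ m) * (1 - th) = 1 - th ^+ N by rewrite gerBl exprn_ge0.
elim: N => [|N IH]; first by rewrite big_ord0 mul0r expr0 subrr.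
by rewrite big_ord_recr /= mulrDl IH exprSr; ring.
Qed.

(** The cube covers the largest constant in the jets of [P_m], namely [(m + 2) m^2], so one series
    dominates values, differentials and remainders. *)
Lemma majorant (r : R) : 0 <= r < 1 -> exists rho S : R, [/\ 0 < rho, r < rho, rho < 1 &
  forall N, \sum_(m < N) (m.+2)%:R ^+ 3 * rho ^+ m <= S].
Proof.
move=> /andP[r0 r1]; pose rho := (1 + r) / 2.
have rh0 : 0 < rho by rewrite /rho; lra.
have rh1 : rho < 1 by rewrite /rho; lra.
(* As [th ^+ 4 = rho], three factors [th ^+ m] absorb the factors [m + 2] by Bernoulli's inequality,
   and the fourth leaves a geometric series. *)
pose th := Num.sqrt (Num.sqrt rho).
have th0 : 0 < th by rewrite !sqrtr_gt0.
have th4 : th ^+ 4 = rho by rewrite (exprM th 2 2) !sqr_sqrtr ?sqrtr_ge0 // ltW.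
have th1 : th < 1.
  by rewrite -(@ltr_pXn2r _ 4) ?nnegrE ?ler01 ?(ltW th0) // th4 expr1n.
pose d := th^-1 - 1.
have d0 : 0 < d by rewrite subr_gt0 invf_gt1.
have bern m : 1 + m%:R * d <= (th^-1) ^+ m.
  elim: m => [|m IH]; first by rewrite mul0r addr0 expr0.
  rewrite exprS (_ : th^-1 = 1 + d); last by rewrite /d addrC subrK.
  rewrite (_ : th^-1 = 1 + d) in IH; last by rewrite /d addrC subrK.
  apply: le_trans (ler_wpM2l _ IH); last by rewrite addr_ge0 // ltW.
  rewrite -natr1; have : 0 <= m%:R * d * d by rewrite !mulr_ge0 // ltW.
  lra.
pose C := 2 + d^-1.
have hC m : (m.+2)%:R * th ^+ m <= C.
  have t0 : 0 < th ^+ m by rewrite exprn_gt0.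
  rewrite -ler_pdivlMr // -exprVn -[m.+2%:R]natr1 -[m.+1%:R]natr1.
  have := bern m; set z := (_ ^+ m) => hz.
  have z1 : 1 <= z by apply: le_trans hz; rewrite lerDl mulr_ge0 // ltW.
  have : m%:R <= d^-1 * z by rewrite mulrC ler_pdivlMr //; lra.
  rewrite /C; lra.
have C0 : 0 <= C by rewrite addr_ge0 // invr_ge0 ltW.
exists rho, (C ^+ 3 * (1 - th)^-1); split => //; first by rewrite /rho; lra.
move=> N; apply: (@le_trans _ _ (\sum_(m < N) C ^+ 3 * th ^+ m)); last first.
  by rewrite -mulr_sumr ler_wpM2l ?exprn_ge0 // geometric_le // (ltW th0).
apply: ler_sum => m _; rewrite -th4 -exprM mulnC exprM.
have -> : (th ^+ m) ^+ 4 = (th ^+ m) ^+ 3 * th ^+ m by rewrite -exprSr.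
rewrite mulrA -exprMn ler_wpM2r ?exprn_ge0 ?(ltW th0) // lerXn2r ?nnegrE //.
by rewrite mulr_ge0 // exprn_ge0 // ltW.
Qed.

End QuatSeries.

(** * Termwise differentiation of series with coefficients of norm at most 1 *)

Section PSeries.
Variable R : realType.
Implicit Types (x y h k : quat R).
Variable a : nat -> quat R.
Hypothesis a1 : forall m, qn (a m) <= 1.

Let u x m := qmul (Pm m x) (a m).
Let v x h m := qmul (dP m x h) (a m).
Definition Psum x := qsum (u x).
Definition dPsum x h := qsum (v x h).

Section Ball.
Variables (rho S : R).
Hypothesis r0 : 0 < rho.
Hypothesis hS : forall N, \sum_(m < N) (m.+2)%:R ^+ 3 * rho ^+ m <= S.
Let B (m : nat) : R := (m.+2)%:R ^+ 3 * rho ^+ m.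
Let B0 m : 0 <= B m. Proof. by rewrite mulr_ge0 // exprn_ge0 // ltW. Qed.
Let rm m : 0 <= rho ^+ m. Proof. by rewrite exprn_ge0 // ltW. Qed.
Let Bv m : (m.+2)%:R * rho ^+ m <= B m.
Proof. by rewrite /B ler_wpM2r // -[X in X <= _]expr1 ler_eXn2l // ltr1n. Qed.
Let Bd m : (m.+2)%:R * m%:R * rho ^+ m <= B m.
Proof.
rewrite /B ler_wpM2r // exprS ler_wpM2l // (le_trans _ (_ : m.+2%:R <= _)) ?ler_nat //; last by rewrite -[X in X <= _]expr1 ler_eXn2l // ltr1n.
by rewrite leqW.
Qed.
Let Br m : (m.+2)%:R * m%:R ^+ 2 * rho ^+ m <= B m.
Proof. by rewrite /B ler_wpM2r // [m.+2%:R ^+ 3]exprS ler_wpM2l // lerXn2r ?nnegrE // ler_nat !leqW. Qed.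
Let q0 h : 0 <= qn h / rho. Proof. by rewrite divr_ge0 ?qn_ge0 // ltW. Qed.
Let ua (q : quat R) m (t : R) : qn q <= t -> qn (qmul q (a m)) <= t.
Proof. by move=> h; rewrite qnM (le_trans _ h) // ler_piMr ?qn_ge0. Qed.

Lemma Psum_bound x m : qn x <= rho -> qn (u x m) <= 1 * B m.
Proof.
by move=> hx; rewrite mul1r; apply: ua; rewrite (le_trans (jet_val (jet_Pm m r0) hx)) // Bv.
Qed.
Lemma dPsum_bound x h m : qn x <= rho -> qn (v x h m) <= qn h / rho * B m.
Proof.
move=> hx; apply: ua; rewrite (le_trans (jet_der (jet_Pm m r0) h hx)) // mulrC ler_wpM2l // Bd.
Qed.
Lemma Psum_lim x : qn x <= rho -> qlim (qpart (u x)) (Psum x).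
Proof. by move=> hx; apply: (qsum_lim B0 hS ler01) => m; apply: Psum_bound. Qed.
Lemma dPsum_lim x h : qn x <= rho -> qlim (qpart (v x h)) (dPsum x h).
Proof. by move=> hx; apply: (qsum_lim B0 hS (q0 h)) => m; apply: dPsum_bound. Qed.

Lemma Psum_rem x h : qn x <= rho -> qn (x + h) <= rho ->
  qn (Psum (x + h) - Psum x - dPsum x h) <= (qn h / rho) ^+ 2 * S.
Proof.
move=> hx hxh.
have L := qlimD (qlimD (Psum_lim hxh) (qlimZ (-1) (Psum_lim hx))) (qlimZ (-1) (dPsum_lim h hx)).
rewrite !scaleN1r in L; apply: (qlim_le L) => N; rewrite !scaleN1r.
rewrite [X in qn X](_ : _ = qpart (fun m => qmul (Pm m (x + h) - Pm m x - dP m x h) (a m)) N); last first.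
  by rewrite /qpart -!sumrB; apply: eq_bigr => m _; rewrite /u /v !qmulBl.
apply: (@qpart_le _ B S hS); first by rewrite sqr_ge0.
move=> m; apply: ua; rewrite (le_trans (jet_rem (jet_Pm m r0) hx hxh)) // mulrC ler_wpM2l ?sqr_ge0 // Br.
Qed.

Lemma dPsum_lip x h k : qn x <= rho -> qn (x + h) <= rho ->
  qn (dPsum (x + h) k - dPsum x k) <= (qn h / rho) * (qn k / rho) * S.
Proof.
move=> hx hxh.
have L := qlimD (dPsum_lim k hxh) (qlimZ (-1) (dPsum_lim k hx)).
rewrite !scaleN1r in L; apply: (qlim_le L) => N; rewrite !scaleN1r.
rewrite [X in qn X](_ : _ = qpart (fun m => qmul (dP m (x + h) k - dP m x k) (a m)) N); last first.
  by rewrite /qpart -!sumrB; apply: eq_bigr => m _; rewrite /v !qmulBl.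
apply: (@qpart_le _ B S hS); first by rewrite mulr_ge0.
move=> m; apply: ua; rewrite (le_trans (jet_dlip (jet_Pm m r0) k hx hxh)) //.
have Q : 0 <= qn h / rho * (qn k / rho) by rewrite mulr_ge0.
rewrite [X in X <= _](_ : _ = qn h / rho * (qn k / rho) * (m.+2%:R * m%:R ^+ 2 * rho ^+ m)); last by ring.
exact: (ler_wpM2l Q (Br m)).
Qed.

Lemma dPsumD x h k : qn x <= rho -> dPsum x (h + k) = dPsum x h + dPsum x k.
Proof.
move=> hx; apply: qlim_uniq (dPsum_lim (h + k) hx) _.
apply: qlim_eq (qlimD (dPsum_lim h hx) (dPsum_lim k hx)) => N.
rewrite -qpartD /qpart; apply: eq_bigr => m _.
by rewrite /v (jet_linD (jet_Pm m r0)) qmulDl.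
Qed.
Lemma dPsumZ x (t : R) h : qn x <= rho -> dPsum x (t *: h) = t *: dPsum x h.
Proof.
move=> hx; apply: qlim_uniq (dPsum_lim (t *: h) hx) _.
apply: qlim_eq (qlimZ t (dPsum_lim h hx)) => N.
rewrite /qpart scaler_sumr; apply: eq_bigr => m _.
by rewrite /v (jet_linZ (jet_Pm m r0)) qmulZl.
Qed.
Lemma dPsum_le x h : qn x <= rho -> qn (dPsum x h) <= qn h / rho * S.
Proof. by move=> hx; apply: (qsum_le B0 hS (q0 h)) => m; apply: dPsum_bound. Qed.

Lemma dPsum_D x : qn x <= rho -> qD (dPsum x) = 0.
Proof.
move=> hx; pose L i := dPsum_lim (qe R i) hx.
have M := qlimD (L 0%N) (qlimD (qlimD (qlimMl (qe R 1) (L 1%N)) (qlimMl (qe R 2) (L 2%N))) (qlimMl (qe R 3) (L 3%N))).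
apply: qlim_uniq M _; apply: qlim_eq (qlim_cst 0) => N.
rewrite /qpart !qmul_sumr -!big_split /= big1 // => m _.
rewrite -[LHS]/(qD (fun h => qmul (dP m x h) (a m))) qDM.
by rewrite [qD _](_ : _ = qD (fun h => (sm R m)^-1 *: dQ m x h)) // qDZ qD_dQ scaler0 qmul0l.
Qed.

End Ball.

Let ball_ex x : qn x < 1 -> exists rho S : R, [/\ 0 < rho, qn x < rho, rho < 1 &
  forall N, \sum_(m < N) (m.+2)%:R ^+ 3 * rho ^+ m <= S].
Proof. by move=> hx; apply: majorant; rewrite qn_ge0. Qed.

Let hnear x rho : qn x < rho -> exists2 d : R, 0 < d & forall h, `|h| <= d -> qn (x + h) <= rho.
Proof.
move=> hx; exists ((rho - qn x) / 2); first by rewrite divr_gt0 // subr_gt0.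
move=> h hh; rewrite (le_trans (qnD _ _)) // -lerBrDl (le_trans (qn_le_norm _)) //.
by rewrite mulrC -ler_pdivlMr.
Qed.

Lemma Psum_cvg x : qn x < 1 -> qlim (qpart (u x)) (Psum x).
Proof. by move=> /ball_ex[rho [S [r0 /ltW hx _ hS]]]; apply: (Psum_lim r0 hS). Qed.

Lemma Psum_derive x w : qn x < 1 -> 'D_w Psum x = dPsum x w.
Proof.
move=> /ball_ex[rho [S [r0 hx _ hS]]]; have [d d0 hd] := hnear hx.
have S0 : 0 <= S by have := hS 0%N; rewrite big_ord0.
apply: cvg_lim => //; apply/cvgrPdist_le => e e0.
pose C := (qn w / rho) ^+ 2 * S.
have C0 : 0 <= C by rewrite mulr_ge0 // sqr_ge0.
pose del := Num.min (d / (1 + `|w|)) (e / (1 + C)).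
have del0 : 0 < del by rewrite lt_min !divr_gt0 // ltr_pwDl.
near=> t.
have t0 : t != 0 by near: t; exact: nbhs_dnbhs_neq.
have td : `|t| <= del by near: t; apply: dnbhs0_le.
move: td; rewrite le_min => /andP[t1 t2].
have hxt : qn (x + t *: w) <= rho.
  apply: hd; rewrite normrZ; move: t1; rewrite ler_pdivlMr ?ltr_pwDl // => t1.
  by apply: le_trans t1; rewrite ler_wpM2l // lerDr.
have := Psum_rem r0 hS (ltW hx) hxt.
rewrite (dPsumZ r0 hS t w (ltW hx)) qnZ => H.
rewrite -[X in X <= _](mulKf (x := `|t|)) ?normr_eq0 // -normrZ.
rewrite -[(Psum \o shift x) (t *: w)]/(Psum (t *: w + x)).
rewrite mulrC ler_pdivrMr ?normr_gt0 // scalerBr scalerA mulfV // scale1r [t *: w + x]addrC distrC.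
rewrite (le_trans (norm_le_qn _)) // (le_trans H) //.
rewrite (_ : _ * S = `|t| * (`|t| * C)); last by rewrite /C; field; rewrite gt_eqF.
rewrite mulrC ler_wpM2r //.
move: t2; rewrite ler_pdivlMr ?ltr_pwDl // => t2; apply: le_trans t2; rewrite ler_wpM2l // lerDr //.
Unshelve. all: by end_near. Qed.

Lemma Psum_differentiable x : qn x < 1 -> differentiable Psum x.
Proof.
move=> /ball_ex[rho [S [r0 hx _ hS]]]; have [d d0 hd] := hnear hx.
have S0 : 0 <= S by have := hS 0%N; rewrite big_ord0.
have lin : linear (dPsum x).
  by move=> t h k; rewrite (dPsumD r0 hS _ _ (ltW hx)) (dPsumZ r0 hS _ _ (ltW hx)).
pose La := GRing.isLinear.Build R 'rV[R]_4 'rV[R]_4 *:%R (dPsum x) lin.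
pose L : {linear 'rV[R]_4 -> 'rV[R]_4} := HB.pack (dPsum x) La.
have cL : continuous L.
  move=> y; apply/(quat_ctsP L y) => e e0.
  exists (e / (1 + 2 / rho * S)); first by rewrite divr_gt0 // ltr_pwDl // mulr_ge0 // divr_ge0 // ltW.
  move=> z yz; rewrite -linearB (le_trans (norm_le_qn _)) // (le_trans (dPsum_le r0 hS _ (ltW hx))) //.
  move: yz; rewrite ler_pdivlMr; last by rewrite ltr_pwDl // mulr_ge0 // divr_ge0 // ltW.
  apply: le_trans; rewrite mulrDr mulr1 ler_wpDl //.
  rewrite (_ : `|y - z| * _ = (2 * `|y - z|) / rho * S); last by ring.
  by rewrite !ler_wpM2r ?invr_ge0 ?(ltW r0) // qn_le_norm.
pose V : normedModType R := 'rV[R]_4.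
pose f : V -> V := fun h => Psum (h + x).
pose g : V -> V := fun h => Psum x + dPsum x h.
have E : f = g +o_ (0 : V) (id : V -> V).
  apply/(@eqaddoP R V V V (nbhs (0 : V)) f g id) => e e0.
  pose C := 4 / rho ^+ 2 * S.
  have C0 : 0 <= C by rewrite mulr_ge0 // divr_ge0 // sqr_ge0.
  have m0 : 0 < Num.min d (e / (1 + C)) by rewrite lt_min d0 divr_gt0 // ltr_pwDl.
  apply/(@nbhs_ballP R V 0); exists (Num.min d (e / (1 + C))) => //= h.
  rewrite -ball_normE /= sub0r normrN => /ltW hdel.
  move: hdel; rewrite le_min => /andP[h1 h2].
  have := Psum_rem r0 hS (ltW hx) (hd _ h1).
  rewrite -[(f - g) h]/(Psum (h + x) - (Psum x + dPsum x h)) opprD addrA [h + x]addrC.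
  move=> /(le_trans (norm_le_qn _)) /le_trans; apply.
  have hh : qn h ^+ 2 <= (2 * `|h|) ^+ 2.
    by rewrite lerXn2r ?nnegrE ?qn_ge0 ?mulr_ge0 // qn_le_norm.
  rewrite expr_div_n (le_trans (ler_wpM2r _ (ler_wpM2r _ hh))) ?invr_ge0 ?sqr_ge0 //.
  rewrite (_ : _ * S = (C * `|h|) * `|h|); last by rewrite /C; field; rewrite gt_eqF.
  rewrite ler_wpM2r // mulrC.
  by move: h2; rewrite ler_pdivlMr ?ltr_pwDl //; apply: le_trans; rewrite ler_wpM2l // lerDr.
have dE := diff_unique cL E.
by apply/diff_locallyP; rewrite dE.
Qed.

Lemma Psum_hyperholo : hyperholo (fun x => qn x < 1) Psum.
Proof.
split; [|split].
- exact: Psum_differentiable.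
- move=> i x hx1; have [rho [S [r0 hx rl hS]]] := ball_ex hx1; have [d d0 hd] := hnear hx.
  have S0 : 0 <= S by have := hS 0%N; rewrite big_ord0.
  apply/(quat_ctsP _ x) => e e0.
  pose C := 2 / rho * (qn (qe R i) / rho) * S.
  have C0 : 0 <= C by rewrite !mulr_ge0 ?invr_ge0 ?qn_ge0 // ltW.
  exists (Num.min d (e / (1 + C))); first by rewrite lt_min d0 divr_gt0 // ltr_pwDl.
  move=> y; rewrite le_min => /andP[h1 h2].
  have hy : qn (x + (y - x)) <= rho by apply: hd; rewrite distrC.
  have hy1 : qn y < 1 by apply: le_lt_trans rl; move: hy; rewrite addrC subrK.
  rewrite !Psum_derive // distrC.
  have := dPsum_lip r0 hS (qe R i) (ltW hx) hy; rewrite [x + _]addrC subrK.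
  move=> /(le_trans (norm_le_qn _)) /le_trans; apply.
  have hh : qn (y - x) <= 2 * `|x - y| by rewrite distrC qn_le_norm.
  apply: (@le_trans _ _ (2 * `|x - y| / rho * (qn (qe R i) / rho) * S)).
    by rewrite !ler_wpM2r ?invr_ge0 ?(ltW r0) ?divr_ge0 ?qn_ge0 ?(ltW r0).
  rewrite (_ : _ * S = `|x - y| * C); last by rewrite /C; ring.
  by move: h2; rewrite ler_pdivlMr ?ltr_pwDl //; apply: le_trans; rewrite ler_wpM2l // lerDr.
- move=> x hx1; have [rho [S [r0 hx rl hS]]] := ball_ex hx1.
  have D := dPsum_D r0 hS (ltW hx).
  rewrite /Dop (Psum_derive (qe R 0) hx1) -[RHS]D /qD; congr (_ + _).
  rewrite -(sum_ord3 (fun k : nat => qmul (qe R k) (dPsum x (qe R k)))).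
  by apply: eq_bigr => i _; rewrite Psum_derive.
Qed.

Lemma Psum_imag x : qn x < 1 -> qc x 0 = 0 -> qlim (qpart (fun m => qmul (qpow x m) (a m))) (Psum x).
Proof.
move=> hx x0; apply: qlim_eq (Psum_cvg hx) => N.
by apply: eq_bigr => m _; rewrite /u Pm_imag.
Qed.

End PSeries.

(** * Finite sections of Toeplitz operators *)

Section FiniteL2.
Variable R : realType.

Section Seqs.
Variable n : nat.
Implicit Types (h g : nat -> 'I_n -> quat R) (t : R) (M : nat).

(** Norms are taken over entries [j < M] and bounded uniformly in [M], which keeps them real;
    [finite_contractionP] makes the link with [l2norm2]. *)
Definition nrm2 M h : R := \sum_(j < M) vnorm2 (h j).
Definition dotp M h g : R := \sum_(j < M) \sum_k qdot (h j k) (g j k).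
Definition nN M h : R := Num.sqrt (nrm2 M h).

Lemma vnorm2_ge0 (v : 'I_n -> quat R) : 0 <= vnorm2 v.
Proof. by apply: sumr_ge0 => k _; exact: qnorm2_ge0. Qed.
Lemma nrm2_ge0 M h : 0 <= nrm2 M h.
Proof. by apply: sumr_ge0 => k _; exact: vnorm2_ge0. Qed.
Lemma nrm2_le M M' h : (M <= M')%N -> nrm2 M h <= nrm2 M' h.
Proof.
move=> /subnKC <-; rewrite /nrm2 big_split_ord /= lerDl.
by apply: sumr_ge0 => k _; exact: vnorm2_ge0.
Qed.
Lemma nN_ge0 M h : 0 <= nN M h. Proof. exact: sqrtr_ge0. Qed.
Lemma nN_sqr M h : nN M h ^+ 2 = nrm2 M h. Proof. by rewrite sqr_sqrtr // nrm2_ge0. Qed.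

Lemma dotpp M h : dotp M h h = nrm2 M h.
Proof. by apply: eq_bigr => j _; apply: eq_bigr => k _; rewrite qdotxx. Qed.

Lemma nrm2_expand M h g t :
  nrm2 M (fun j k => h j k + t *: g j k) = nrm2 M h + 2 * t * dotp M h g + t ^+ 2 * nrm2 M g.
Proof.
rewrite /nrm2 /dotp !mulr_sumr -!big_split /=; apply: eq_bigr => j _.
rewrite /vnorm2 !mulr_sumr -!big_split /=; apply: eq_bigr => k _.
by rewrite -!qdotxx !(qdotDl, qdotDr, qdotZl, qdotZr) (qdotC (g j k) (h j k)); ring.
Qed.

Lemma dotp_CS M h g : dotp M h g ^+ 2 <= nrm2 M h * nrm2 M g.
Proof.
have P t : 0 <= nrm2 M h + 2 * t * dotp M h g + t ^+ 2 * nrm2 M g.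
  by rewrite -nrm2_expand nrm2_ge0.
move: P (nrm2_ge0 M h) (nrm2_ge0 M g); move: (nrm2 M h) (nrm2 M g) (dotp M h g) => A C B P A0.
rewrite le_eqVlt => /orP[/eqP C0|C0].
  (* With [C = 0] and [B != 0] this [t] turns the nonnegative expression into [-1]. *)
  rewrite -C0 mulr0 in P *; have := P (- (A + 1) / (2 * B)).
  have [->|B0] := eqVneq B 0; first by rewrite expr0n.
  rewrite mulr0 addr0 (_ : 2 * (- (A + 1) / (2 * B)) * B = - (A + 1)); first by lra.
  by field.
have := P (- (B / C)).
rewrite [X in 0 <= X](_ : _ = A - B ^+ 2 / C); last by field; rewrite gt_eqF.
by rewrite subr_ge0 ler_pdivrMr.
Qed.

Lemma dotp_le M h g : dotp M h g <= nN M h * nN M g.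
Proof.
have [H|/ltW H] := leP (dotp M h g) 0; first by rewrite (le_trans H) // mulr_ge0 ?nN_ge0.
rewrite -(@ler_pXn2r _ 2) ?nnegrE ?mulr_ge0 ?nN_ge0 //.
by rewrite exprMn !nN_sqr dotp_CS.
Qed.

Lemma nND M h g : nN M (fun j k => h j k + g j k) <= nN M h + nN M g.
Proof.
rewrite -(@ler_pXn2r _ 2) ?nnegrE ?addr_ge0 ?nN_ge0 //.
have -> : (fun j k => h j k + g j k) = (fun j k => h j k + 1 *: g j k).
  by apply/funext => j; apply/funext => k; rewrite scale1r.
rewrite nN_sqr nrm2_expand sqrrD !nN_sqr; have := dotp_le M h g; lra.
Qed.

Lemma nN_mulr M h (c : quat R) : nN M (fun j k => qmul (h j k) c) = nN M h * qn c.
Proof.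
rewrite /nN /qn -sqrtrM ?nrm2_ge0 //; congr Num.sqrt.
rewrite /nrm2 mulr_suml; apply: eq_bigr => j _; rewrite /vnorm2 mulr_suml.
by apply: eq_bigr => k _; rewrite qnorm2M.
Qed.

Lemma nN_eq M h g : (forall j k, (j < M)%N -> h j k = g j k) -> nN M h = nN M g.
Proof.
move=> e; congr Num.sqrt; apply: eq_bigr => j _; apply: eq_bigr => k _; by rewrite e.
Qed.

Lemma nN_le M M' h : (M <= M')%N -> nN M h <= nN M' h.
Proof. by move=> /nrm2_le ?; rewrite ler_wsqrtr. Qed.

Lemma qn_le_nN h j k M : (j < M)%N -> qn (h j k) <= nN M h.
Proof.
move=> jM; rewrite ler_wsqrtr // /nrm2 (bigD1 (Ordinal jM)) //= /vnorm2 (bigD1 k) //=.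
rewrite -addrA lerDl addr_ge0 //; first by apply: sumr_ge0 => i _; exact: qnorm2_ge0.
by apply: sumr_ge0 => i _; exact: vnorm2_ge0.
Qed.

Lemma nN_unif M h (e : R) : 0 <= e -> (forall j k, qn (h j k) <= e) -> nN M h <= (M * n)%:R * e.
Proof.
move=> e0 he; rewrite -(@ler_pXn2r _ 2) ?nnegrE ?nN_ge0 ?mulr_ge0 // nN_sqr.
apply: (@le_trans _ _ ((M * n)%:R * e ^+ 2)).
  rewrite natrM -mulrA mulr_natl -[M in _ *+ M]card_ord -sumr_const; apply: ler_sum => j _.
  rewrite mulr_natl -[n in _ *+ n]card_ord -sumr_const; apply: ler_sum => k _.
  by rewrite -qn_sqr lerXn2r ?nnegrE ?qn_ge0.
rewrite exprMn ler_wpM2r ?sqr_ge0 //.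
by rewrite -natrX ler_nat; case: (M * n)%N => // q; rewrite expnS expn1 leq_pmulr.
Qed.

Lemma l2norm2_bound h (B : R) : (forall M, nrm2 M h <= B) -> (l2norm2 h <= B%:E)%E.
Proof.
move=> hB; apply: lime_le.
  by apply: is_cvg_nneseries => i _ _; rewrite lee_fin vnorm2_ge0.
by apply: nearW => M; rewrite sumEFin lee_fin big_mkord; exact: hB.
Qed.

Lemma nrm2_l2norm2 h M : ((nrm2 M h)%:E <= l2norm2 h)%E.
Proof.
have := @nneseries_lim_ge R (fun j => (vnorm2 (h j))%:E) xpredT 0%N M.
rewrite sumEFin big_mkord; apply => i _; by rewrite lee_fin vnorm2_ge0.
Qed.

End Seqs.

Section Toeplitz.
Variables (r s : nat) (Sn : nat -> 'M[quat R]_(r, s)).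
Implicit Types (h : nat -> 'I_s -> quat R) (g : nat -> 'I_r -> quat R).

(** The adjoint of the [M]-th section. The operator is lower triangular, so its entries below [M]
    form that section. *)
Definition adj M g : nat -> 'I_s -> quat R :=
  fun n l => \sum_(j < M | (n <= j)%N) \sum_a qmul (qconj (Sn (j - n)%N a l)) (g j a).

Lemma toeplitz_adj M h g : dotp M (toeplitz_apply Sn h) g = dotp M h (adj M g).
Proof.
rewrite /dotp /toeplitz_apply /adj.
transitivity (\sum_(j < M) \sum_(k < M | (k <= j)%N) \sum_a \sum_l
    qdot (h k l) (qmul (qconj (Sn (j - k)%N a l)) (g j a))).
  apply: eq_bigr => j _; rewrite [RHS]exchange_big /=; apply: eq_bigr => a _.
  rewrite qdot_suml (big_ord_widen_cond M xpredT (fun k => qdot (\sum_l qmul (Sn (j - k)%N a l) (h k l)) (g j a))) //=.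
  apply: eq_big => [k|k _]; first by rewrite ltnS.
  rewrite qdot_suml; apply: eq_bigr => l _; exact: qdot_mull.
rewrite (exchange_big_dep xpredT) //=; apply: eq_bigr => k _.
under [RHS]eq_bigr do rewrite qdot_sumr.
rewrite [RHS]exchange_big /=; apply: eq_bigr => j _.
rewrite exchange_big /=; apply: eq_bigr => l _.
by rewrite qdot_sumr.
Qed.

Definition finite_contraction := forall M h, nrm2 M (toeplitz_apply Sn h) <= nrm2 M h.
Definition finite_adj_contraction := forall M g, nrm2 M (adj M g) <= nrm2 M g.

Let sqr_cancel (X H : R) : 0 <= X -> 0 <= H -> X ^+ 2 <= H * X -> X <= H.
Proof.
move=> X0 H0; have [->|Xn] := eqVneq X 0; first by [].
by rewrite expr2 ler_pM2r // lt_neqAle eq_sym Xn.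
Qed.

(** With [|T^* g|^2 = <T T^* g, g>], Cauchy-Schwarz and contractivity give
    [|T^* g|^4 <= |T^* g|^2 |g|^2], and one factor is cancelled. *)
Lemma finite_contraction_adj : finite_contraction -> finite_adj_contraction.
Proof.
move=> C M g; apply: sqr_cancel; rewrite ?nrm2_ge0 //.
rewrite -{1}dotpp -toeplitz_adj; apply: le_trans (dotp_CS _ _ _) _.
by rewrite mulrC ler_wpM2l ?nrm2_ge0.
Qed.
Lemma finite_adj_contraction_toeplitz : finite_adj_contraction -> finite_contraction.
Proof.
move=> C M h; apply: sqr_cancel; rewrite ?nrm2_ge0 //.
rewrite -{1}dotpp toeplitz_adj; apply: le_trans (dotp_CS _ _ _) _.
by rewrite ler_wpM2l ?nrm2_ge0.
Qed.

Lemma finite_contractionP : finite_contraction <-> toeplitz_contraction Sn.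
Proof.
split=> [C h hl|C M h].
  have b : (l2norm2 (toeplitz_apply Sn h) <= l2norm2 h)%E.
    have h0 : (0 <= l2norm2 h)%E by apply: (le_trans _ (nrm2_l2norm2 h 0)); rewrite lee_fin nrm2_ge0.
    have hf : l2norm2 h \is a fin_num by rewrite ge0_fin_numE.
    rewrite -(fineK hf); apply: l2norm2_bound => M; apply: le_trans (C M h) _.
    by rewrite -lee_fin fineK // nrm2_l2norm2.
  by split => //; rewrite /in_l2 (le_lt_trans b).
(* A truncation is square summable and, by triangularity, does not change the image at indices below
   [M]. *)
pose h' j l := if (j < M)%N then h j l else 0.
have hb : (l2norm2 h' <= (nrm2 M h)%:E)%E.
  apply: l2norm2_bound => N.
  have -> : nrm2 M h = nrm2 M h'.
    by apply: eq_bigr => j _; apply: eq_bigr => l _; rewrite /h' ltn_ord.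
  have [NM|/ltnW MN] := leqP N M; first exact: nrm2_le.
  rewrite -(subnKC MN) /nrm2 big_split_ord /= gerDl [X in X <= _]big1 // => j _.
  by rewrite /vnorm2 big1 // => l _; rewrite /h' ltnNge leq_addr /= qnorm2_0.
have [|_ b] := C h'; first by rewrite /in_l2 (le_lt_trans hb) // ltry.
rewrite -lee_fin; apply: le_trans hb; apply: le_trans b.
apply: le_trans (nrm2_l2norm2 _ M); rewrite lee_fin le_eqVlt; apply/orP; left; apply/eqP.
apply: eq_bigr => j _; apply: eq_bigr => a _; congr qnorm2.
apply: eq_bigr => k _; apply: eq_bigr => l _; rewrite /h' (leq_trans (ltn_ord k)) //.
Qed.

(** The unit sequence at index 0 is mapped to the coefficients themselves. *)
Lemma finite_contraction_le1 : finite_contraction -> forall m a l, qn (Sn m a l) <= 1.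
Proof.
move=> C m a l; pose h j l' : quat R := if (j == 0%N) && (l' == l) then qone R else 0.
have E : toeplitz_apply Sn h m a = Sn m a l.
  rewrite /toeplitz_apply big_ord_recl /= subn0 [X in _ + X]big1 ?addr0 => [|k _].
    rewrite (bigD1 l) //= /h !eqxx /= qmul1r big1 ?addr0 // => l' /negbTE ll.
    by rewrite ll qmul0r.
  by rewrite big1 // => l' _; rewrite /h /= qmul0r.
have H : nrm2 m.+1 h = 1.
  rewrite /nrm2 big_ord_recl [X in _ + X]big1 ?addr0 => [|k _]; last first.
    by rewrite /vnorm2 big1 // => l' _; rewrite /h /= qnorm2_0.
  rewrite /vnorm2 (bigD1 l) //= /h !eqxx /= big1 ?addr0.
    by rewrite -qn_sqr qn1 expr1n.
  by move=> l' /negbTE ->; rewrite /= qnorm2_0.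
rewrite -E (le_trans (qn_le_nN _ _ (ltnSn m))) //.
by rewrite -sqrtr1 ler_wsqrtr // -H.
Qed.

End Toeplitz.

Lemma kernel_term_quad (r s N : nat) (c : 'I_N -> quat R) (g : 'I_N -> 'I_r -> 'I_s -> quat R)
    (u : 'I_N -> 'I_r -> quat R) :
  \sum_(i < N) \sum_(j < N) \sum_(a < r) \sum_(b < r)
    qmul (qmul (qconj (u i a)) ((if a == b then qmul (c i) (qconj (c j)) else 0)
       - \sum_(k < s) qmul (g i a k) (qconj (g j b k)))) (u j b) =
  (vnorm2 (fun a => \sum_(j < N) qmul (qconj (c j)) (u j a))
   - vnorm2 (fun k => \sum_(j < N) \sum_(b < r) qmul (qconj (g j b k)) (u j b))) *: qone R.
Proof.
rewrite scalerBl.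
have VE (n : nat) (v : 'I_n -> quat R) : vnorm2 v *: qone R = \sum_k qmul (qconj (v k)) (v k).
  by rewrite /vnorm2 scaler_suml; apply: eq_bigr => k _; rewrite qmul_conjx.
rewrite !VE.
transitivity (\sum_(i < N) \sum_(j < N) \sum_(a < r) qmul (qmul (qconj (u i a)) (c i)) (qmul (qconj (c j)) (u j a))
  - \sum_(i < N) \sum_(j < N) \sum_(a < r) \sum_(b < r) \sum_(k < s)
      qmul (qmul (qconj (u i a)) (g i a k)) (qmul (qconj (g j b k)) (u j b))).
  rewrite -sumrB; apply: eq_bigr => i _; rewrite -sumrB; apply: eq_bigr => j _.
  rewrite -sumrB; apply: eq_bigr => a _.
  under eq_bigr do rewrite qmulBr qmulBl.
  rewrite sumrB; congr (_ - _).
    rewrite (bigD1 a) //= eqxx big1 ?addr0 ?qmulA // => b /negbTE ba.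
    by rewrite eq_sym ba qmul0r qmul0l.
  apply: eq_bigr => b _; rewrite qmul_sumr qmul_suml; apply: eq_bigr => k _.
  by rewrite !qmulA.
congr (_ - _).
  under eq_bigr do rewrite exchange_big /=.
  rewrite exchange_big /=; apply: eq_bigr => a _.
  rewrite qconj_sum qmul_suml; apply: eq_bigr => i _; rewrite qmul_sumr; apply: eq_bigr => j _.
  by rewrite qconjM qconjK.
transitivity (\sum_(k < s) \sum_(i < N) \sum_(a < r) \sum_(j < N) \sum_(b < r)
      qmul (qmul (qconj (u i a)) (g i a k)) (qmul (qconj (g j b k)) (u j b))).
  rewrite [RHS]exchange_big /=; apply: eq_bigr => i _.
  rewrite exchange_big /= [RHS]exchange_big /=; apply: eq_bigr => a _.
  rewrite [RHS]exchange_big /=; apply: eq_bigr => j _.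
  by rewrite [RHS]exchange_big.
apply: eq_bigr => k _; rewrite qconj_sum qmul_suml; apply: eq_bigr => i _.
rewrite qconj_sum qmul_suml; apply: eq_bigr => a _; rewrite qmul_sumr; apply: eq_bigr => j _.
rewrite qmul_sumr; apply: eq_bigr => b _.
by rewrite qconjM qconjK.
Qed.

End FiniteL2.

(** * The adjoint of multiplication by S *)

Lemma nN_zero (R : realType) n M : nN M (fun (_ : nat) (_ : 'I_n) => (0 : quat R)) = 0.
Proof. by rewrite /nN /nrm2 big1 ?sqrtr0 // => j _; rewrite /vnorm2 big1 // => k _; rewrite qnorm2_0. Qed.

Section ClosedRelation.
Variables (R : realType) (r s : nat) (S : quat R -> 'M[quat R]_(r, s)).
Local Notation hseq := (nat -> 'I_r -> quat R).
Local Notation wseq := (nat -> 'I_s -> quat R).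
Implicit Types (h g : hseq) (w : wseq) (c : seq (quat R * ('I_r -> quat R))) (e : R).

Definition imag_pt (y : quat R) := Ell y /\ qc y 0 = 0.
Fixpoint valid c := if c is p :: c' then imag_pt p.1 /\ valid c' else True.

(** A list of pairs [(y, u)] encodes a combination of the sequences [conj(y^n) u]. Right scalars are
    absorbed in [u], so sums are concatenations. *)
Definition hh c : hseq := fun n a => \sum_(p <- c) qmul (qconj (qpow p.1 n)) (p.2 a).
Definition ww c : wseq := fun n l =>
  \sum_(p <- c) \sum_a qmul (qconj (qmul (qpow p.1 n) (S p.1 a l))) (p.2 a).

Hypothesis combo_contraction : forall c (H : R), valid c -> 0 <= H ->
  (forall M, nN M (hh c) <= H) -> forall M, nN M (ww c) <= H.

(* Closure of the graph [hh c |-> ww c]. The domain must be closed in l2; on the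
   image side coordinatewise convergence is enough, as contractivity passes to it. *)
Definition good h w := forall e, 0 < e -> exists c, [/\ valid c,
  forall M, nN M (fun n a => h n a - hh c n a) <= e &
  forall n l, qn (w n l - ww c n l) <= e].

Definition rmul c (q : quat R) := [seq (p.1, fun a => qmul (p.2 a) q) | p <- c].
(** As [conj(y^(n+1)) u = conj(y^n) (conj(y) u)], replacing [u] by [conj(y) u] realizes the backward
    shift on both sides of the graph. *)
Definition lshift c := [seq (p.1, fun a => qmul (qconj p.1) (p.2 a)) | p <- c].

Lemma valid_cat c c' : valid c -> valid c' -> valid (c ++ c').
Proof. by elim: c => [//|p c IH] /= [h1 h2] h3; split => //; apply: IH. Qed.
Lemma valid_rmul c q : valid c -> valid (rmul c q).
Proof. by elim: c => [//|p c IH] /= [h1 h2]; split => //; apply: IH. Qed.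
Lemma valid_lshift c : valid c -> valid (lshift c).
Proof. by elim: c => [//|p c IH] /= [h1 h2]; split => //; apply: IH. Qed.

Lemma hh_cat c c' n a : hh (c ++ c') n a = hh c n a + hh c' n a.
Proof. by rewrite /hh big_cat. Qed.
Lemma ww_cat c c' n l : ww (c ++ c') n l = ww c n l + ww c' n l.
Proof. by rewrite /ww big_cat. Qed.
Lemma hh_rmul c q n a : hh (rmul c q) n a = qmul (hh c n a) q.
Proof. by rewrite /hh big_map qmul_suml; apply: eq_bigr => p _; rewrite /= qmulA. Qed.
Lemma ww_rmul c q n l : ww (rmul c q) n l = qmul (ww c n l) q.
Proof.
rewrite /ww big_map qmul_suml; apply: eq_bigr => p _; rewrite /= qmul_suml.
by apply: eq_bigr => a _; rewrite qmulA.
Qed.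
Lemma hh_lshift c n a : hh (lshift c) n a = hh c n.+1 a.
Proof. by rewrite /hh big_map; apply: eq_bigr => p _; rewrite /= qmulA -qconjM. Qed.
Lemma ww_lshift c n l : ww (lshift c) n l = ww c n.+1 l.
Proof.
rewrite /ww big_map; apply: eq_bigr => p _; apply: eq_bigr => a _.
by rewrite /= qmulA -qconjM qmulA.
Qed.

Lemma goodD h w h' w' : good h w -> good h' w' ->
  good (fun n a => h n a + h' n a) (fun n l => w n l + w' n l).
Proof.
move=> g g' e e0; have e2 : 0 < e / 2 by rewrite divr_gt0.
have [c [v H W]] := g _ e2; have [c' [v' H' W']] := g' _ e2.
exists (c ++ c'); split; first exact: valid_cat.
- move=> M; have := lerD (H M) (H' M); rewrite -splitr; apply: le_trans.
  rewrite (nN_eq (g := fun n a => (h n a - hh c n a) + (h' n a - hh c' n a))) ?nND // => n a _.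
  by rewrite hh_cat opprD addrACA.
- move=> n l; rewrite ww_cat opprD addrACA (le_trans (qnD _ _)) // [e]splitr lerD //.
Qed.

Lemma good_rmul h w q : good h w -> good (fun n a => qmul (h n a) q) (fun n l => qmul (w n l) q).
Proof.
move=> g e e0; have q0 : 0 < 1 + qn q by rewrite ltr_pwDl // qn_ge0.
have e2 : 0 < e / (1 + qn q) by rewrite divr_gt0.
have le x : 0 <= x -> x <= e / (1 + qn q) -> x * qn q <= e.
  move=> x0; rewrite ler_pdivlMr // => hx; apply: le_trans hx.
  by rewrite ler_wpM2l // lerDr.
have [c [v H W]] := g _ e2.
exists (rmul c q); split; first exact: valid_rmul.
- move=> M; rewrite (nN_eq (g := fun n a => qmul (h n a - hh c n a) q)).
    by rewrite nN_mulr le // nN_ge0.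
  by move=> n a _; rewrite hh_rmul qmulBl.
- by move=> n l; rewrite ww_rmul -qmulBl qnM le // qn_ge0.
Qed.

Lemma good_shift h w : good h w -> good (fun n a => h n.+1 a) (fun n l => w n.+1 l).
Proof.
move=> g e e0; have [c [v H W]] := g _ e0.
exists (lshift c); split; first exact: valid_lshift.
- move=> M; apply: le_trans (H M.+1).
  rewrite /nN ler_wsqrtr // /nrm2 [X in _ <= X]big_ord_recl.
  apply: (@le_trans _ _ (\sum_(j < M) vnorm2 (fun a => h (lift ord0 j) a - hh c (lift ord0 j) a))).
    by apply: ler_sum => j _; rewrite le_eqVlt; apply/orP; left; apply/eqP; apply: eq_bigr => a _; rewrite hh_lshift.
  by rewrite lerDr vnorm2_ge0.
- by move=> n l; rewrite ww_lshift.
Qed.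

Lemma good_eq h w h' w' : (forall n a, h n a = h' n a) -> (forall n l, w n l = w' n l) -> good h w -> good h' w'.
Proof.
move=> e1 e2; have -> : h = h' by apply/funext => n; apply/funext => a; exact: e1.
by have -> : w = w' by apply/funext => n; apply/funext => a; exact: e2.
Qed.

Lemma goodN h w : good h w -> good (fun n a => - h n a) (fun n l => - w n l).
Proof.
move=> /(good_rmul (- qone R)); apply: good_eq => n a; by rewrite qmulNr qmul1r.
Qed.
Lemma goodB h w h' w' : good h w -> good h' w' ->
  good (fun n a => h n a - h' n a) (fun n l => w n l - w' n l).
Proof. by move=> g /goodN g'; apply: goodD. Qed.
Lemma goodZ (t : R) h w : good h w -> good (fun n a => t *: h n a) (fun n l => t *: w n l).
Proof.
by move=> /(good_rmul (t *: qone R)); apply: good_eq => n a; rewrite qmulZr qmul1r.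
Qed.
Lemma good0 : good (fun _ _ => 0) (fun _ _ => 0).
Proof.
move=> e e0; exists [::]; split => //.
- move=> M; rewrite (nN_eq (g := fun _ _ => 0)); last by move=> n a _; rewrite /hh big_nil subrr.
  by rewrite nN_zero ltW.
- by move=> n l; rewrite /ww big_nil subrr qn0 ltW.
Qed.
Lemma good_sum (I : Type) (t : seq I) (h : I -> hseq) (w : I -> wseq) : (forall i, good (h i) (w i)) ->
  good (fun n a => \sum_(i <- t) h i n a) (fun n l => \sum_(i <- t) w i n l).
Proof.
move=> g; elim: t => [|i t IH].
  by apply: good_eq good0 => n a; rewrite big_nil.
by apply: good_eq (goodD (g i) IH) => n a; rewrite big_cons.
Qed.

Lemma good_gen y u : imag_pt y -> good (fun n a => qmul (qconj (qpow y n)) (u a))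
  (fun n l => \sum_a qmul (qconj (qmul (qpow y n) (S y a l))) (u a)).
Proof.
move=> iy e e0; exists [:: (y, u)]; split => //.
- move=> M; rewrite (nN_eq (g := fun _ _ => 0)); last by move=> n a _; rewrite /hh big_seq1 subrr.
  by rewrite nN_zero ltW.
- by move=> n l; rewrite /ww big_seq1 subrr qn0 ltW.
Qed.

(** A section of [w] has only [M * s] entries, so their uniform approximation controls its norm. *)
Lemma good_contraction h w (H : R) : 0 <= H -> good h w -> (forall M, nN M h <= H) -> forall M, nN M w <= H.
Proof.
move=> H0 g hH M; apply/ler_addgt0Pr => e e0.
pose d := e / (1 + (M * s)%:R).
have d1 : 0 < 1 + (M * s)%:R :> R by rewrite ltr_pwDl.
have d0 : 0 < d by rewrite divr_gt0.
have [c [v Hc Wc]] := g _ d0.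
have b M' : nN M' (hh c) <= H + d.
  rewrite (nN_eq (g := fun n a => h n a + (-1) *: (h n a - hh c n a))).
    rewrite (le_trans (nND _ _ _)) // lerD //.
    rewrite (nN_eq (g := fun n a => qmul (h n a - hh c n a) (- qone R))).
      by rewrite nN_mulr qnN qn1 mulr1.
    by move=> n a _; rewrite scaleN1r qmulNr qmul1r.
  by move=> n a _; rewrite scaleN1r subKr.
have := combo_contraction v (addr_ge0 H0 (ltW d0)) b M.
have := nN_unif M (ltW d0) Wc.
have E : (M * s)%:R * d + d = e by rewrite -[X in _ + X]mul1r -mulrDl addrC mulrC /d divfK // gt_eqF.
move=> h1 h2.
rewrite (nN_eq (g := fun n l => (w n l - ww c n l) + ww c n l)); last by move=> n l _; rewrite subrK.
by rewrite (le_trans (nND _ _ _)) //; lra.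
Qed.

Lemma good_zero w : good (fun _ _ => 0) w -> forall n l, w n l = 0.
Proof.
move=> g n l; apply: qn_eq0; apply/eqP; rewrite eq_le qn_ge0 andbT.
rewrite (le_trans (qn_le_nN w l (ltnSn n))) //.
apply: (good_contraction (lexx 0) g) => M.
by rewrite nN_zero.
Qed.

Lemma good_uniq h w w' : good h w -> good h w' -> forall n l, w n l = w' n l.
Proof.
move=> g g' n l; apply/eqP; rewrite -subr_eq0; apply/eqP.
apply: (good_zero (w := fun n l => w n l - w' n l)).
by apply: good_eq (goodB g g') => // k a; rewrite subrr.
Qed.

Lemma combo_close c c' (d : R) : valid c -> valid c' -> 0 <= d ->
  (forall M, nN M (fun n a => hh c n a - hh c' n a) <= d) -> forall n l, qn (ww c n l - ww c' n l) <= d.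
Proof.
move=> v v' d0 H n l.
have E1 n' a : hh (c ++ rmul c' (- qone R)) n' a = hh c n' a - hh c' n' a.
  by rewrite hh_cat hh_rmul qmulNr qmul1r.
have E2 n' l' : ww (c ++ rmul c' (- qone R)) n' l' = ww c n' l' - ww c' n' l'.
  by rewrite ww_cat ww_rmul qmulNr qmul1r.
rewrite -E2 (le_trans (qn_le_nN _ _ (ltnSn n))) //.
apply: (combo_contraction _ d0) => [|M]; first by apply: valid_cat => //; apply: valid_rmul.
by rewrite (nN_eq (g := fun n a => hh c n a - hh c' n a)).
Qed.

(** Combinations within [2^-k] of [h] have images that are Cauchy in each entry, by contractivity
    applied to differences; [w] is the telescoping sum. *)
Lemma good_limit h : (forall e, 0 < e -> exists h' w', good h' w' /\ forall M, nN M (fun n a => h n a - h' n a) <= e) ->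
  exists w, good h w.
Proof.
move=> hyp.
have half k : 0 < (2^-1 : R) ^+ k by rewrite exprn_gt0 // invr_gt0.
have ex k : exists c, valid c /\ forall M, nN M (fun n a => h n a - hh c n a) <= (2^-1) ^+ k.
  have [h' [w' [g hc]]] := hyp _ (half k.+1).
  have [c [v H _]] := g _ (half k.+1).
  exists c; split => // M.
  rewrite (nN_eq (g := fun n a => (h n a - h' n a) + (h' n a - hh c n a))); last by move=> n a _; rewrite subrKA.
  rewrite (le_trans (nND _ _ _)) // (le_trans (lerD (hc M) (H M))) // exprSr.
  by rewrite -mulrDr -[X in _ * (X + _)]mul1r -[X in _ * (_ + X)]mul1r -splitr mulr1.
have [c hc] := choice ex.
have d2 n l k : qn (ww (c k.+1) n l - ww (c k) n l) <= 2 * (2^-1) ^+ k.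
  have [v H] := hc k; have [v' H'] := hc k.+1.
  apply: (combo_close v' v); first by rewrite mulr_ge0 // ltW.
  move=> M; rewrite (nN_eq (g := fun n a => (h n a - hh (c k) n a) + qmul (h n a - hh (c k.+1) n a) (- qone R))).
    rewrite (le_trans (nND _ _ _)) // nN_mulr qnN qn1 mulr1 (le_trans (lerD (H M) (H' M))) //.
    by rewrite exprS; have := half k; lra.
  by move=> n' a _; rewrite qmulNr qmul1r opprB [RHS]addrC subrKA.
have gs N : \sum_(m < N) (2^-1 : R) ^+ m <= (1 - 2^-1)^-1.
  by apply: geometric_le; rewrite invr_ge0 ler0n /= invf_lt1 // ltr1n.
have lim n l := qsum_lim (fun m => ltW (half m)) gs (ler0n R 2) (d2 n l).
pose w n l := ww (c 0%N) n l + qsum (fun k => ww (c k.+1) n l - ww (c k) n l).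
have wlim n l : qlim (fun k => ww (c k) n l) (w n l).
  apply: qlim_eq (qlimD (qlim_cst (ww (c 0%N) n l)) (lim n l)) => N.
  rewrite /qpart; elim: N => [|N IH]; first by rewrite big_ord0 addr0.
  by rewrite big_ord_recr /= addrA IH addrC subrK.
exists w => e e0.
have [k hk] : exists k, 2 * (2^-1) ^+ k <= e.
  exists (Num.bound (2 / e)).
  rewrite exprVn ler_pdivrMr ?exprn_gt0 // mulrC -ler_pdivrMr //.
  rewrite (le_trans (ltW (archi_boundP _))) ?divr_ge0 ?(ltW e0) //.
  by rewrite -natrX ler_nat ltnW // ltn_expl.
have [v H] := hc k; exists (c k); split => //.
  by move=> M; rewrite (le_trans (H M)) // (le_trans _ hk) // ler_peMl ?ler1n // ltW.
move=> n l; have L := qlimD (wlim n l) (qlim_cst (- ww (c k) n l)).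
apply: (qlim_le_near (N0 := k) L) => N kN; apply: le_trans hk.
have [v' H'] := hc N; apply: (combo_close v' v); first by rewrite mulr_ge0 // ltW.
move=> M; rewrite (nN_eq (g := fun n a => (h n a - hh (c k) n a) + qmul (h n a - hh (c N) n a) (- qone R))).
  rewrite (le_trans (nND _ _ _)) // nN_mulr qnN qn1 mulr1 (le_trans (lerD (H M) (H' M))) //.
  have i1 : (2^-1 : R) ^+ (N - k) <= 1 by rewrite exprn_ile1 ?invr_ge0 //; lra.
  rewrite -(subnKC kN) exprD; have : (2^-1) ^+ k * (2^-1 : R) ^+ (N - k) <= 2^-1 ^+ k by rewrite ler_piMr // ltW.
  lra.
by move=> n' a _; rewrite qmulNr qmul1r opprB [RHS]addrC subrKA.
Qed.

Definition del (m : nat) (v : 'I_r -> quat R) : hseq := fun n a => if n == m then v a else 0.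
Definition e1 : quat R := qe R 1.

Lemma e1_pow_norm n : qn (qpow e1 n) = 1.
Proof.
elim: n => [|n IH]; first exact: qn1.
by rewrite /= qnM IH mulr1 /qn qnorm2E !qc_qe expr1n !expr0n /= !addr0 add0r sqrtr1.
Qed.

Lemma qpowZ (t : R) (y : quat R) n : qpow (t *: y) n = t ^+ n *: qpow y n.
Proof.
elim: n => [|n IH]; first by rewrite /= expr0 scale1r.
by rewrite /= IH qmulZl qmulZr scalerA exprS.
Qed.

Lemma imag_te1 (t : R) : 0 < t <= 2^-1 -> imag_pt (t *: e1).
Proof.
move=> /andP[t0 t1]; split; last by rewrite qcZ qc_qe mulr0.
rewrite EllE /Nq !qcZ !qc_qe !mulr0 expr0n /= mulr0 mulr1 !addr0 add0r.
by rewrite expr_lt1 ?ltW // (le_lt_trans t1) // invf_lt1 // ltr1n.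
Qed.

Definition tail m (t : R) (u : 'I_r -> quat R) : hseq := fun n a =>
  if (n < m)%N then 0 else t ^+ n *: qmul (qconj (qpow e1 n)) (u a).

Let uvn (v : 'I_r -> quat R) (q : quat R) : qn q = 1 -> vnorm2 (fun a => qmul q (v a)) = vnorm2 v.
Proof. by move=> q1; apply: eq_bigr => a _; rewrite qnorm2M -qn_sqr q1 expr1n mul1r. Qed.

(* Dividing the tail by [t^m] and letting [t -> 0] isolates its leading entry. *)
Lemma good_del_of_tail m : (forall t u, 0 < t <= 2^-1 -> exists w, good (tail m t u) w) ->
  forall v, exists w, good (del m v) w.
Proof.
move=> ht v; apply: good_limit => e e0.
pose V := Num.sqrt (vnorm2 v).
have V0 : 0 <= V by exact: sqrtr_ge0.
(* After rescaling, entry [n > m] of the tail has norm [t ^+ (n - m) * V], so the total error is at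
   most [2 * t * V]. *)
pose t := Num.min (2^-1) (e / (2 * (1 + V))).
have V1 : 0 < 1 + V by rewrite ltr_pwDl.
have t0 : 0 < t by rewrite lt_min invr_gt0 ltr0n divr_gt0 // mulr_gt0.
have t2 : t <= 2^-1 by rewrite ge_min lexx.
have te : t * (2 * (1 + V)) <= e by rewrite -ler_pdivlMr ?mulr_gt0 // ge_min lexx orbT.
(* The unit factor [qpow e1 m] undoes the [conj(e1^m)] in the leading entry of the tail, which
   becomes [v] after rescaling. *)
have [|w g] := ht t (fun a => qmul (qpow e1 m) (v a)); first by rewrite t0.
exists (fun n a => (t ^- m) *: tail m t (fun a => qmul (qpow e1 m) (v a)) n a), (fun n l => t ^- m *: w n l).
split; first exact: goodZ.
move=> M.
have E n a : del m v n a - t ^- m *: tail m t (fun a => qmul (qpow e1 m) (v a)) n a =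
   if (n <= m)%N then 0 else - (t ^+ (n - m) *: qmul (qmul (qconj (qpow e1 n)) (qpow e1 m)) (v a)).
  rewrite /del /tail ltnNge; have [nm|nm|->] := ltngtP n m; first by rewrite /= scaler0 subr0.
    rewrite /= sub0r scalerA qmulA; congr (- (_ *: _)).
    by rewrite -{1}(subnKC (ltnW nm)) exprD mulrA mulVf ?mul1r // expf_neq0 // gt_eqF.
  rewrite /= scalerA mulVf ?scale1r ?expf_neq0 ?gt_eqF //.
  by rewrite qmulA qmul_conjx -qn_sqr e1_pow_norm expr1n scale1r qmul1l subrr.
have vn n : vnorm2 (fun a => del m v n a - t ^- m *: tail m t (fun a => qmul (qpow e1 m) (v a)) n a)
   <= if (n <= m)%N then 0 else (t ^+ (n - m)) ^+ 2 * vnorm2 v.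
  case: ifP => nm.
    by rewrite /vnorm2 big1 // => a _; rewrite E nm qnorm2_0.
  rewrite -(uvn v (q := qmul (qconj (qpow e1 n)) (qpow e1 m))); last by rewrite qnM qn_conj !e1_pow_norm mulr1.
  rewrite /vnorm2 mulr_sumr ler_sum // => a _.
  by rewrite E nm qnorm2N qnorm2Z.
have S2 : nrm2 M (fun n a => del m v n a - t ^- m *: tail m t (fun a => qmul (qpow e1 m) (v a)) n a) <= (2 * t) ^+ 2 * vnorm2 v.
  apply: (@le_trans _ _ (\sum_(n < M) if (n <= m)%N then 0 else (t ^+ (n - m)) ^+ 2 * vnorm2 v)).
    by apply: ler_sum => n _.
  have V2 : 0 <= vnorm2 v by exact: vnorm2_ge0.
  (* The subtracted term closes the induction: as [t ^+ 2 <= 4^-1], twice a term dominates that term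
     plus twice the next one. *)
  have bb N : \sum_(n < N) (if (n <= m)%N then 0 else (t ^+ (n - m)) ^+ 2 * vnorm2 v) <=
     (2 * t ^+ 2 - (if (N <= m)%N then 2 * t ^+ 2 else 2 * (t ^+ (N - m)) ^+ 2)) * vnorm2 v.
    elim: N => [|N IH]; first by rewrite big_ord0 subrr mul0r.
    rewrite big_ord_recr /=; apply: (le_trans (lerD IH (lexx _))).
    have [NM|NM] := leqP N m.
      rewrite addr0 subrr mul0r; have [NM'|NM'] := leqP N.+1 m; first by rewrite subrr mul0r.
      have -> : m = N by apply/eqP; rewrite eqn_leq NM -ltnS NM'.
      by rewrite subSnn expr1 subrr mul0r.
    rewrite leqNgt (leq_trans NM (leqnSn N)) /= -mulrDl ler_wpM2r //.
    have k1 : (N.+1 - m = (N - m).+1)%N by rewrite subSn // ltnW.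
    rewrite k1 [t ^+ (N - m).+1]exprS exprMn.
    have t22 : t ^+ 2 <= 4^-1.
      rewrite (_ : 4^-1 = (2^-1) ^+ 2 :> R); last by field.
      by rewrite lerXn2r ?nnegrE ?invr_ge0 // ltW.
    have : t ^+ 2 * (t ^+ (N - m)) ^+ 2 <= 4^-1 * (t ^+ (N - m)) ^+ 2 by rewrite ler_wpM2r ?sqr_ge0.
    have := sqr_ge0 (t ^+ (N - m)).
    set z := (t ^+ (N - m)) ^+ 2; lra.
  apply: (le_trans (bb M)); rewrite ler_wpM2r // exprMn.
  case: ifP => _; first by rewrite subrr mulr_ge0 ?sqr_ge0.
  have := sqr_ge0 (t ^+ (M - m)); have := sqr_ge0 t; lra.
apply: (@le_trans _ _ (2 * t * V)).
  rewrite /nN (le_trans (ler_wsqrtr S2)) // sqrtrM ?sqr_ge0 // sqrtr_sqr ger0_norm //.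
  by rewrite mulr_ge0 // ltW.
apply: le_trans te; rewrite mulrCA mulrAC -mulrA ler_wpM2l // mulrC ler_wpM2l ?(ltW t0) //.
by rewrite lerDr.
Qed.

(** [tail 0] is the sequence generated at the imaginary point [t e1]. If all tails from [m] on are
    in the domain, so is the unit sequence at [m], and subtracting it gives the tail from [m + 1]
    on. *)
Lemma good_tail m t u : 0 < t <= 2^-1 -> exists w, good (tail m t u) w.
Proof.
elim: m t u => [|m IH] t u ht.
  have := good_gen u (imag_te1 ht); set w := (fun n l => \sum_a _) => g; exists w.
  apply: good_eq g => // n a; rewrite /tail /= qpowZ qconjZ qmulZl //.
have [w g] := IH t u ht.
have [w' g'] := good_del_of_tail IH (fun a => t ^+ m *: qmul (qconj (qpow e1 m)) (u a)).
exists (fun n l => w n l - w' n l); apply: good_eq (goodB g g') => // n a.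
rewrite /tail /del ltnS; have [nm|nm|->] := ltngtP n m; rewrite ?subrr ?subr0 //.
Qed.

Lemma good_del m v : exists w, good (del m v) w.
Proof. by apply: good_del_of_tail => t u; apply: good_tail. Qed.

Definition bas (a : 'I_r) : 'I_r -> quat R := fun b => if b == a then qone R else 0.
Definition Wd m a : wseq := projT1 (cid (good_del m (bas a))).
Lemma WdP m a : good (del m (bas a)) (Wd m a).
Proof. exact: projT2 (cid (good_del m (bas a))). Qed.

(** [Wd m] collects the columns of the adjoint at index [m]; row 0 of the adjoint holds the
    conjugate coefficients. *)
Definition Sco m : 'M[quat R]_(r, s) := \matrix_(a, l) qconj (Wd m a 0%N l).

(** The backward shift sends the unit sequence at [m + 1] to that at [m], and the one at 0 to zero;
    as images are unique, row [n] is reduced to row 0. *)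
Lemma Wd_toeplitz m a n l : Wd m a n l = if (n <= m)%N then qconj (Sco (m - n) a l) else 0.
Proof.
have E k : Wd k a 0%N l = qconj (Sco k a l) by rewrite mxE qconjK.
elim: n m => [|n IH] m; first by rewrite subn0 E.
have g := good_shift (WdP m a).
case: m g => [|m] g; last first.
  rewrite ltnS subSS -IH.
  apply: (good_uniq (h := del m (bas a)) (w := fun n l => Wd m.+1 a n.+1 l)); last exact: WdP.
  exact: good_eq g.
apply: (good_zero (w := fun n l => Wd 0%N a n.+1 l)).
exact: good_eq g.
Qed.

(** A truncated sequence is a finite right combination of unit sequences, whose images are the
    columns just found. *)
Lemma good_trunc M g : good (fun n a => if (n < M)%N then g n a else 0) (adj Sco M g).
Proof.
have G (m : 'I_M) a := good_rmul (g m a) (WdP m a).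
have G2 := good_sum (index_enum 'I_M) (fun m => good_sum (index_enum 'I_r) (G m)).
apply: good_eq G2 => n a.
  have [nM|nM] := ltnP n M.
    rewrite (bigD1 (Ordinal nM)) //= [X in _ + X]big1 ?addr0.
      rewrite (bigD1 a) //= /del /bas !eqxx qmul1l big1 ?addr0 // => b /negbTE ba.
      by rewrite eq_sym ba qmul0l.
    move=> m nm; rewrite big1 // => b _; rewrite /del ifF ?qmul0l //.
    by apply/negbTE; move: nm; apply: contra => /eqP e; apply/eqP/val_inj.
  rewrite big1 // => m _; rewrite big1 // => b _; rewrite /del ifF ?qmul0l //.
  by apply/negbTE; rewrite gtn_eqF // (leq_trans (ltn_ord m)).
rewrite /adj [RHS]big_mkcond; apply: eq_bigr => m _; case: ifP => nm.
  by apply: eq_bigr => b _; rewrite Wd_toeplitz nm.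
by rewrite big1 // => b _; rewrite Wd_toeplitz nm qmul0l.
Qed.

Lemma Sco_adj_contraction : finite_adj_contraction Sco.
Proof.
move=> M g; rewrite -!nN_sqr lerXn2r ?nnegrE ?nN_ge0 //.
apply: (good_contraction (nN_ge0 M g) (good_trunc M g)) => M'.
have [MM|/ltnW MM] := leqP M' M.
  rewrite (nN_eq (g := g)); first exact: nN_le.
  by move=> j k jM; rewrite (leq_trans jM MM).
rewrite ler_wsqrtr // /nrm2 -(subnKC MM) big_split_ord /= [X in _ + X]big1 ?addr0.
  by apply: ler_sum => j _; rewrite ltn_ord.
by move=> j _; rewrite /vnorm2 big1 // => a _; rewrite ltnNge leq_addr /= qnorm2_0.
Qed.

(** The sequence generated by [y] is the l2 limit of its truncations. Contractivity carries this to
    entry 0 of the images: conjugated partial sums on one side, [conj(S y)] on the other. *)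
Lemma Sco_expansion y a l : imag_pt y -> qlim (qpart (fun m => qmul (qpow y m) (Sco m a l))) (S y a l).
Proof.
move=> iy; have [Ey y0] := iy.
pose q := qn y ^+ 2.
have q1 : q < 1.
  by move: Ey; rewrite EllE /q qn_sqr qnorm2E /Nq y0 expr0n /= mulr0.
have q0 : 0 <= q by rewrite sqr_ge0.
pose h n b := qmul (qconj (qpow y n)) (bas a b).
have g := good_gen (bas a) iy.
suff L : qlim (fun M => qconj (adj Sco M h 0%N l)) (S y a l).
  apply: qlim_eq L => M; rewrite /adj /qpart qconj_sum; apply: eq_bigr => m _.
  rewrite subn0 qconj_sum (bigD1 a) //= big1 ?addr0.
    by rewrite /h /bas eqxx qmul1r qconjM !qconjK.
  by move=> b /negbTE ba; rewrite /h /bas ba !qmul0r qconj0.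
have pn n : qn (qpow y n) = qn y ^+ n.
  by elim: n => [|n IH]; [rewrite /= qn1|rewrite /= qnM IH exprS].
have hn n : vnorm2 (h n) = q ^+ n.
  rewrite /vnorm2 (bigD1 a) //= big1 ?addr0.
    by rewrite /h /bas eqxx qmul1r qnorm2_conj -qn_sqr pn exprAC.
  by move=> b /negbTE ba; rewrite /h /bas ba qmul0r qnorm2_0.
move=> e e0.
(* The squared norm of the part beyond [N] is at most [q ^+ N / (1 - q)]. *)
have [N0 hN0] : exists N0, forall N, (N0 <= N)%N -> q ^+ N <= (1 - q) * e ^+ 2.
  have : geometric 1 q @ \oo --> 0 by apply: cvg_geometric; rewrite ger0_norm.
  have p0 : 0 < (1 - q) * e ^+ 2 by rewrite mulr_gt0 ?subr_gt0 // exprn_gt0.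
  move=> /cvgrPdist_le /(_ _ p0) [N0 _ H]; exists N0 => N /H.
  by rewrite /= mul1r sub0r normrN ger0_norm // exprn_ge0.
exists N0 => N /hN0 hN.
have gd := goodB g (good_trunc N h).
have B M : nN M (fun n b => qmul (qconj (qpow y n)) (bas a b) - (if (n < N)%N then h n b else 0)) <= e.
  rewrite -(@ler_pXn2r _ 2) ?nnegrE ?nN_ge0 ?(ltW e0) // nN_sqr.
  apply: (@le_trans _ _ (\sum_(n < M) if (n < N)%N then 0 else q ^+ n)).
    apply: ler_sum => n _; case: ifP => nN1.
      by rewrite /vnorm2 big1 // => b _; rewrite subrr qnorm2_0.
    by rewrite -hn ler_sum // => b _; rewrite subr0.
  have tl M' : (1 - q) * (\sum_(n < M') if (n < N)%N then 0 else q ^+ n) <= q ^+ N - q ^+ (maxn M' N).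
    elim: M' => [|M' IH]; first by rewrite big_ord0 mulr0 max0n subrr.
    rewrite big_ord_recr /= mulrDr (le_trans (lerD IH (lexx _))) //.
    have [MN|MN] := ltnP M' N.
      by rewrite mulr0 addr0 (maxn_idPr MN).
    rewrite (maxn_idPl (leqW MN)) exprS; lra.
  rewrite -(@ler_pM2l _ (1 - q)) ?subr_gt0 // (le_trans (tl M)) // (le_trans _ hN) //.
  by rewrite gerBl exprn_ge0.
have C := good_contraction (ltW e0) gd B 1%N.
have := le_trans (qn_le_nN _ l (ltnSn 0)) C.
rewrite (bigD1 a) //= big1 ?addr0.
  rewrite /bas eqxx qmul1r qmul1l => H; rewrite -qn_conj qconjD qconjN qconjK //.
by move=> b /negbTE ba; rewrite /bas ba qmul0r.
Qed.

End ClosedRelation.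

(** * Schur multipliers *)

Section Main.
Variable R : realType.

Lemma Ell_qn (x : quat R) : Ell x -> qn x < 1.
Proof.
rewrite EllE => h; rewrite -(@ltr_pXn2r _ 2) ?nnegrE ?qn_ge0 // expr1n qn_sqr.
apply: le_lt_trans h; rewrite qnorm2E /Nq !lerD2r; have := sqr_ge0 (qc x 0); lra.
Qed.

Lemma hyperholo_sub (U V : set (quat R)) f : V `<=` U -> hyperholo U f -> hyperholo V f.
Proof.
move=> s [h1 [h2 h3]]; split; [|split] => [x /s|i x /s|x /s]; [exact: h1|exact: h2|exact: h3].
Qed.

Lemma hyperholoB (f g : quat R -> quat R) : hyperholo (@Ell R) f -> hyperholo (@Ell R) g ->
  hyperholo (@Ell R) (fun x => f x - g x).
Proof.
move=> [f1 [f2 f3]] [g1 [g2 g3]].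
have D v x : Ell x -> 'D_v (fun x => f x - g x) x = 'D_v f x - 'D_v g x.
  move=> Ex; apply: (@deriveB _ _ _ f g); apply: diff_derivable; [exact: f1|exact: g1].
split; [|split].
- by move=> x Ex; apply: (@differentiableB _ _ _ f g); [exact: f1|exact: g1].
- move=> i x Ex; apply/(quat_ctsP _ x) => e e0; have e2 : 0 < e / 2 by rewrite divr_gt0.
  have [d d0 H] := (quat_ctsP _ x).1 (f2 i x Ex) _ e2.
  have [d' d'0 H'] := (quat_ctsP _ x).1 (g2 i x Ex) _ e2.
  have [d'' d''0 H''] := Ell_nbhs Ex.
  exists (Num.min d (Num.min d' d'')); first by rewrite !lt_min d0 d'0.
  move=> y; rewrite !le_min => /and3P[/H a1 /H' a2 /H'' Ey].
  have Dx := D (qe R i) x Ex; have Dy := D (qe R i) y Ey.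
  rewrite Dx Dy opprD addrACA -[- 'D_(qe R i) g x - _]opprD.
  rewrite (splitr e); apply: le_trans (ler_normB _ _) (lerD a1 a2).
- move=> x Ex; transitivity (Dop f x - Dop g x); last by rewrite f3 // g3 // subr0.
  have E : \sum_(i < 3) qmul (qe R i.+1) ('D_(qe R i.+1) (fun x => f x - g x) x) =
     \sum_(i < 3) qmul (qe R i.+1) ('D_(qe R i.+1) f x) - \sum_(i < 3) qmul (qe R i.+1) ('D_(qe R i.+1) g x).
    by rewrite -sumrB; apply: eq_bigr => i _; rewrite (D (qe R i.+1) x Ex) qmulBr.
  by rewrite /Dop E (D (qe R 0) x Ex) opprD addrACA.
Qed.

Lemma cvg_sumr (I : finType) (f : I -> nat -> R) (l : I -> R) :
  (forall i, f i @ \oo --> l i) -> (fun N => \sum_i f i N) @ \oo --> \sum_i l i.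
Proof.
move=> h; elim: (index_enum I) => [|i t IH].
  rewrite big_nil; under eq_fun do rewrite big_nil; exact: cvg_cst.
by rewrite big_cons; under eq_fun do rewrite big_cons; apply: cvgD.
Qed.

Lemma lim_le_eventually (u : nat -> R) l c N0 : u @ \oo --> l ->
  (forall N, (N0 <= N)%N -> u N <= c) -> l <= c.
Proof.
move=> h H; apply/ler_addgt0Pl => e e0; have /cvgrPdist_le /(_ _ e0) [N1 _ H1] := h.
have := H1 (maxn N0 N1) (leq_maxr _ _); have := H _ (leq_maxl N0 N1).
rewrite /= ler_norml; lra.
Qed.

Lemma lim_ge_eventually (u : nat -> R) l c N0 : u @ \oo --> l ->
  (forall N, (N0 <= N)%N -> c <= u N) -> c <= l.
Proof.
move=> h H; rewrite -lerN2; apply: (@lim_le_eventually (fun N => - u N) _ _ N0); first exact: cvgN.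
by move=> N /H; rewrite lerN2.
Qed.

Lemma qlim_qnorm2 (u : nat -> quat R) l : qlim u l -> (fun N => qnorm2 (u N)) @ \oo --> qnorm2 l.
Proof.
move=> h; apply: (@cvg_sumr 'I_4 (fun c N => u N ord0 c ^+ 2) (fun c => l ord0 c ^+ 2)) => c.
have k := (coord_qlim h) c; have E (q : quat R) : q ord0 c = qc q c by rewrite /qc inord_val.
by under eq_fun do rewrite E; rewrite E; apply: cvgM.
Qed.

Lemma qlim_scalar (d : nat -> R) q : qlim (fun n => d n *: qone R) q ->
  [/\ qc q 1 = 0, qc q 2 = 0, qc q 3 = 0 & d @ \oo --> qc q 0].
Proof.
move=> L; have H := coord_qlim L.
have E (k : 'I_4) : (fun n => qc (d n *: qone R) k) = fun n => d n * (k == 0%N :> nat)%:R.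
  apply/funext => n; rewrite qcZ /qone; congr (_ * _).
  by case: k => [[|[|[|[|k]]]] //= ?]; rewrite qc_mk.
have Z (k : 'I_4) : (k != 0%N :> nat) -> qc q k = 0.
  move=> /negbTE k0; have := H k; rewrite E k0; under eq_fun do rewrite mulr0.
  by move=> h; apply: (cvg_unique _ h (cvg_cst _)).
split; [exact: (Z (@Ordinal 4 1 isT))|exact: (Z (@Ordinal 4 2 isT))|exact: (Z (@Ordinal 4 3 isT))|].
by have := H (@Ordinal 4 0 isT); rewrite E /=; under eq_fun do rewrite mulr1.
Qed.

(** * The quadratic form of the kernel *)

Section Kernel.
Variables (r s : nat) (G : nat -> quat R -> 'M[quat R]_(r, s)).
Variables (N : nat) (ys : 'I_N -> quat R) (us : 'I_N -> 'I_r -> quat R).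

Definition kh (n : nat) (a : 'I_r) : quat R := \sum_(j < N) qmul (qconj (Pm n (ys j))) (us j a).
Definition kw (n : nat) (k : 'I_s) : quat R := \sum_(j < N) \sum_(b < r) qmul (qconj (G n (ys j) b k)) (us j b).

Lemma kernel_partial_quad n0 :
  \sum_(i < N) \sum_(j < N) \sum_(a < r) \sum_(b < r)
    qmul (qmul (qconj (us i a)) (\sum_(n < n0) Kterm G n (ys i) (ys j) a b)) (us j b)
  = (nrm2 n0 kh - nrm2 n0 kw) *: qone R.
Proof.
rewrite /nrm2 -sumrB scaler_suml.
under [RHS]eq_bigr do rewrite -(kernel_term_quad (fun i => Pm _ (ys i)) (fun i => G _ (ys i)) us).
rewrite [RHS]exchange_big /=; apply: eq_bigr => i _.
rewrite [RHS]exchange_big /=; apply: eq_bigr => j _.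
rewrite [RHS]exchange_big /=; apply: eq_bigr => a _.
rewrite [RHS]exchange_big /=; apply: eq_bigr => b _.
by rewrite qmul_sumr qmul_suml.
Qed.

Lemma kernel_quad_lim (K : quat R -> quat R -> 'I_r -> 'I_r -> quat R) :
  (forall i, Ell (ys i)) ->
  (forall x y, Ell x -> Ell y -> forall a b,
         (fun N => \sum_(n < N) Kterm G n x y a b) @ \oo --> K x y a b) ->
  qlim (fun n0 => (nrm2 n0 kh - nrm2 n0 kw) *: qone R)
   (\sum_(i < N) \sum_(j < N) \sum_(a < r) \sum_(b < r)
               qmul (qmul (qconj (us i a)) (K (ys i) (ys j) a b)) (us j b)).
Proof.
move=> Ey hK.
apply: (qlim_eq kernel_partial_quad).
do 4 ![apply: qlim_sum => ?]; apply: qlimMr; apply: qlimMl; apply/qlimP; exact: hK.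
Qed.

End Kernel.

(** * From a Schur multiplier to a Toeplitz contraction *)

Section Forward.
Variables (r s : nat) (S : quat R -> 'M[quat R]_(r, s)).
Hypothesis hS : hyperholo_mx (@Ell R) S.
Hypothesis sch : schur_multiplier S.

(** Sections of [|hh|^2 - |ww|^2] tend to the quadratic form of [K], which is nonnegative. From
    index [M] on they are at most [H ^+ 2] minus the [M]-th section of [|ww|^2], and this bound
    survives in the limit. *)
Lemma schur_combo_contraction c (H : R) : valid c -> 0 <= H ->
  (forall M, nN M (hh c) <= H) -> forall M, nN M (ww S c) <= H.
Proof.
move=> vc H0 hH M; have [G [hG [K [hK pK]]]] := sch.
pose d : quat R * ('I_r -> quat R) := (0, fun=> 0).
pose ys (i : 'I_(size c)) := (nth d c i).1; pose us (i : 'I_(size c)) := (nth d c i).2.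
have vi i : imag_pt (ys i).
  rewrite /ys; case: i => i /= ic; elim: (c) i vc ic => [//|p c' IH] [|i] /= [h1 h2] // ic.
  by apply: IH.
have hE n a : kh ys us n a = hh c n a.
  rewrite /kh /hh (big_nth d) big_mkord; apply: eq_bigr => j _.
  by rewrite Pm_imag //; case: (vi j).
have wE n l : kw G ys us n l = ww S c n l.
  rewrite /kw /ww (big_nth d) big_mkord; apply: eq_bigr => j _; apply: eq_bigr => b _.
  have [Ej j0] := vi j; have [_ g] := hG n; rewrite g // Pm_imag //.
have L := kernel_quad_lim us (fun i => (vi i).1) hK.
have [_ _ _ q0] := pK _ ys us (fun i => (vi i).1).
have [_ _ _ {}L] := qlim_scalar L.
rewrite -(@ler_pXn2r _ 2) ?nnegrE ?nN_ge0 // nN_sqr -subr_ge0; apply: (le_trans q0).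
apply: (lim_le_eventually (N0 := M) L) => n0 hn0.
have -> : nrm2 n0 (kh ys us) = nrm2 n0 (hh c) by apply: eq_bigr => n _; apply: eq_bigr => a _; rewrite hE.
have -> : nrm2 n0 (kw G ys us) = nrm2 n0 (ww S c) by apply: eq_bigr => n _; apply: eq_bigr => a _; rewrite wE.
rewrite lerB //; last exact: nrm2_le.
by rewrite -nN_sqr lerXn2r ?nnegrE ?nN_ge0.
Qed.

Lemma schur_expansion : exists Sn : nat -> 'M[quat R]_(r, s),
  has_P_expansion S Sn /\ toeplitz_contraction Sn.
Proof.
pose Sn := Sco schur_combo_contraction.
have fc : finite_contraction Sn by apply: finite_adj_contraction_toeplitz; exact: Sco_adj_contraction.
exists Sn; split; last by apply/finite_contractionP.
move=> x Ex a b; have a1 m : qn (Sn m a b) <= 1 by exact: finite_contraction_le1.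
pose H := Psum (fun m => Sn m a b).
have hH : hyperholo (@Ell R) H.
  apply: (@hyperholo_sub (fun x => qn x < 1)); first exact: Ell_qn.
  exact: Psum_hyperholo.
have SH : S x a b = H x.
  apply/eqP; rewrite -subr_eq0; apply/eqP.
  (* So far the expansion is known at imaginary points only; uniqueness carries it to the
     ellipsoid. *)
  have hD := hyperholoB (hS a b) hH.
  refine (CK_unique hD _ Ex) => y Ey y0; apply/eqP; rewrite subr_eq0; apply/eqP.
  apply: (qlim_uniq (Sco_expansion schur_combo_contraction a b (conj Ey y0))).
  exact: Psum_imag (Ell_qn Ey) y0.
by apply/qlimP; rewrite SH; apply: Psum_cvg => //; exact: Ell_qn.
Qed.

End Forward.

(** * From a Toeplitz contraction to a Schur multiplier *)

Section Backward.
Variables (r s : nat) (S : quat R -> 'M[quat R]_(r, s)) (Sn : nat -> 'M[quat R]_(r, s)).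
Hypothesis hexp : has_P_expansion S Sn.
Hypothesis hT : toeplitz_contraction Sn.

Let fc : finite_contraction Sn. Proof. exact/finite_contractionP. Qed.
Let afc : finite_adj_contraction Sn. Proof. exact: finite_contraction_adj. Qed.
(** Coefficients of [sum_k P_k S_(k-n)], padded by zeros below [n] so that each product is again a
    series handled by [Psum]. *)
Let cof n a b k : quat R := if (n <= k)%N then Sn (k - n)%N a b else 0.
Let cof1 n a b k : qn (cof n a b k) <= 1.
Proof. by rewrite /cof; case: ifP => _; [exact: finite_contraction_le1|rewrite qn0]. Qed.

Definition CKprod n x : 'M[quat R]_(r, s) := \matrix_(a, b) Psum (cof n a b) x.

Lemma CKprodP n : is_CKprod_P n S (CKprod n).
Proof.
split.
  move=> a b; rewrite (_ : (fun x => CKprod n x a b) = Psum (cof n a b)); last first.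
    by apply/funext => x; rewrite mxE.
  apply: (@hyperholo_sub (fun x => qn x < 1)); first exact: Ell_qn.
  exact: Psum_hyperholo.
move=> x Ex x0 a b; rewrite mxE.
have L1 := Psum_imag (cof1 n a b) (Ell_qn Ex) x0.
have /qlimP L2 := (hexp Ex) a b.
have L2' := qlimMl (Pm n x) L2.
apply: qlim_uniq _ L2'.
(* Passing to index [n + N] skips the [n] zero terms and aligns the partial sums with those of [S],
   multiplied by [P_n(x) = x^n]. *)
have {}L1 : qlim (fun N => qpart (fun m => qmul (qpow x m) (cof n a b m)) (n + N)) (Psum (cof n a b) x).
  move=> e /L1[N0 H]; exists N0 => N hN; apply: H; by rewrite (leq_trans hN) // leq_addl.
apply: qlim_eq L1 => N; rewrite /qpart big_split_ord /= big1 ?add0r => [|m _]; last first.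
  by rewrite /cof leqNgt ltn_ord /= qmul0r.
rewrite qmul_sumr; apply: eq_bigr => m _; rewrite /cof leq_addr addKn !Pm_imag // qmulA; congr qmul.
elim: (n) => [|k IH]; first by rewrite add0n /= qmul1l.
by rewrite addSn /= IH qmulA.
Qed.

Lemma Pm_square_sum (y : quat R) : Ell y -> exists C : R, forall M, \sum_(n < M) qn (Pm n y) ^+ 2 <= C.
Proof.
move=> Ey; have [|rho [C [r0 yr r1 hC]]] := @majorant _ (qn y); first by rewrite qn_ge0 Ell_qn.
exists C => M; apply: le_trans (hC M); apply: ler_sum => n _.
have rn : 0 <= rho ^+ n by rewrite exprn_ge0 // ltW.
have := jet_val (jet_Pm n r0) (ltW yr) => h.
apply: (@le_trans _ _ ((n.+2%:R * rho ^+ n) ^+ 2)).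
  by rewrite lerXn2r ?nnegrE ?qn_ge0 // mulr_ge0.
rewrite exprMn ler_pM ?sqr_ge0 //; first by rewrite ler_weXn2l // ler1n.
by rewrite expr2 ler_piMr // exprn_ile1 // ltW.
Qed.

Section Points.
Variables (N : nat) (ys : 'I_N -> quat R) (us : 'I_N -> 'I_r -> quat R).
Hypothesis Ey : forall i, Ell (ys i).

(** [kw] is the entrywise limit of the truncated adjoints applied to [kh], each bounded by [H]; a
    section of fixed length passes to the limit. *)
Lemma kw_contraction (H : R) : (forall M, nrm2 M (kh ys us) <= H) -> forall M, nrm2 M (kw CKprod ys us) <= H.
Proof.
move=> hH M.
have L n l : qlim (fun M' => adj Sn M' (kh ys us) n l) (kw CKprod ys us n l).
  have K : qlim (fun M' => \sum_(j < N) \sum_(b < r) qmul (qconj (qpart (fun k => qmul (Pm k (ys j)) (cof n b l k)) M')) (us j b))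
     (kw CKprod ys us n l).
    rewrite /kw; apply: qlim_sum => j; apply: qlim_sum => b; apply: qlimMr; apply: qlim_conj.
    by rewrite mxE; apply: Psum_cvg => //; exact: Ell_qn.
  apply: qlim_eq K => M'; rewrite /adj [RHS]big_mkcond /=.
  transitivity (\sum_(j < N) \sum_(b < r) \sum_(k < M') qmul (qmul (qconj (cof n b l k)) (qconj (Pm k (ys j)))) (us j b)).
    apply: eq_bigr => j _; apply: eq_bigr => b _; rewrite qconj_sum qmul_suml; apply: eq_bigr => k _.
    by rewrite qconjM.
  transitivity (\sum_(j < N) \sum_(k < M') \sum_(b < r) qmul (qmul (qconj (cof n b l k)) (qconj (Pm k (ys j)))) (us j b)).
    by apply: eq_bigr => j _; rewrite exchange_big.
  rewrite exchange_big /=; apply: eq_bigr => k _; case: ifP => nk.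
    rewrite exchange_big /=; apply: eq_bigr => b _; rewrite /kh qmul_sumr; apply: eq_bigr => j _.
    by rewrite /cof nk qmulA.
  by rewrite big1 // => j _; rewrite big1 // => b _; rewrite /cof nk qconj0 !qmul0l.
have C : (fun M' => nrm2 M (adj Sn M' (kh ys us))) @ \oo --> nrm2 M (kw CKprod ys us).
  apply: cvg_sumr => n; apply: cvg_sumr => l; exact: qlim_qnorm2.
apply: (lim_le_eventually (N0 := M) C) => M' hM.
by rewrite (le_trans (nrm2_le _ hM)) // (le_trans (afc _ _)).
Qed.

Lemma kh_bounded : exists H : R, forall M, nrm2 M (kh ys us) <= H.
Proof.
have [C hC] := choice (fun j => Pm_square_sum (Ey j)).
exists ((\sum_(j < N) Num.sqrt (C j * vnorm2 (us j))) ^+ 2) => M.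
rewrite -nN_sqr lerXn2r ?nnegrE ?nN_ge0 ?sumr_ge0 //.
have st j : nN M (fun n a => qmul (qconj (Pm n (ys j))) (us j a)) <= Num.sqrt (C j * vnorm2 (us j)).
  rewrite ler_wsqrtr //; apply: (@le_trans _ _ (\sum_(n < M) qn (Pm n (ys j)) ^+ 2 * vnorm2 (us j))).
    apply: ler_sum => n _; rewrite /vnorm2 mulr_sumr ler_sum // => a _.
    by rewrite qnorm2M qnorm2_conj qn_sqr.
  by rewrite -mulr_suml ler_wpM2r ?vnorm2_ge0.
rewrite /kh; elim: (index_enum 'I_N) => [|j t IH].
  rewrite big_nil (nN_eq (g := fun n a => 0)) => [|n a _]; last by rewrite big_nil.
  by rewrite nN_zero.
rewrite big_cons; apply: le_trans (lerD (st j) IH).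
by rewrite (le_trans _ (nND _ _ _)) //; under nN_eq do rewrite big_cons.
Qed.

(** At finite [n0] the difference need not be nonnegative, since the adjoint at an index below [n0]
    also involves [kh] beyond [n0]. Replacing the section of [kh] by its full norm [Z] does not
    change the limit and makes every term nonnegative. *)
Lemma kernel_form_ge0 (l : R) :
  (fun n0 => nrm2 n0 (kh ys us) - nrm2 n0 (kw CKprod ys us)) @ \oo --> l -> 0 <= l.
Proof.
move=> L; have [H hH] := kh_bounded.
have nd : nondecreasing_seq (fun M => nrm2 M (kh ys us)) by move=> m n; exact: nrm2_le.
have ub : has_ubound (range (fun M => nrm2 M (kh ys us))).
  by exists H => _ [M _ <-].
have cv := nondecreasing_is_cvgn nd ub.
pose Z := limn (fun M => nrm2 M (kh ys us)).
have hZ M : nrm2 M (kh ys us) <= Z by exact: nondecreasing_cvgn_le.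
have {}cv : (fun M => nrm2 M (kh ys us)) @ \oo --> Z by exact: cv.
have D : (fun M => (nrm2 M (kh ys us) - nrm2 M (kw CKprod ys us)) - (nrm2 M (kh ys us) - Z)) @ \oo --> l - (Z - Z).
  by apply: cvgB => //; apply: cvgB => //; exact: cvg_cst.
rewrite subrr subr0 in D.
apply: (lim_ge_eventually (N0 := 0%N) D) => M _; have := kw_contraction hZ M.
lra.
Qed.

End Points.

(** For the single point [x] and the basis vector at [a], [kw] consists of the conjugates of row [a]
    of the products. *)
Lemma CKprod_square_sum x a : Ell x ->
  exists C : R, forall M, \sum_(n < M) \sum_(k < s) qn (CKprod n x a k) ^+ 2 <= C.
Proof.
move=> Ex; pose ys (_ : 'I_1) := x; pose us (_ : 'I_1) := @bas R r a.
have [C hC] := kh_bounded us (fun i : 'I_1 => Ex); exists C => M.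
apply: le_trans (kw_contraction (fun i : 'I_1 => Ex) hC M).
apply: ler_sum => n _; apply: ler_sum => k _.
rewrite /kw big_ord1 (bigD1 a) //= big1 => [|b /negbTE ba]; last by rewrite /us /bas ba qmul0r.
by rewrite addr0 /us /bas eqxx qmul1r qnorm2_conj qn_sqr.
Qed.

Lemma Kterm_bound n x y (a b : 'I_r) :
  qn (Kterm CKprod n x y a b) <= qn (Pm n x) ^+ 2 + qn (Pm n y) ^+ 2 +
   (\sum_(k < s) qn (CKprod n x a k) ^+ 2 + \sum_(k < s) qn (CKprod n y b k) ^+ 2).
Proof.
have P (p q : R) : 0 <= p -> 0 <= q -> p * q <= p ^+ 2 + q ^+ 2.
  by move=> p0 q0; have := sqr_ge0 (p - q); rewrite sqrrB -mulr_natr; have := mulr_ge0 p0 q0; lra.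
rewrite /Kterm (le_trans (qnB _ _)) // lerD //.
  case: ifP => _; last by rewrite qn0 addr_ge0 ?sqr_ge0.
  by rewrite qnM qn_conj P ?qn_ge0.
rewrite (le_trans (qn_sum _ _ _)) // -big_split ler_sum //= => k _.
by rewrite qnM qn_conj P ?qn_ge0.
Qed.

Lemma Kterm_summable x y (a b : 'I_r) : Ell x -> Ell y ->
  qlim (qpart (fun n => Kterm CKprod n x y a b)) (qsum (fun n => Kterm CKprod n x y a b)).
Proof.
move=> Ex Ey; have [C1 h1] := Pm_square_sum Ex; have [C2 h2] := Pm_square_sum Ey.
have [C3 h3] := CKprod_square_sum a Ex; have [C4 h4] := CKprod_square_sum b Ey.
pose B n := qn (Pm n x) ^+ 2 + qn (Pm n y) ^+ 2 +
   (\sum_(k < s) qn (CKprod n x a k) ^+ 2 + \sum_(k < s) qn (CKprod n y b k) ^+ 2).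
have B0 n : 0 <= B n by rewrite !addr_ge0 ?sqr_ge0 // sumr_ge0 // => k _; rewrite sqr_ge0.
have BS M : \sum_(n < M) B n <= C1 + C2 + (C3 + C4) by rewrite /B !big_split /= !lerD ?h1 ?h2 ?h3 ?h4.
apply: (qsum_lim B0 BS ler01) => n; rewrite mul1r; exact: Kterm_bound.
Qed.

Lemma contraction_schur : schur_multiplier S.
Proof.
exists CKprod; split; first exact: CKprodP.
pose K x y a b := qsum (fun n => Kterm CKprod n x y a b).
have hK x y : Ell x -> Ell y -> forall a b,
    (fun N => \sum_(n < N) Kterm CKprod n x y a b) @ \oo --> K x y a b.
  by move=> Ex Ey a b; apply/qlimP; exact: Kterm_summable.
exists K; split => // N ys us Ey.
have [q1 q2 q3 L] := qlim_scalar (kernel_quad_lim us Ey hK).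
by split => //; exact: kernel_form_ge0 L.
Qed.

End Backward.
End Main.

Theorem mainTheorem10 (R : realType) (r s : nat) (S : quat R -> 'M[quat R]_(r, s)) :
  hyperholo_mx (@Ell R) S ->
  (schur_multiplier S <->
   exists Sn : nat -> 'M[quat R]_(r, s),
     has_P_expansion S Sn /\ toeplitz_contraction Sn).
Proof.
move=> hS; split=> [|[Sn [hexp hT]]]; first exact: schur_expansion.
exact: contraction_schur hexp hT.
Qed.
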